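(* Let $K\subset\mathbb{C}$ be a compact set with no isolated points which is $J$-like relative to a domain $U\subset\mathbb{C}$. Then at least one of the following holds: (1) every non-trivial family of symmetries of $K$ defined on $U$ is finite; (2) every open subset of $U$ intersecting $K$ contains a simply connected domain $\Omega$ such that $\overline{\Omega}\cap K$ is analytically diffeomorphic to a product $[0,1]\times L\subset\mathbb{C}$ with $L\subset i\mathbb{R}$ a non-empty compact set; that is, there is an analytic diffeomorphism $\psi$ (i.e. a univalent map) defined in a neighborhood of $\overline{\Omega}$ such that $\psi(\overline{\Omega}\cap K)=[0,1]\times L:=\{x+y: x\in[0,1], y\in L\}$.
   Context: A domain is an open connected subset of the plane. Univalent means holomorphic and injective. Symmetry: for a compact $K\subset\mathbb{C}$ and a domain $D\subset\mathbb{C}$ with $D\cap K\neq\emptyset$, a holomorphic map $H:D\to\mathbb{C}$ is a (local holomorphic) symmetry of $K$ on $D$ if for $x\in D$: $x\in D\cap K \Leftrightarrow H(x)\in H(D)\cap K$. A family $\mathcal{H}$ of symmetries of $K$ on a domain $D$ is non-trivial if it is a normal family (every sequence in $\mathcal H$ has a subsequence converging uniformly on compact subsets of $D$) and no limit function (of a sequence in $\mathcal H$ converging uniformly on compacts) is constant. A point $b\in D$ is an attracting fixed point of a holomorphic $H:D\to\mathbb{C}$ if $H(b)=b$ and $0<|H'(b)|<1$. A compact $K\subset\mathbb{C}$ is $J$-like relative to a domain $U$ if the set of points of $U\cap K$ that are attracting fixed points of local holomorphic symmetries of $K$ (each defined on some domain containing the point) is dense in $U\cap K$. *)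

(* Defs.v *)
From HB Require Import structures.
From mathcomp Require Import all_boot all_order all_algebra.
From mathcomp Require Import all_classical all_reals all_analysis.
From mathcomp Require Import complex.
Import Order.TTheory GRing.Theory Num.Theory.
Import numFieldNormedType.Exports.

Set Implicit Arguments.
Unset Strict Implicit.
Unset Printing Implicit Defensive.

Local Open Scope classical_set_scope.
Local Open Scope complex_scope.
Local Open Scope ring_scope.

(* The complex plane is [R[i]^o], the numeric field [R[i]] seen as a normed
   space over itself, so that [derivable f z 1] is complex differentiability
   and [derive1 f] is the complex derivative.  A function defined on a domain
   [D] is a total function whose values outside [D] are ignored. *)

Section ComplexPlane.
Variable R : realType.
Local Notation C := (R[i]^o).
Implicit Types (A D K U : set C) (f H : C -> C) (F : set (C -> C)).

Definition domain D := open D /\ connected D.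

Definition holomorphic D f := forall z, D z -> derivable f z 1.

Definition univalent D f := holomorphic D f /\ {in D &, injective f}.

Local Notation I01 := (`[0%R, 1%R]%classic : set R).

(* Every loop in [A] is homotopic in [A], with fixed base point, to a constant
   loop.  Path connectedness is not included: this is only applied to domains,
   for which it is automatic. *)
Definition loops_contractible A :=
  forall gamma : R -> C,
    {within I01, continuous gamma} -> gamma @` I01 `<=` A ->
    gamma 0 = gamma 1 ->
  exists h : R * R -> C,
    [/\ {within I01 `*` I01, continuous h},
        h @` (I01 `*` I01) `<=` A,
        (forall t, I01 t -> h (0, t) = gamma t /\ h (1, t) = gamma 0) &
        (forall s, I01 s -> h (s, 0) = gamma 0 /\ h (s, 1) = gamma 0)].

Definition simply_connected_domain D := domain D /\ loops_contractible D.

Definition symmetry K D H :=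
  [/\ domain D, D `&` K !=set0, holomorphic D H &
      forall x, D x -> ((D `&` K) x <-> (H @` D `&` K) (H x))].

Definition cvg_unif_on_compacts D (u : nat -> C -> C) (g : C -> C) :=
  {family compactly_in D, u @ \oo --> g}.

Definition normal_family D F :=
  forall u : nat -> C -> C, (forall n, F (u n)) ->
  exists phi : nat -> nat, {homo phi : m n / (m < n)%N} /\
    exists g : C -> C, cvg_unif_on_compacts D (u \o phi) g.

Definition constant_on D f := exists c : C, forall z, D z -> f z = c.

Definition nontrivial_family D F :=
  normal_family D F /\
  (forall (u : nat -> C -> C) (g : C -> C), (forall n, F (u n)) ->
    cvg_unif_on_compacts D u g -> ~ constant_on D g).

(* Members of [F] are identified when they agree on [D]. *)
Definition finite_family D F := finite_set [set f \_ D | f in F].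

Definition attracting_fixed_point H (b : C) :=
  H b = b /\ 0 < `|derive1 H b| < 1.

Definition attracting_points K : set C :=
  [set b | exists D H, [/\ symmetry K D H, D b & attracting_fixed_point H b]].

Definition J_like K U :=
  U `&` K `<=` closure (U `&` K `&` attracting_points K).

Definition unit_interval_times (L : set C) : set C :=
  [set x%:C + y | x in I01 & y in L].

Definition imaginary_axis : set C := [set z | complex.Re z = 0].

Definition product_piece K (Omega : set C) :=
  simply_connected_domain Omega /\
  exists (N : set C) (psi : C -> C) (L : set C),
    [/\ open N, closure Omega `<=` N & univalent N psi] /\
    [/\ L !=set0, compact L, L `<=` imaginary_axis &
        psi @` (closure Omega `&` K) = unit_interval_times L].

End ComplexPlane.

(* Main.v *)
Require Import Defs.
From HB Require Import structures.
From mathcomp Require Import all_boot all_order all_algebra.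
From mathcomp Require Import all_classical all_reals all_analysis.
From mathcomp Require Import complex.
From mathcomp Require Import ring lra.
Import Order.TTheory GRing.Theory Num.Theory.
Import numFieldNormedType.Exports.

(* If (1) fails, a nontrivial family contains pairwise distinct symmetries
   u_n converging to a nonconstant map g.  Choose an attracting fixed point b
   of a symmetry G, near the prescribed point of K, with g'(b) <> 0.  The maps
   h_n = u_n^-1 o u_(n+1) are local symmetries of K near b, different from the
   identity, and they tend to the identity.  In the Koenigs coordinate of G at
   b the set K is invariant under z |-> l z, where l = G'(b), so it is also
   (nearly) invariant under l^-k h_n l^k.  As k grows these maps look like
   z |-> z + t z^p with t -> 0, for a fixed p.  Away from 0 the vector field
   z^p can be rectified, K becomes invariant under arbitrarily small steps that
   are almost translations in a fixed direction, and, being closed, under the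
   translations themselves: it is locally a product. *)

(** Neither the limit [g] nor the maps [u_n] need be close to the identity; only quotients of
    consecutive maps are, and these can be formed on a fixed disc about [b] because [g'(b)] is
    nonzero. The prescribed point of [K] may itself be critical for [g]. Critical points are
    isolated and [K] has no isolated points, so attracting points that are not critical lie
    arbitrarily close to it. The rescaled maps are controlled with an error small relative to the
    step [|t|], not merely small: covering a fixed distance takes about [1 / |t|] iterations, whose
    errors add up. The steps [t] are complex, and their arguments need not converge; compactness of
    the unit circle selects one direction. Iteration then moves points forward only, and backward
    motion comes from the inverse maps. For [p > 0] the field [z^p] vanishes at [0], so the product
    structure is found not at [b] but at a nearby point of [K], which exists because [b] is not
    isolated in [K]. *)

Set Implicit Arguments.
Unset Strict Implicit.
Unset Printing Implicit Defensive.

Local Open Scope classical_set_scope.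
Local Open Scope complex_scope.
Local Open Scope ring_scope.

(** * Modulus and complex derivative *)

Section Modulus.
Variable R : realType.
Local Notation C := R[i].

(* The order and the norm of [R[i]] take values in [R[i]]; [nm] is the modulus
   as a real number. *)
Definition nm (z : C) : R := ComplexField.Normc.normc (z : R[i]).

Lemma normE (z : C) : `|z| = (nm z)%:C.
Proof. by []. Qed.

Lemma nm0 : nm 0 = 0. Proof. exact: ComplexField.Normc.normc0. Qed.
Lemma nm1 : nm 1 = 1. Proof. exact: ComplexField.Normc.normc1. Qed.
Lemma nmM x y : nm (x * y) = nm x * nm y.
Proof. exact: ComplexField.Normc.normcM. Qed.
Lemma nmV x : nm x^-1 = (nm x)^-1.
Proof. exact: ComplexField.Normc.normcV. Qed.
Lemma nm_ge0 x : 0 <= nm x.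
Proof. by rewrite -ler0c -normE normr_ge0. Qed.
Lemma nm_eq0 x : (nm x == 0) = (x == 0).
Proof. by apply/eqP/eqP => [/ComplexField.Normc.eq0_normc|->]; rewrite ?nm0. Qed.
Lemma nm_gt0 x : (0 < nm x) = (x != 0).
Proof. by rewrite lt_def nm_ge0 andbT nm_eq0. Qed.
Lemma nmD x y : nm (x + y) <= nm x + nm y.
Proof. by rewrite -lecR rmorphD /= -!normE ler_normD. Qed.
Lemma nmN x : nm (- x) = nm x.
Proof. by apply: complexI; rewrite -!normE normrN. Qed.
Lemma nmB x y : nm (x - y) = nm (y - x).
Proof. by rewrite -nmN opprB. Qed.
Lemma nmX x n : nm (x ^+ n) = nm x ^+ n.
Proof. by elim: n => [|n IH]; rewrite ?expr0 ?nm1// !exprS nmM IH. Qed.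
Lemma nm_real (x : R) : nm x%:C = `|x|.
Proof. by rewrite /nm /= expr0n addr0 sqrtr_sqr. Qed.
Lemma nm_i : nm 'i = 1.
Proof. by rewrite /nm /= expr0n add0r expr1n sqrtr1. Qed.
Lemma nm_nat n : nm (n%:R) = n%:R.
Proof. by rewrite -(rmorph_nat (real_complex R)) nm_real ger0_norm. Qed.
Lemma nm_tri y x z : nm (x - z) <= nm (x - y) + nm (y - z).
Proof. by have := nmD (x - y) (y - z); rewrite addrA subrK. Qed.
Lemma nmBl x y : nm x - nm y <= nm (x - y).
Proof. by rewrite lerBlDr; have := nmD (x - y) y; rewrite subrK. Qed.
Lemma nm_Re x : `|complex.Re x| <= nm x.
Proof.
by case: x => a b /=; rewrite -sqrtr_sqr ler_wsqrtr // lerDl sqr_ge0.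
Qed.
Lemma nm_Im x : `|complex.Im x| <= nm x.
Proof.
by case: x => a b /=; rewrite -sqrtr_sqr ler_wsqrtr // lerDr sqr_ge0.
Qed.
Lemma nm_ReIm x : nm x <= `|complex.Re x| + `|complex.Im x|.
Proof.
rewrite {1}[x]complexE; apply: le_trans (nmD _ _) _.
by rewrite nmM nm_i mul1r !nm_real.
Qed.

Lemma nm_le0 x : (nm x <= 0) = (x == 0).
Proof. by rewrite le_eqVlt ltNge nm_ge0 orbF nm_eq0. Qed.

End Modulus.
Arguments nm_tri {R} y x z.

Section ComplexDerivative.
Variable R : realType.
Local Notation C := R[i].
Implicit Types (f g : C -> C) (z w l a b : C) (e d r s M : R).

(** The quotient-free form of the complex derivative: [w = z] needs no exception, and all tolerances
    are real numbers instead of elements of the partially ordered field [R[i]]. *)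
Definition cder f z l := forall e, 0 < e ->
  exists2 d : R, 0 < d & forall w, nm (w - z) < d ->
    nm (f w - f z - l * (w - z)) <= e * nm (w - z).

Definition holo_on a r f f' := forall z, nm (z - a) < r -> cder f z (f' z).

(** Comparison with [0] in [R[i]] forces the imaginary part to vanish, so complex tolerances can be
    replaced by real ones. *)
Lemma gt0CE (e : C) : 0 < e -> exists2 d : R, 0 < d & e = d%:C.
Proof.
by case: e => a b; rewrite ltcE /= => /andP[/eqP -> a0]; exists a.
Qed.

Lemma nbhs_nmP (z : R[i]^o) (P : R[i]^o -> Prop) :
  (\forall w \near z, P w) <-> exists2 d : R, 0 < d & forall w, nm (w - z) < d -> P w.
Proof.
split=> [/nbhs_normP[e /= /gt0CE[d d0 ->] dP]|[d d0 dP]].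
  exists d => // w wz; apply: dP; rewrite /= normE ltcR.
  by rewrite nmB.
apply/nbhs_normP; exists d%:C; rewrite /= ?ltcR // => w /=.
by rewrite normE ltcR nmB => /dP.
Qed.

Lemma is_deriveE (K : numFieldType) (f : K^o -> K^o) (x l : K^o) :
  is_derive x 1 f l <-> (fun h : K^o => h^-1 * (f (h + x) - f x)) @ (0:K^o)^' --> l.
Proof.
have E : (fun h : K^o => h^-1 *: ((f \o shift x) (h *: (1:K^o)) - f x)) =
         (fun h : K^o => h^-1 * (f (h + x) - f x)).
  by apply/funext => h /=; rewrite /GRing.scale /= mulr1.
split=> [[]|h].
  by rewrite /derivable /derive E => c <-.
apply: DeriveDef; rewrite /derivable /derive E.
  by apply/cvg_ex; exists l.
by apply: cvg_lim => //; exact: norm_hausdorff.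
Qed.

Lemma cder_derive (f : R[i]^o -> R[i]^o) (z l : R[i]^o) :
  cder f z l <-> is_derive z 1 f l.
Proof.
rewrite is_deriveE; split=> [fl|fl].
  apply/cvgrPdist_le => _/gt0CE[e e0 ->].
  have [d d0 dP] := fl e e0.
  near=> h.
  have h0 : h != 0 by near: h; exact: nbhs_dnbhs_neq.
  have hd : nm h < d.
    near: h; apply: nbhs_dnbhs; apply/nbhs_nmP; exists d => // w.
    by rewrite subr0.
  have := dP (h + z); rewrite addrK => /(_ hd) H.
  rewrite normE lecR.
  have -> : l - h^-1 * (f (h + z) - f z) = - (h^-1 * (f (h + z) - f z - l * h)).
    by field.
  rewrite nmN nmM nmV mulrC ler_pdivrMr ?nm_gt0 //.
move=> e e0; move/cvgrPdist_le: fl => /(_ e%:C); rewrite ltcR => /(_ e0).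
rewrite nearE /= /within /= => /nbhs_nmP[d d0 dP]; exists d => // w wd.
have [->|wz] := eqVneq w z; first by rewrite !subrr mulr0 subr0 nm0 mulr0.
have wz0 : w - z != 0 by rewrite subr_eq0.
have := dP (w - z); rewrite subr0 => /(_ wd wz0).
rewrite normE lecR subrK.
have -> : f w - f z - l * (w - z) = - ((l - (w - z)^-1 * (f w - f z)) * (w - z)).
  by field.
rewrite nmN nmM; apply: ler_wpM2r => //; exact: nm_ge0.
Unshelve. all: by end_near.
Qed.

Lemma cder_derivable (f : R[i]^o -> R[i]^o) (z l : R[i]^o) : cder f z l -> derivable f z 1.
Proof. by move/cder_derive => [].  Qed.

Lemma cder_derive1 (f : R[i]^o -> R[i]^o) (z l : R[i]^o) : cder f z l -> derive1 f z = l.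
Proof. by move/cder_derive => [_ <-]; rewrite derive1E. Qed.

Lemma derivable_cder (f : R[i]^o -> R[i]^o) (z : R[i]^o) : derivable f z 1 -> cder f z (derive1 f z).
Proof.
move=> h; rewrite derive1E; apply/cder_derive; exact: (derivableP h).
Qed.

Lemma cder_uniq f z l k : cder f z l -> cder f z k -> l = k.
Proof. by move=> /cder_derive1 <- /cder_derive1 <-. Qed.

(** Absorbs a constant factor in the error, so that the differentiation rules need not normalise
    their estimates. *)
Lemma cder_leM f z l k : (forall e, 0 < e ->
  exists2 d : R, 0 < d & forall w, nm (w - z) < d ->
    nm (f w - f z - l * (w - z)) <= k * e * nm (w - z)) -> cder f z l.
Proof.
move=> H e e0; have k1 : 0 < `|k| + 1 by rewrite ltr_pwDr.
have [|d d0 dP] := H (e / (`|k| + 1)); first by rewrite divr_gt0.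
exists d => // w /dP /le_trans; apply; apply: ler_wpM2r; first exact: nm_ge0.
rewrite mulrA ler_pdivrMr // mulrC ler_pM2l //.
by rewrite (le_trans (ler_norm _)) // lerDl.
Qed.

Lemma cder_near f g z l r : 0 < r -> (forall w, nm (w - z) < r -> f w = g w) ->
  cder f z l -> cder g z l.
Proof.
move=> r0 fg fl e e0; have [d d0 dP] := fl e e0.
exists (Num.min d r) => [|w]; first by rewrite lt_min d0.
rewrite lt_min => /andP[wd wr]; rewrite -!fg ?dP //.
by rewrite subrr nm0.
Qed.

Lemma cder_ext f g z l : f =1 g -> cder f z l -> cder g z l.
Proof. by move=> fg; apply: (@cder_near _ _ _ _ 1) => // w _; exact: fg. Qed.

Lemma cder_cst c z : cder (fun=> c) z 0.
Proof.
move=> e e0; exists 1 => // w _; rewrite !subrr mul0r subr0 nm0.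
by rewrite mulr_ge0 ?nm_ge0 // ltW.
Qed.

Lemma cder_id z : cder id z 1.
Proof.
move=> e e0; exists 1 => // w _; rewrite mul1r subrr nm0.
by rewrite mulr_ge0 ?nm_ge0 // ltW.
Qed.

Lemma cderD f g z l k : cder f z l -> cder g z k ->
  cder (fun w => f w + g w) z (l + k).
Proof.
move=> fl gk; apply: (@cder_leM _ _ _ 2) => e e0.
have [d d0 dP] := fl e e0; have [d' d'0 d'P] := gk e e0.
exists (Num.min d d') => [|w]; first by rewrite lt_min d0.
rewrite lt_min => /andP[/dP wd /d'P wd'].
rewrite (_ : _ - _ = (f w - f z - l * (w - z)) + (g w - g z - k * (w - z))); last by ring.
by apply: le_trans (nmD _ _) _; lra.
Qed.

Lemma cderZ c f z l : cder f z l -> cder (fun w => c * f w) z (c * l).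
Proof.
move=> fl; apply: (@cder_leM _ _ _ (nm c)) => e e0.
have [d d0 dP] := fl e e0; exists d => // w /dP wd.
rewrite (_ : _ - _ = c * (f w - f z - l * (w - z))); last by ring.
by rewrite nmM -mulrA; apply: ler_wpM2l => //; exact: nm_ge0.
Qed.

Lemma cderN f z l : cder f z l -> cder (fun w => - f w) z (- l).
Proof.
move=> /(cderZ (-1)); rewrite mulN1r; apply: cder_ext => w.
by rewrite mulN1r.
Qed.

Lemma cderB f g z l k : cder f z l -> cder g z k ->
  cder (fun w => f w - g w) z (l - k).
Proof. by move=> fl /cderN; exact: cderD. Qed.

Lemma cder_lip f z l : cder f z l -> exists2 d : R, 0 < d & forall w, nm (w - z) < d ->
  nm (f w - f z) <= (nm l + 1) * nm (w - z).
Proof.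
move=> /(_ 1 ltr01)[d d0 dP]; exists d => // w /dP wd.
rewrite -[f w - f z](subrK (l * (w - z))) (le_trans (nmD _ _)) // nmM.
by lra.
Qed.

Lemma cder_cont f z l e : cder f z l -> 0 < e -> exists2 d : R, 0 < d &
  forall w, nm (w - z) < d -> nm (f w - f z) < e.
Proof.
move=> /cder_lip[d d0 dP] e0.
have l1 : 0 < nm l + 1 by rewrite ltr_wpDl ?nm_ge0.
exists (Num.min d (e / (nm l + 1))) => [|w]; first by rewrite lt_min d0 divr_gt0.
rewrite lt_min ltr_pdivlMr // mulrC => /andP[/dP wd]; exact: le_lt_trans.
Qed.

Lemma cder_comp g f z l k : cder f z l -> cder g (f z) k ->
  cder (fun w => g (f w)) z (k * l).
Proof.
move=> fl gk; apply: (@cder_leM _ _ _ (nm l + 1 + nm k)) => e e0.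
have [d2 d20 d2P] := gk e e0.
have [d1 d10 d1P] := fl e e0; have [d3 d30 d3P] := cder_cont fl d20.
have [d4 d40 d4P] := cder_lip fl.
exists (Num.min (Num.min d1 d4) d3) => [|w]; first by rewrite !lt_min d10 d30 d40.
rewrite !lt_min => /andP[/andP[/d1P w1 /d4P w4] /d3P/d2P w3].
rewrite (_ : _ - _ = (g (f w) - g (f z) - k * (f w - f z)) +
   k * (f w - f z - l * (w - z))); last by ring.
apply: le_trans (nmD _ _) _; rewrite nmM.
have := ler_wpM2l (ltW e0) w4; have := ler_wpM2l (nm_ge0 k) w1.
by lra.
Qed.

Lemma cder_inv z : z != 0 -> cder (fun w => w^-1) z (- (z ^+ 2)^-1).
Proof.
move=> z0 e e0; have nz : 0 < nm z by rewrite nm_gt0.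
(* The first radius keeps [|w| > |z| / 2]; the second then makes [|w - z| / (|z|^2 |w|)] at most
   [e]. *)
exists (Num.min (nm z / 2) (e * nm z ^+ 3 / 2)) => [|w].
  by rewrite lt_min !divr_gt0 // mulr_gt0 // exprn_gt0.
rewrite lt_min => /andP[w1 w2].
have w3 : nm z / 2 < nm w.
  by have := nmBl z w; rewrite (nmB z w); lra.
have w0 : w != 0 by rewrite -nm_gt0; apply: lt_trans w3; rewrite divr_gt0.
rewrite (_ : _ - _ = (w - z) ^+ 2 / (z ^+ 2 * w)); last by field; rewrite w0.
rewrite nmM nmV nmM !nmX ler_pdivrMr ?mulr_gt0 ?exprn_gt0 ?nm_gt0 //.
rewrite expr2 [e * _]mulrC -mulrA; apply: ler_wpM2l; first exact: nm_ge0.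
apply: le_trans (ltW w2) _; rewrite -mulrA; apply: ler_wpM2l; first exact: ltW.
rewrite exprS mulrC mulrA [X in X <= _](_ : _ = nm z ^+ 2 * (nm z / 2)); last by ring.
by apply: ler_wpM2l; rewrite ?exprn_ge0 ?nm_ge0 // ltW.
Qed.

Lemma cderM f g z l k : cder f z l -> cder g z k ->
  cder (fun w => f w * g w) z (l * g z + f z * k).
Proof.
move=> fl gk; apply: (@cder_leM _ _ _ (nm (g z) + 1 + nm (f z) + nm l)) => e e0.
have [d1 d10 d1P] := fl e e0; have [d2 d20 d2P] := gk e e0.
have [d3 d30 d3P] := cder_cont gk e0; have [d4 d40 d4P] := cder_cont gk ltr01.
exists (Num.min (Num.min d1 d4) (Num.min d2 d3)) => [|w].
  by rewrite !lt_min d10 d20 d30 d40.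
rewrite !lt_min => /andP[/andP[/d1P w1 /d4P w4] /andP[/d2P w2 /d3P w3]].
rewrite (_ : _ - _ = (f w - f z - l * (w - z)) * g w + f z * (g w - g z - k * (w - z))
  + l * (w - z) * (g w - g z)); last by ring.
apply: le_trans (nmD _ _) _; apply: le_trans (lerD (nmD _ _) (lexx _)) _.
rewrite !nmM.
have gw : nm (g w) <= nm (g z) + 1.
  by have := nmBl (g w) (g z); lra.
have := ler_wpM2l (nm_ge0 (f z)) w2.
have := ler_pM (nm_ge0 _) (nm_ge0 _) w1 gw.
have lw : 0 <= nm l * nm (w - z) by rewrite mulr_ge0 ?nm_ge0.
have := ler_wpM2l lw (ltW w3).
by lra.
Qed.

Lemma cderX z n : cder (fun w => w ^+ n) z (n%:R * z ^+ n.-1).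
Proof.
elim: n => [|n IH]; first by rewrite mul0r; exact: cder_cst.
have := cderM (cder_id z) IH.
rewrite (_ : 1 * z ^+ n + _ = n.+1%:R * z ^+ n); last first.
  by case: n {IH} => [|n]; rewrite ?expr0 /= ?mul0r ?mulr0 ?addr0 // exprS -addn1 natrD; ring.
by apply: cder_ext => w; rewrite exprS.
Qed.

End ComplexDerivative.

(** * Primitives and integrals along segments *)

Section RealVariable.
Variable R : realType.
Local Notation C := R[i].
Implicit Types (G g : R -> C) (t s e d M : R) (u l : C).

Lemma real_deriveP (f : R -> R) t (l : R) :
  (forall e, 0 < e -> exists2 d : R, 0 < d & forall s, `|s - t| < d ->
     `|f s - f t - l * (s - t)| <= e * `|s - t|) ->
  is_derive t 1 f l.
Proof.
move=> H; apply/is_deriveE/cvgrPdist_le => e e0.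
have [d d0 dP] := H e e0.
near=> h.
have h0 : h != 0 by near: h; exact: nbhs_dnbhs_neq.
have hd : `|h| < d.
  near: h; apply: nbhs_dnbhs; apply/nbhs_normP; exists d => //= h.
  by rewrite /ball_ /= sub0r normrN.
have := dP (h + t); rewrite addrK => /(_ hd) {}H.
have -> : l - h^-1 * (f (h + t) - f t) = - (h^-1 * (f (h + t) - f t - l * h)).
  by field.
by rewrite normrN normrM normfV mulrC ler_pdivrMr ?normr_gt0.
Unshelve. all: by end_near.
Qed.

Lemma deriveP_real (f : R -> R) t (l : R) : is_derive t 1 f l ->
  forall e, 0 < e -> exists2 d : R, 0 < d & forall s, `|s - t| < d ->
     `|f s - f t - l * (s - t)| <= e * `|s - t|.
Proof.
move=> /is_deriveE/cvgrPdist_le fl e e0; have := fl e e0.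
rewrite nearE /= /within /= => /nbhs_normP[d /= d0 dP]; exists d => // s sd.
have [->|st] := eqVneq s t; first by rewrite !subrr mulr0 subr0 normr0 mulr0.
have st0 : s - t != 0 by rewrite subr_eq0.
have := dP (s - t); rewrite /ball_ /= sub0r normrN => /(_ sd st0).
rewrite subrK.
have -> : f s - f t - l * (s - t) = - ((l - (s - t)^-1 * (f s - f t)) * (s - t)).
  by field.
by rewrite normrN normrM; apply: ler_wpM2r.
Qed.

Definition rder G t l := forall e, 0 < e -> exists2 d : R, 0 < d & forall s, `|s - t| < d ->
  nm (G s - G t - (s - t)%:C * l) <= e * `|s - t|.

(** The mean value theorem has no analogue with equality for plane curves. It is applied to the real
    function [Re (u G)], where [u] is the conjugate of [G 1 - G 0]: its increment is the square of
    the modulus to be bounded. *)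
Lemma rder_mvi G (G' : R -> C) M :
  (forall t, 0 <= t <= 1 -> rder G t (G' t)) ->
  (forall t, 0 <= t <= 1 -> nm (G' t) <= M) -> nm (G 1 - G 0) <= M.
Proof.
move=> dG bG; set u := (G 1 - G 0)^*%C.
have dphi t : 0 <= t <= 1 ->
    is_derive t 1 (fun s => complex.Re (u * G s)) (complex.Re (u * G' t)).
  move=> t01; apply: real_deriveP => e e0.
  have u1 : 0 < nm u + 1 by rewrite ltr_wpDl ?nm_ge0.
  have [|d d0 dP] := dG t t01 (e / (nm u + 1)); first by rewrite divr_gt0.
  exists d => // s /dP sd.
  have -> : complex.Re (u * G s) - complex.Re (u * G t) - complex.Re (u * G' t) * (s - t)
      = complex.Re (u * (G s - G t - (s - t)%:C * G' t)).
    case: (G s) (G t) (G' t) u {dP sd u1} => a1 a2 [b1 b2] [c1 c2] [v1 v2] /=; ring.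
  apply: le_trans (nm_Re _) _; rewrite nmM.
  apply: le_trans (ler_wpM2l (nm_ge0 _) sd) _.
  rewrite mulrA ler_wpM2r // mulrA ler_pdivrMr // mulrC ler_wpM2l ?ltW //; lra.
have dphi' t : t \in `]0, 1[%R ->
    is_derive t 1 (fun s => complex.Re (u * G s)) (complex.Re (u * G' t)).
  by rewrite in_itv /= => /andP[/ltW t0 /ltW t1]; apply: dphi; rewrite t0.
have [|t t01 E] := MVT_segment ler01 dphi'.
  apply: derivable_within_continuous => t; rewrite in_itv /= => /dphi h.
  exact: ex_derive.
move: t01; rewrite in_itv /= => t01.
have [->|n0] := eqVneq (nm (G 1 - G 0)) 0.
  by apply: le_trans (bG t t01); exact: nm_ge0.
have np : 0 < nm (G 1 - G 0) by rewrite lt_def n0 nm_ge0.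
have nu : nm u = nm (G 1 - G 0).
  by rewrite /u; case: (G 1 - G 0) => a b; rewrite /nm /= sqrrN.
have {}E : nm (G 1 - G 0) ^+ 2 = complex.Re (u * G' t).
  rewrite subr0 mulr1 in E; rewrite -E /u.
  move: (G 1) (G 0) => [a1 a2] [b1 b2]; rewrite /nm /= sqr_sqrtr ?addr_ge0 ?sqr_ge0 //.
  by ring.
have : nm (G 1 - G 0) ^+ 2 <= nm (G 1 - G 0) * M.
  rewrite E; apply: le_trans (ler_norm _) _; apply: le_trans (nm_Re _) _.
  by rewrite nmM nu ler_wpM2l ?nm_ge0 // bG.
by rewrite expr2 ler_pM2l.
Qed.

Lemma real_primitive (g : R -> R) : continuous g ->
  exists G : R -> R, forall t, 0 <= t <= 1 -> is_derive t 1 G (g t).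
Proof.
(* Integrating from [-1], inside [[-1, 2]], makes every point of [[0, 1]] an interior point. *)
move=> cg; exists (fun x => (\int[lebesgue_measure]_(t in `[(-1)%R, x]) g t)%R) => t /andP[t0 t1].
have [||||dG E] := @continuous_FTC1_closed R g (-1) t 2.
- by apply: le_lt_trans t1 _; rewrite ltr1n.
- apply: continuous_compact_integrable; first exact: segment_compact.
  exact: continuous_subspaceT.
- by apply: lt_le_trans t0; rewrite ltrN10.
- exact: cg.
by apply: DeriveDef; rewrite -?derive1E.
Qed.

(* The integrand is extended to the whole line by clamping the variable to
   [[0, 1]], which makes the two endpoints ordinary points. *)
Lemma complex_primitive g :
  (forall t e, 0 <= t <= 1 -> 0 < e -> exists2 d : R, 0 < d &
     forall s, 0 <= s <= 1 -> `|s - t| < d -> nm (g s - g t) < e) ->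
  exists G, forall t, 0 <= t <= 1 -> rder G t (g t).
Proof.
move=> cg; pose c t : R := Num.max 0 (Num.min 1 t).
have c01 t : 0 <= c t <= 1.
  by rewrite /c le_max lexx /= ge_max ler01 ge_min lexx.
have cE t : 0 <= t <= 1 -> c t = t.
  by move=> /andP[t0 t1]; rewrite /c (min_idPr t1) (max_idPr t0).
have clip s t : `|c s - c t| <= `|s - t|.
  have n1 := ler_norm (s - t); have n2 := ler_norm (- (s - t)).
  rewrite normrN in n2.
  rewrite /c; case: (leP 1 s) => ?; case: (leP 1 t) => ?;
  case: (leP 0 _) => ?; try (case: (leP 0 _) => ?);
  rewrite ler_norml; apply/andP; split; lra.
have cont (p : C -> R) : (forall x y, `|p x - p y| <= nm (x - y)) ->
    continuous (fun t => p (g (c t))).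
  move=> pl t; apply/cvgrPdist_lt => e e0.
  have [d d0 dP] := cg (c t) e (c01 t) e0.
  near=> s; apply: le_lt_trans (pl _ _) _; rewrite nmB; apply: dP => //.
  apply: le_lt_trans (clip _ _) _; near: s.
  by apply/nbhs_normP; exists d => //= s; rewrite distrC.
have [] := real_primitive (cont (@complex.Re R) _).
  by move=> x y; rewrite -raddfB; exact: nm_Re.
move=> G1 G1P; have [] := real_primitive (cont (@complex.Im R) _).
  by move=> x y; rewrite -raddfB; exact: nm_Im.
move=> G2 G2P; exists (fun t => (G1 t +i* G2 t)%C) => t t01 e e0.
have e2 : 0 < e / 2 by rewrite divr_gt0.
have [d1 d10 d1P] := deriveP_real (G1P t t01) e2.
have [d2 d20 d2P] := deriveP_real (G2P t t01) e2.
exists (Num.min d1 d2) => [|s]; first by rewrite lt_min d10.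
rewrite lt_min => /andP[/d1P s1 /d2P s2].
rewrite cE // in s1 s2.
apply: le_trans (nm_ReIm _) _.
move: s1 s2; case: (g t) => a b /=; rewrite !mul0r subr0 addr0.
by rewrite ![_ * (s - t)]mulrC; lra.
Unshelve. all: by end_near.
Qed.

End RealVariable.

(** * Completeness of the plane and geometric sequences *)

Section Completeness.
Variable R : realType.
Local Notation C := R[i].

Lemma real_cauchy (u : nat -> R) :
  (forall e : R, 0 < e -> exists N, forall m n, (N <= m)%N -> (N <= n)%N ->
     `|u m - u n| <= e) ->
  exists l, forall e : R, 0 < e -> exists N, forall n, (N <= n)%N -> `|u n - l| <= e.
Proof.
move=> uC; have : cvg (u @ \oo).
  apply/cauchy_cvgP/cauchy_exP => e e0.
  have [|N NP] := uC (e / 2); first by rewrite divr_gt0.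
  exists (u N); exists N => // n /= Nn.
  by apply: le_lt_trans (NP _ _ _ _) _ => //; rewrite ltr_pdivrMr // ltr_pMr // ltr1n.
move=> /cvg_ex[l /cvgrPdist_le ul]; exists l => e /ul[N _ NP].
by exists N => n Nn; rewrite distrC; exact: NP.
Qed.

Lemma complex_cauchy (u : nat -> C) :
  (forall e : R, 0 < e -> exists N, forall m n, (N <= m)%N -> (N <= n)%N ->
     nm (u m - u n) <= e) ->
  exists l : C, forall e : R, 0 < e -> exists N, forall n, (N <= n)%N -> nm (u n - l) <= e.
Proof.
move=> uC; have [] := @real_cauchy (fun n => complex.Re (u n)).
  move=> e /uC[N NP]; exists N => m n Nm Nn; rewrite -raddfB.
  by apply: le_trans (nm_Re _) _; exact: NP.
move=> a aP; have [] := @real_cauchy (fun n => complex.Im (u n)).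
  move=> e /uC[N NP]; exists N => m n Nm Nn; rewrite -raddfB.
  by apply: le_trans (nm_Im _) _; exact: NP.
move=> b bP; exists (a +i* b)%C => e e0.
have e2 : 0 < e / 2 by rewrite divr_gt0.
have [N NP] := aP _ e2; have [M MP] := bP _ e2.
exists (maxn N M) => n; rewrite geq_max => /andP[/NP n1 /MP n2].
apply: le_trans (nm_ReIm _) _; rewrite !raddfB /=; lra.
Qed.

Lemma expr_small (q e : R) : 0 <= q < 1 -> 0 < e ->
  exists N, forall n, (N <= n)%N -> q ^+ n <= e.
Proof.
move=> /andP[q0 q1] e0.
have : (GRing.exp q @ \oo --> 0%R) by apply: cvg_expr; rewrite ger0_norm.
move=> /cvgrPdist_le/(_ e e0)[N _ NP]; exists N => n /NP /=.
by rewrite sub0r normrN ger0_norm // exprn_ge0.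
Qed.

(** The explicit tail, rather than mere convergence, is what the bisection in Goursat's theorem,
    Newton's iteration and the Koenigs limit use. *)
Lemma complex_geometric (u : nat -> C) (M q : R) : 0 <= q < 1 ->
  (forall n, nm (u n.+1 - u n) <= M * q ^+ n) ->
  exists l : C, forall n, nm (u n - l) <= M * q ^+ n / (1 - q).
Proof.
move=> /andP[q0 q1] du; have q1' : 0 < 1 - q by rewrite subr_gt0.
have M0 : 0 <= M by have := du 0%N; rewrite expr0 mulr1; apply: le_trans; exact: nm_ge0.
(* The factor [1 - q ^+ k] is the exact partial geometric sum, which lets the induction close. *)
have dist n k : nm (u (n + k)%N - u n) <= M * q ^+ n / (1 - q) * (1 - q ^+ k).
  elim: k => [|k IH]; first by rewrite addn0 subrr nm0 expr0 subrr mulr0.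
  apply: le_trans (nm_tri (u (n + k)%N) _ _) _; rewrite addnS.
  apply: le_trans (lerD (du _) IH) _; rewrite exprD exprS.
  by rewrite le_eqVlt; apply/orP; left; apply/eqP; field; exact: lt0r_neq0.
have dist' n k : nm (u (n + k)%N - u n) <= M * q ^+ n / (1 - q).
  apply: le_trans (dist n k) _; rewrite ler_piMr //.
    by rewrite !mulr_ge0 ?invr_ge0 ?exprn_ge0 // ltW.
  by rewrite lerBlDr lerDl exprn_ge0.
have [] := @complex_cauchy u.
  move=> e e0; have M1 : 0 < M + 1 by rewrite ltr_wpDl.
  have [||N NP] := @expr_small q (e * (1 - q) / (2 * (M + 1))).
  - by rewrite q0.
  - by rewrite divr_gt0 // mulr_gt0.
  have uN k : nm (u (N + k)%N - u N) <= e / 2.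
    apply: le_trans (dist' _ _) _; rewrite ler_pdivrMr //.
    have := NP N (leqnn _); rewrite ler_pdivlMr ?mulr_gt0 // => h.
    have qN := exprn_ge0 N q0; nra.
  exists N => m n /subnKC <- /subnKC <-.
  apply: le_trans (nm_tri (u N) _ _) _; rewrite [X in _ + X]nmB.
  have := uN (m - N)%N; have := uN (n - N)%N; lra.
move=> l lP; exists l => n; apply/ler_addgt0Pr => e /lP[N NP].
apply: le_trans (nm_tri (u (n + N)%N) _ _) _.
by rewrite nmB lerD // ?NP ?leq_addl.
Qed.

End Completeness.

(** * Integrals of functions of a complex variable along segments *)

Section SegmentIntegral.
Variable R : realType.
Local Notation C := R[i].
Implicit Types (f g : C -> C) (G : R -> C) (p q z v w l c : C) (t s e d M : R).

(** A tolerance is divided by [a + 1] rather than [a], so that the case [a = 0] needs no separate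
    treatment. *)
Lemma div_succ_le (e a x : R) : 0 <= e -> 0 <= a -> 0 <= x ->
  e / (a + 1) * (a * x) <= e * x.
Proof.
move=> e0 a0 x0; have a1 : 0 < a + 1 by rewrite ltr_wpDl.
rewrite -mulrA ler_wpM2l // mulrA ler_piMl // mulrC ler_pdivrMr // mul1r.
by rewrite lerDl.
Qed.

Definition seg p q t : C := p + t%:C * (q - p).

Lemma rder_comp_affine G t l (a b : R) : rder G (a * t + b) l ->
  rder (fun s => G (a * s + b)) t (a%:C * l).
Proof.
move=> Gl e e0; have a1 : 0 < `|a| + 1 by rewrite ltr_pwDr.
have [|d d0 dP] := Gl (e / (`|a| + 1)); first by rewrite divr_gt0.
exists (d / (`|a| + 1)) => [|s sd]; first by rewrite divr_gt0.
have E : a * s + b - (a * t + b) = a * (s - t) by ring.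
have := dP (a * s + b); rewrite E normrM.
rewrite (_ : (a * (s - t))%:C * l = (s - t)%:C * (a%:C * l)); last first.
  by rewrite rmorphM /=; ring.
move=> h; apply: le_trans (h _) _.
  rewrite ltr_pdivlMr // in sd; apply: le_lt_trans sd.
  by rewrite mulrC ler_wpM2l // lerDl.
exact: div_succ_le (ltW e0) _ _.
Qed.

Lemma rder_seg f p q t l : cder f (seg p q t) l ->
  rder (fun s => f (seg p q s)) t (l * (q - p)).
Proof.
move=> fl e e0; have a1 : 0 < nm (q - p) + 1 by rewrite ltr_wpDl ?nm_ge0.
have [|d d0 dP] := fl (e / (nm (q - p) + 1)); first by rewrite divr_gt0.
exists (d / (nm (q - p) + 1)) => [|s sd]; first by rewrite divr_gt0.
have E : seg p q s - seg p q t = (s - t)%:C * (q - p).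
  by rewrite /seg rmorphB /=; ring.
have := dP (seg p q s); rewrite E nmM nm_real.
rewrite (_ : l * ((s - t)%:C * (q - p)) = (s - t)%:C * (l * (q - p))); last by ring.
move=> h.
apply: le_trans (h _) _.
  rewrite ltr_pdivlMr // in sd; apply: le_lt_trans sd.
  by rewrite ler_wpM2l // lerDl.
by rewrite [X in _ * X]mulrC; apply: div_succ_le; rewrite ?nm_ge0 // ltW.
Qed.

Lemma rderD G H t l v : rder G t l -> rder H t v -> rder (fun s => G s + H s) t (l + v).
Proof.
move=> Gl Hv e e0; have e2 : 0 < e / 2 by rewrite divr_gt0.
have [d d0 dP] := Gl _ e2; have [d' d'0 d'P] := Hv _ e2.
exists (Num.min d d') => [|s]; first by rewrite lt_min d0.
rewrite lt_min => /andP[/dP sd /d'P sd'].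
rewrite (_ : _ - _ = (G s - G t - (s - t)%:C * l) + (H s - H t - (s - t)%:C * v)); last by ring.
by apply: le_trans (nmD _ _) _; lra.
Qed.

Lemma rderZ c G t l : rder G t l -> rder (fun s => c * G s) t (c * l).
Proof.
move=> Gl e e0; have c1 : 0 < nm c + 1 by rewrite ltr_wpDl ?nm_ge0.
have [|d d0 dP] := Gl (e / (nm c + 1)); first by rewrite divr_gt0.
exists d => // s /dP sd.
rewrite (_ : _ - _ = c * (G s - G t - (s - t)%:C * l)); last by ring.
rewrite nmM; apply: le_trans (ler_wpM2l (nm_ge0 _) sd) _.
by rewrite mulrCA; apply: div_succ_le; rewrite ?nm_ge0 // ltW.
Qed.

(* The integral along a segment is the increment of a primitive of the
   parametrized integrand, so no integration theory enters beyond
   [complex_primitive]. *)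
Definition has_int f p q v := exists2 G,
  (forall t, 0 <= t <= 1 -> rder G t (f (seg p q t) * (q - p))) & v = G 1 - G 0.

Lemma has_int_ex f p q :
  (forall t, 0 <= t <= 1 -> exists l, cder f (seg p q t) l) -> exists v, has_int f p q v.
Proof.
move=> df; have [] := @complex_primitive R (fun t => f (seg p q t) * (q - p)).
  move=> t e t01 e0; have [l fl] := df t t01.
  have a1 : 0 < nm (q - p) + 1 by rewrite ltr_wpDl ?nm_ge0.
  have [|d d0 dP] := @cder_cont _ _ _ _ (e / (nm (q - p) + 1)) fl.
    by rewrite divr_gt0.
  exists (d / (nm (q - p) + 1)) => [|s s01 sd]; first by rewrite divr_gt0.
  rewrite -mulrBl nmM; have := dP (seg p q s).
  have -> : seg p q s - seg p q t = (s - t)%:C * (q - p).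
    by rewrite /seg rmorphB /=; ring.
  rewrite nmM nm_real => /(_ _)/[dup] _ h.
  have {}h : nm (f (seg p q s) - f (seg p q t)) < e / (nm (q - p) + 1).
    apply: h; rewrite ltr_pdivlMr // in sd; apply: le_lt_trans sd.
    by rewrite ler_wpM2l // lerDl.
  rewrite ltr_pdivlMr // in h; apply: le_lt_trans h.
  by rewrite ler_wpM2l ?nm_ge0 // lerDl.
by move=> G GP; exists (G 1 - G 0), G.
Qed.

Lemma has_intD f g p q v w : has_int f p q v -> has_int g p q w ->
  has_int (fun z => f z + g z) p q (v + w).
Proof.
move=> [G GP ->] [H HP ->]; exists (fun s => G s + H s); last by ring.
by move=> t t01; rewrite mulrDl; apply: rderD; [exact: GP|exact: HP].
Qed.

Lemma has_intZ c f p q v : has_int f p q v -> has_int (fun z => c * f z) p q (c * v).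
Proof.
move=> [G GP ->]; exists (fun s => c * G s); last by ring.
by move=> t t01; rewrite -mulrA; apply: rderZ; exact: GP.
Qed.

Lemma has_int_le f p q v M : has_int f p q v ->
  (forall t, 0 <= t <= 1 -> nm (f (seg p q t)) <= M) -> nm v <= M * nm (q - p).
Proof.
move=> [G GP ->] fM; apply: rder_mvi GP _ => t t01.
by rewrite nmM ler_wpM2r ?nm_ge0 // fM.
Qed.

Lemma has_int_eq f g p q v : (forall t, 0 <= t <= 1 -> f (seg p q t) = g (seg p q t)) ->
  has_int f p q v -> has_int g p q v.
Proof. by move=> fg [G GP ->]; exists G => // t t01; rewrite -fg //; exact: GP. Qed.

Lemma has_int_uniq f p q v w : has_int f p q v -> has_int f p q w -> v = w.
Proof.
move=> fv /(has_intZ (-1)) /(has_intD fv) fw; apply/eqP.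
rewrite -subr_eq0 -nm_le0 -mulN1r.
rewrite -[X in _ <= X](mul0r (nm (q - p))); apply: has_int_le fw _ => t _.
by rewrite mulN1r subrr nm0.
Qed.

Lemma has_int_rev f p q v : has_int f p q v -> has_int f q p (- v).
Proof.
move=> [G GP ->]; exists (fun t => G (-1 * t + 1)); last first.
  by rewrite mulr1 mulr0 add0r addNr opprB.
move=> t t01; have -> : f (seg q p t) * (p - q) = (-1)%:C * (f (seg p q (-1 * t + 1)) * (q - p)).
  have -> : seg q p t = seg p q (-1 * t + 1) by rewrite /seg !(rmorphD, rmorphM, rmorphN, rmorph1) /=; ring.
  by rewrite rmorphN rmorph1; ring.
by apply: rder_comp_affine; apply: GP; lra.
Qed.

Lemma has_int_split f p q v : has_int f p q v -> exists v1 v2,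
  [/\ has_int f p ((p + q) / 2) v1, has_int f ((p + q) / 2) q v2 & v = v1 + v2].
Proof.
move=> [G GP ->]; exists (G 2^-1 - G 0), (G 1 - G 2^-1); split; last by ring.
- exists (fun t => G (2^-1 * t + 0)); last by rewrite mulr1 mulr0 !addr0.
  move=> t t01; have -> : f (seg p ((p + q) / 2) t) * ((p + q) / 2 - p) =
      (2^-1)%:C * (f (seg p q (2^-1 * t + 0)) * (q - p)).
    have -> : seg p ((p + q) / 2) t = seg p q (2^-1 * t + 0).
      by rewrite /seg !(rmorphD, rmorphM, rmorph0, fmorphV, rmorph1, rmorph_nat) /=; field.
    by rewrite fmorphV rmorph_nat; field.
  by apply: rder_comp_affine; apply: GP; lra.
- exists (fun t => G (2^-1 * t + 2^-1)).
    move=> t t01; have -> : f (seg ((p + q) / 2) q t) * (q - (p + q) / 2) =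
        (2^-1)%:C * (f (seg p q (2^-1 * t + 2^-1)) * (q - p)).
      have -> : seg ((p + q) / 2) q t = seg p q (2^-1 * t + 2^-1).
        by rewrite /seg !(rmorphD, rmorphM, rmorph0, fmorphV, rmorph1, rmorph_nat) /=; field.
      by rewrite fmorphV rmorph_nat; field.
    by apply: rder_comp_affine; apply: GP; lra.
  by congr (G _ - G _); field.
Qed.

Lemma has_int_deriv (F : C -> C) f p q :
  (forall t, 0 <= t <= 1 -> cder F (seg p q t) (f (seg p q t))) ->
  has_int f p q (F q - F p).
Proof.
move=> FP; exists (fun t => F (seg p q t)).
  by move=> t t01; apply: rder_seg; exact: FP.
by rewrite /seg rmorph1 rmorph0 mul1r mul0r addr0 subrKC.
Qed.

End SegmentIntegral.

(** * Goursat's theorem and the Cauchy estimate *)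

Section Goursat.
Variable R : realType.
Local Notation C := R[i].
Implicit Types (f g : C -> C) (p q r z w l c : C) (t s e d M : R) (S : C -> Prop).

Lemma div_succ_le1 e (a : R) : 0 <= e -> 0 <= a -> e / (a + 1) * a <= e.
Proof. by move=> e0 a0; have := div_succ_le e0 a0 ler01; rewrite !mulr1. Qed.

(** The value is unique by [has_int_uniq]; [0] is a default when the integral does not exist. *)
Definition segment_integral f p q : C := xget 0 [set v | has_int f p q v].

Lemma segment_integralE f p q v : has_int f p q v -> segment_integral f p q = v.
Proof.
by move=> fv; apply: (@has_int_uniq _ f p q) => //; apply: (@xgetPex _ 0 [set v | has_int f p q v]); exists v.
Qed.

Lemma segment_integralP f p q : (forall t, 0 <= t <= 1 -> exists l, cder f (seg p q t) l) ->
  has_int f p q (segment_integral f p q).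
Proof. by move=> /has_int_ex[v fv]; rewrite (segment_integralE fv). Qed.

Definition segment_convex S := forall p q t, S p -> S q -> 0 <= t <= 1 -> S (seg p q t).
(** Closedness in the form supplied by bisection: [l] is only asked to be approached by some terms
    of the sequence. *)
Definition limit_closed S := forall (u : nat -> C) l, (forall n, S (u n)) ->
  (forall e, 0 < e -> exists n, nm (u n - l) <= e) -> S l.

Lemma mid_convex S p q : segment_convex S -> S p -> S q -> S ((p + q) / 2).
Proof.
move=> cS Sp Sq; have -> : (p + q) / 2 = seg p q 2^-1.
  by rewrite /seg fmorphV rmorph_nat; field.
by apply: cS => //; lra.
Qed.

(* A triangle is the triple of its vertices; [bd f T] is the integral of [f]
   along its boundary and [per T] its perimeter. *)
Definition bd f (T : C * C * C) : C :=
  segment_integral f T.1.1 T.1.2 + segment_integral f T.1.2 T.2 + segment_integral f T.2 T.1.1.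

Definition per (T : C * C * C) : R :=
  nm (T.1.2 - T.1.1) + nm (T.2 - T.1.2) + nm (T.1.1 - T.2).

Definition in_tri S (T : C * C * C) := [/\ S T.1.1, S T.1.2 & S T.2].

(** The midpoints cut the triangle into four; the integrals along the inner edges cancel, so one of
    the four boundary integrals has at least a quarter of the modulus. The bound on the first
    vertices makes them a Cauchy sequence under repetition. *)
Lemma goursat_step S f : segment_convex S -> (forall z, S z -> exists l, cder f z l) ->
  forall T, in_tri S T -> exists T',
  [/\ in_tri S T', per T' = per T / 2, nm (T'.1.1 - T.1.1) <= per T
    & nm (bd f T) <= 4 * nm (bd f T')].
Proof.
move=> cS fS [[p q] r] [/= Sp Sq Sr].
have hi a b : S a -> S b -> has_int f a b (segment_integral f a b).
  by move=> Sa Sb; apply: segment_integralP => t t01; apply: fS; exact: cS.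
have rev a b : S a -> S b -> segment_integral f b a = - segment_integral f a b.
  by move=> Sa Sb; apply: segment_integralE; exact/has_int_rev/hi.
have spl a b : S a -> S b ->
    segment_integral f a b = segment_integral f a ((a + b) / 2) + segment_integral f ((a + b) / 2) b.
  move=> Sa Sb; have [v1 [v2 [h1 h2 ->]]] := has_int_split (hi _ _ Sa Sb).
  by rewrite (segment_integralE h1) (segment_integralE h2).
have S1 := mid_convex cS Sp Sq; have S2 := mid_convex cS Sq Sr; have S3 := mid_convex cS Sr Sp.
set m1 := (p + q) / 2 in S1 *; set m2 := (q + r) / 2 in S2 *; set m3 := (r + p) / 2 in S3 *.
pose T1 := (p, m1, m3); pose T2 := (m1, q, m2); pose T3 := (m3, m2, r); pose T4 := (m2, m3, m1).
have E : bd f (p, q, r) = bd f T1 + bd f T2 + bd f T3 + bd f T4.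
  rewrite /bd /= (spl p q) // (spl q r) // (spl r p) // -/m1 -/m2 -/m3.
  rewrite (rev m1 m3) // (rev m2 m1) // (rev m3 m2) //; ring.
have half a b : nm ((a - b) / 2) = nm (a - b) / 2.
  by rewrite nmM nmV nm_nat.
have e1 : m1 - p = (q - p) / 2 by rewrite /m1; field.
have e2 : q - m1 = (q - p) / 2 by rewrite /m1; field.
have e3 : m2 - q = (r - q) / 2 by rewrite /m2; field.
have e4 : r - m2 = (r - q) / 2 by rewrite /m2; field.
have e5 : m3 - r = (p - r) / 2 by rewrite /m3; field.
have e6 : p - m3 = (p - r) / 2 by rewrite /m3; field.
have e7 : m3 - m1 = (r - q) / 2 by rewrite /m1 /m3; field.
have e8 : m1 - m2 = (p - r) / 2 by rewrite /m1 /m2; field.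
have e9 : m2 - m3 = (q - p) / 2 by rewrite /m2 /m3; field.
have n1 := nm_ge0 (q - p); have n2 := nm_ge0 (r - q); have n3 := nm_ge0 (p - r).
have P1 : per T1 = per (p, q, r) / 2 by rewrite /per /= e1 e7 e6 !half; lra.
have P2 : per T2 = per (p, q, r) / 2 by rewrite /per /= e2 e3 e8 !half; lra.
have P3 : per T3 = per (p, q, r) / 2 by rewrite /per /= e9 e4 e5 !half; lra.
have P4 : per T4 = per (p, q, r) / 2.
  by rewrite /per /= (nmB m3) e9 (nmB m1) e7 (nmB m2) e8 !half; lra.
have [h|h1] := leP (nm (bd f (p, q, r))) (4 * nm (bd f T1)).
  by exists T1; split => //=; rewrite subrr nm0 /per /=; lra.
have [h|h2] := leP (nm (bd f (p, q, r))) (4 * nm (bd f T2)).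
  by exists T2; split => //=; rewrite e1 half /per /=; lra.
have [h|h3] := leP (nm (bd f (p, q, r))) (4 * nm (bd f T3)).
  by exists T3; split => //=; rewrite nmB e6 half /per /=; lra.
exists T4; split => //=.
  apply: le_trans (nm_tri q _ _) _; rewrite e3 half /per /=; lra.
have : nm (bd f (p, q, r)) <= nm (bd f T1) + nm (bd f T2) + nm (bd f T3) + nm (bd f T4).
  rewrite E; apply: le_trans (nmD _ _) _; rewrite lerD2r.
  by apply: le_trans (nmD _ _) _; rewrite lerD2r nmD.
lra.
Qed.

Lemma nm_seg_tri p q t : 0 <= t <= 1 -> nm (seg p q t - p) <= nm (q - p).
Proof.
move=> /andP[t0 t1]; rewrite /seg addrAC subrr add0r nmM nm_real ger0_norm //.
by rewrite ler_piMl ?nm_ge0.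
Qed.

(** An affine function has a quadratic primitive. This removes the tangent map of [f] at the limit
    point in Goursat's theorem. *)
Lemma bd_affine (a b z : C) T : bd (fun w => a + b * (w - z)) T = 0.
Proof.
have E p q : segment_integral (fun w => a + b * (w - z)) p q =
   (a * q + b * (q - z) ^+ 2 / 2) - (a * p + b * (p - z) ^+ 2 / 2).
  apply: segment_integralE; apply: (@has_int_deriv _ (fun w => a * w + b * (w - z) ^+ 2 / 2)) => t _.
  have := cderD (cderZ a (cder_id (seg p q t)))
    (cderZ (b / 2) (cder_comp (cderB (cder_id (seg p q t)) (cder_cst z _)) (cderX _ 2))).
  rewrite /= expr1 (_ : a * 1 + _ = a + b * (seg p q t - z)); last by field.
  by apply: cder_ext => w; field.
by rewrite /bd !E; ring.
Qed.

Lemma bd_le S f T M : segment_convex S -> in_tri S T -> (forall z, S z -> exists l, cder f z l) ->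
  (forall z, nm (z - T.1.1) <= per T -> nm (f z) <= M) ->
  nm (bd f T) <= M * per T.
Proof.
case: T => [[p q] r] cS [/= Sp Sq Sr] fS fM.
have n1 := nm_ge0 (q - p); have n2 := nm_ge0 (r - q); have n3 := nm_ge0 (p - r).
have hi a b : S a -> S b -> nm (a - p) + nm (b - a) <= per (p, q, r) ->
    nm (segment_integral f a b) <= M * nm (b - a).
  move=> Sa Sb ab; apply: has_int_le (segment_integralP _) _.
    by move=> t t01; apply: fS; exact: cS.
  move=> t t01; apply: fM; apply: le_trans ab; apply: le_trans (nm_tri a _ _) _.
  by rewrite addrC lerD2l nm_seg_tri.
rewrite /bd /per /= !mulrDr; apply: le_trans (nmD _ _) _; apply: lerD; last first.
  apply: hi => //; rewrite /per /= (nmB r p).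
  by have := nm_tri q p r; rewrite (nmB p q) (nmB q r); lra.
apply: le_trans (nmD _ _) _; apply: lerD.
  by apply: hi => //; rewrite /per /= subrr nm0; lra.
by apply: hi => //; rewrite /per /=; lra.
Qed.

(** The nested triangles shrink to a point [z] of [S]. After subtraction of the tangent map at [z],
    the integrand on the n-th triangle is at most [e] times three perimeters, so the integral is of
    order [e] times the square of the perimeter. The factor [4 ^+ n] lost in the bisection cancels
    this square. *)
Lemma goursat S f : segment_convex S -> limit_closed S ->
  (forall z, S z -> exists l, cder f z l) ->
  forall p q r, S p -> S q -> S r ->
  segment_integral f p q + segment_integral f q r + segment_integral f r p = 0.
Proof.
move=> cS clS fS p q r Sp Sq Sr.
have step := goursat_step cS fS.
(* Subdivision is made total, with [T] itself as value outside [S], so that a choice function can be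
   iterated. *)
have step' T : exists T', in_tri S T ->
  [/\ in_tri S T', per T' = per T / 2, nm (T'.1.1 - T.1.1) <= per T
    & nm (bd f T) <= 4 * nm (bd f T')].
  by have [/step[T' ?]|ST] := pselect (in_tri S T); [exists T'|exists T].
have [next nextP] := boolp.choice step'.
pose T n := iter n next (p, q, r).
have TS n : in_tri S (T n) by elim: n => [//|n /nextP[]].
have perT n : per (T n) = per (p, q, r) * 2^-1 ^+ n.
  elim: n => [|n IH]; first by rewrite expr0 mulr1.
  by have [_ -> _ _] := nextP _ (TS n); rewrite -/(T n) IH exprSr mulrA.
have bdT n : nm (bd f (p, q, r)) <= 4 ^+ n * nm (bd f (T n)).
  elim: n => [|n IH]; first by rewrite expr0 mul1r.
  apply: le_trans IH _; rewrite exprSr -mulrA; apply: ler_wpM2l; first exact: exprn_ge0.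
  by have [] := nextP _ (TS n).
have half01 : 0 <= (2^-1 : R) < 1 by apply/andP; split; lra.
have [|z zP] := @complex_geometric _ (fun n => (T n).1.1) (per (p, q, r)) 2^-1 half01.
  by move=> n; rewrite -perT; have [] := nextP _ (TS n).
have {}zP n : nm ((T n).1.1 - z) <= 2 * per (T n).
  by apply: le_trans (zP n) _; rewrite -perT (_ : (1 - 2^-1)^-1 = 2) 1?mulrC //; field.
have per0 : 0 <= per (p, q, r) by rewrite /per !addr_ge0 ?nm_ge0.
have small e : 0 < e -> exists n, per (T n) <= e.
  move=> e0; have [|n nP] := @expr_small _ 2^-1 (e / (per (p, q, r) + 1)) half01.
    by rewrite divr_gt0 // ltr_wpDl.
  exists n; rewrite perT; apply: le_trans (ler_wpM2l per0 (nP n (leqnn _))) _.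
  by rewrite mulrC; apply: div_succ_le1 => //; exact: ltW.
have Sz : S z.
  apply: (clS (fun n => (T n).1.1)) => [n|e e0]; first by have [] := TS n.
  have [|n nP] := small (e / 2); first by rewrite divr_gt0.
  by exists n; apply: le_trans (zP n) _; lra.
have [l fl] := fS z Sz.
have [|n0] := eqVneq (bd f (p, q, r)) 0; first by [].
have {n0} : 0 < nm (bd f (p, q, r)) by rewrite nm_gt0.
suff h e : 0 < e -> nm (bd f (p, q, r)) <= e * (3 * per (p, q, r) ^+ 2).
  set B := nm _ in h *; set A := 3 * _ in h.
  have A0 : 0 <= A by rewrite /A mulr_ge0 // sqr_ge0.
  move=> B0; have := h (B / 2 / (A + 1)).
  have A1 : 0 < A + 1 by rewrite ltr_wpDl.
  rewrite !divr_gt0 // => /(_ isT) {}h; exfalso.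
  have : B / 2 / (A + 1) * A <= B / 2.
    by apply: div_succ_le1 => //; rewrite ltW // divr_gt0.
  lra.
move=> e0; have [d d0 dP] := fl e e0.
have [|n nP] := small (d / 4); first by rewrite divr_gt0.
apply: le_trans (bdT n) _.
(* [g] is [f] minus its tangent map at [z]; it has the same boundary integral and is at most
   [e |w - z|]. *)
pose g w := f w + -1 * (f z + l * (w - z)).
have gS w : S w -> exists k, cder g w k.
  move=> /fS[k fk]; exists (k + -1 * (0 + l * (1 - 0))).
  apply: cderD => //; apply: cderZ; apply: cderD; first exact: cder_cst.
  by apply: cderZ; apply: cderB; [exact: cder_id|exact: cder_cst].
have aff w : exists k, cder (fun w => f z + l * (w - z)) w k.
  exists (0 + l * (1 - 0)); apply: cderD; first exact: cder_cst.
  by apply: cderZ; apply: cderB; [exact: cder_id|exact: cder_cst].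
have Eg : bd f (T n) = bd g (T n).
  have add a b : S a -> S b -> segment_integral g a b =
      segment_integral f a b + -1 * segment_integral (fun w => f z + l * (w - z)) a b.
    move=> Sa Sb; apply: segment_integralE; apply: has_intD; last apply: has_intZ.
      by apply: segment_integralP => t t01; apply: fS; exact: cS.
    by apply: segment_integralP => t t01; exact: aff.
  have [? ? ?] := TS n.
  have := bd_affine (f z) l z (T n); rewrite /bd !add // => h.
  rewrite -[LHS]addr0 -[X in _ + X]oppr0 -h; ring.
have pn0 : 0 <= per (T n) by rewrite perT mulr_ge0 // exprn_ge0.
have : nm (bd g (T n)) <= e * (3 * per (T n)) * per (T n).
  apply: (bd_le cS (TS n) gS) => w wT.
  have wz : nm (w - z) <= 3 * per (T n).
    by apply: le_trans (nm_tri (T n).1.1 _ _) _; have := zP n; lra.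
  rewrite /g mulN1r opprD addrA; apply: le_trans (dP _ _) _; first lra.
  by rewrite ler_wpM2l // ltW.
rewrite Eg => /(ler_wpM2l (exprn_ge0 n (ler0n R 4))) /le_trans; apply.
rewrite perT le_eqVlt; apply/orP; left; apply/eqP.
have E4 : 4 ^+ n * (2^-1 ^+ n) * (2^-1 ^+ n) = 1 :> R.
  by rewrite -!exprMn (_ : 4 * _ * _ = 1) ?expr1n //; field.
set x := 2^-1 ^+ n in E4 *.
transitivity (e * (3 * per (p, q, r) ^+ 2) * (4 ^+ n * x * x)); first by ring.
by rewrite E4 mulr1.
Qed.

End Goursat.

(** * The Cauchy estimate, by integration along squares *)

Section CauchyEstimate.
Variable R : realType.
Local Notation C := R[i].
Local Notation ii := ('i%C : R[i]).
Implicit Types (f g : C -> C) (p q z w l c u : C) (r t s e d M : R) (S : C -> Prop).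

Lemma nm_sqr z : nm z ^+ 2 = complex.Re z ^+ 2 + complex.Im z ^+ 2.
Proof. by case: z => a b; rewrite /nm /= sqr_sqrtr // addr_ge0 ?sqr_ge0. Qed.

Lemma nm_le_sqr z w (k : R) : 0 <= k -> nm z ^+ 2 <= k ^+ 2 * nm w ^+ 2 -> nm z <= k * nm w.
Proof.
by move=> k0; rewrite -exprMn ler_pXn2r // nnegrE ?mulr_ge0 ?nm_ge0.
Qed.

Lemma nm_convex p q t M : 0 <= t <= 1 -> nm p <= M -> nm q <= M -> nm (seg p q t) <= M.
Proof.
move=> /andP[t0 t1] pM qM.
have -> : seg p q t = (1 - t)%:C * p + t%:C * q.
  by rewrite /seg rmorphB rmorph1; ring.
apply: le_trans (nmD _ _) _; rewrite !nmM !nm_real !ger0_norm ?subr_ge0 //.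
have := ler_wpM2l t0 qM; have : (1 - t) * nm p <= (1 - t) * M.
  by apply: ler_wpM2l => //; rewrite subr_ge0.
lra.
Qed.

Lemma convex_disc c M : segment_convex (fun z => nm (z - c) <= M).
Proof.
move=> p q t pM qM t01; have -> : seg p q t - c = seg (p - c) (q - c) t.
  by rewrite /seg; ring.
exact: nm_convex.
Qed.

Lemma closed_disc c M : limit_closed (fun z => nm (z - c) <= M).
Proof.
move=> v l vM vl; apply/ler_addgt0Pr => e /vl[n nP].
by apply: le_trans (nm_tri (v n) _ _) _; rewrite addrC (nmB l); apply: lerD.
Qed.

(** A disc cut by a half-plane. For [|u| = 1] and [d > 0] it is a closed convex set that avoids the
    origin, and it contains the trapezoid between corresponding sides of two concentric squares. *)
Definition trapezoid u (d M : R) : C -> Prop := fun z => d <= complex.Re (u * z) /\ nm (z - 0) <= M.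

Lemma convex_trapezoid u d M : segment_convex (trapezoid u d M).
Proof.
move=> p q t [p1 p2] [q1 q2] t01; split; last exact: convex_disc.
have -> : complex.Re (u * seg p q t) = (1 - t) * complex.Re (u * p) + t * complex.Re (u * q).
  by rewrite /seg; case: u {p1 q1} => ? ?; case: p {p2} => ? ?; case: q {q2} => ? ? /=; ring.
move/andP: t01 => [t0 t1]; have := ler_wpM2l t0 q1.
have : (1 - t) * d <= (1 - t) * complex.Re (u * p) by rewrite ler_wpM2l // subr_ge0.
lra.
Qed.

Lemma closed_trapezoid u d M : nm u = 1 -> limit_closed (trapezoid u d M).
Proof.
move=> u1 v l vM vl; split; last by apply: closed_disc vl => n; have [] := vM n.
apply/ler_addgt0Pr => e /vl[n nP]; have [h _] := vM n.
have : `|complex.Re (u * v n - u * l)| <= e.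
  by apply: le_trans (nm_Re _) _; rewrite -mulrBr nmM u1 mul1r.
by rewrite raddfB /= ler_norml => /andP[_ ?]; lra.
Qed.

Lemma eq_of_sum0 (x y a b : C) : a = 0 -> b = 0 -> x - y = a + b -> x = y.
Proof. by move=> -> -> /eqP; rewrite addr0 subr_eq0 => /eqP. Qed.

(* Integrals around the square of half-side [s] replace integrals over circles,
   so that neither the exponential nor the number pi is needed: the four sides
   are exchanged by multiplication by [i], and two concentric squares are joined
   by four trapezoids avoiding the origin. *)
Definition corner k : C := ii ^+ k * (1 - ii).

Lemma cornerS k : corner k.+1 = ii ^+ k * (1 + ii).
Proof.
have i2 : ii * ii = -1 by rewrite -expr2 sqr_i.
by rewrite /corner exprSr -mulrA mulrBr i2 mulr1 opprK addrC.
Qed.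

Lemma corner4 : corner 4 = corner 0.
Proof.
by rewrite /corner (exprM ii 2 2) sqr_i sqrrN expr1n.
Qed.

Definition side g s k := segment_integral g (s%:C * corner k) (s%:C * corner k.+1).
Definition loop g s := side g s 0 + side g s 1 + side g s 2 + side g s 3.

Lemma nm_iX k : nm (ii ^+ k) = 1. Proof. by rewrite nmX nm_i expr1n. Qed.

Lemma side_pt s k t : seg (s%:C * corner k) (s%:C * corner k.+1) t =
  s%:C * ii ^+ k * (1 + ii * (2 * t - 1)%:C).
Proof.
by rewrite cornerS /seg /corner rmorphB rmorphM rmorph1 rmorph_nat; ring.
Qed.

Lemma nm_1i (y : R) : nm (1 + ii * y%:C) ^+ 2 = 1 + y ^+ 2.
Proof. by rewrite nm_sqr /=; ring. Qed.

Lemma nm_side s k t : 0 < s -> 0 <= t <= 1 ->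
  s <= nm (seg (s%:C * corner k) (s%:C * corner k.+1) t) <= 2 * s.
Proof.
move=> s0 /andP[t0 t1]; rewrite side_pt nmM nmM nm_iX mulr1 nm_real gtr0_norm //.
have n0 := nm_ge0 (1 + ii * (2 * t - 1)%:C).
have nE := nm_1i (2 * t - 1).
rewrite mulrC; apply/andP; split.
  apply: ler_peMl; first exact: ltW.
  by rewrite -(@ler_pXn2r _ 2) ?nnegrE // expr1n nE lerDl sqr_ge0.
apply: ler_wpM2r; first exact: ltW.
rewrite -(@ler_pXn2r _ 2) ?nnegrE // nE.
have t2 : 0 <= t * (1 - t) by rewrite mulr_ge0 // subr_ge0.
nra.
Qed.

Lemma side_len s k : 0 < s -> nm (s%:C * corner k.+1 - s%:C * corner k) = 2 * s.
Proof.
move=> s0; rewrite cornerS /corner (_ : _ - _ = s%:C * (ii ^+ k * (ii * 2))); last by ring.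
by rewrite !nmM nm_iX nm_i nm_nat nm_real gtr0_norm // !mul1r mulrC.
Qed.

Definition holo_punctured (r : R) g := forall z, 0 < nm z < r -> exists l, cder g z l.

Lemma side_has_int g r s k : holo_punctured r g -> 0 < s -> 2 * s < r ->
  has_int g (s%:C * corner k) (s%:C * corner k.+1) (side g s k).
Proof.
move=> gr s0 sr; apply: segment_integralP => t t01; apply: gr.
have /andP[h1 h2] := nm_side k s0 t01.
by rewrite (lt_le_trans s0 h1) (le_lt_trans h2 sr).
Qed.

(** Goursat's theorem on the two triangles that a diagonal cuts in the trapezoid. The integrals
    along the two connecting segments cancel when the four sides are added. *)
Lemma side_change g r s s' k : holo_punctured r g -> 0 < s' -> s' <= s -> 2 * s < r ->
  side g s k = segment_integral g (s%:C * corner k) (s'%:C * corner k) + side g s' k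
     - segment_integral g (s%:C * corner k.+1) (s'%:C * corner k.+1).
Proof.
move=> gr s'0 ss' sr; have s0 : 0 < s by apply: lt_le_trans ss'.
(* Multiplication by [u] turns the k-th sides onto the vertical lines of abscissae [s] and [s'], so
   the half-plane [Re (u z) >= s'] contains both. *)
pose u := (ii ^+ k)^-1; have u1 : nm u = 1 by rewrite nmV nm_iX invr1.
have ik0 : ii ^+ k != 0 by rewrite -nm_gt0 nm_iX.
pose S := trapezoid u s' (2 * s).
have gS z : S z -> exists l, cder g z l.
  move=> [z1 z2]; apply: gr; rewrite subr0 in z2; rewrite (le_lt_trans z2) // andbT.
  apply: lt_le_trans s'0 _; apply: le_trans z1 _; apply: le_trans (ler_norm _) _.
  by apply: le_trans (nm_Re _) _; rewrite nmM u1 mul1r.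
have cS : segment_convex S by exact: convex_trapezoid.
have clS : limit_closed S by exact: closed_trapezoid.
have Sc x : s' <= x -> x <= s -> S (x%:C * corner k) /\ S (x%:C * corner k.+1).
  move=> s'x xs; have x0 : 0 < x by apply: lt_le_trans s'x.
  rewrite cornerS /corner; split; split.
  - by rewrite mulrCA mulKf // /=; lra.
  - rewrite subr0 !nmM nm_iX mul1r nm_real gtr0_norm // mulrC; apply: ler_pM; [exact: nm_ge0|exact: ltW| |by []].
    by apply: le_trans (nm_ReIm _) _ => /=; rewrite !subr0 !sub0r normrN normr1; lra.
  - by rewrite mulrCA mulKf // /=; lra.
  - rewrite subr0 !nmM nm_iX mul1r nm_real gtr0_norm // mulrC; apply: ler_pM; [exact: nm_ge0|exact: ltW| |by []].
    by apply: le_trans (nm_ReIm _) _ => /=; rewrite !addr0 !add0r normr1; lra.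
have [a1 b1] := Sc s ss' (lexx _); have [a2 b2] := Sc s' (lexx _) ss'.
have G := goursat cS clS gS.
have rev x y : S x -> S y -> segment_integral g y x = - segment_integral g x y.
  move=> Sx Sy; apply: segment_integralE; apply/has_int_rev/segment_integralP => t t01.
  by apply: gS; exact: cS.
rewrite /side; have := G _ _ _ a1 b1 b2; have := G _ _ _ a1 b2 a2.
rewrite (rev _ _ a1 b2) (rev _ _ a1 a2) // (rev _ _ a2 b2) //.
move=> h2 h1; apply: (eq_of_sum0 h1 h2); ring.
Qed.

Lemma loop_change g r s s' : holo_punctured r g -> 0 < s' -> s' <= s -> 2 * s < r ->
  loop g s = loop g s'.
Proof.
move=> gr s'0 ss' sr; have h := side_change _ gr s'0 ss' sr.
by rewrite /loop !h corner4; ring.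
Qed.

Lemma loop_le g r s M : holo_punctured r g -> 0 < s -> 2 * s < r ->
  (forall z, s <= nm z <= 2 * s -> nm (g z) <= M) -> nm (loop g s) <= 8 * s * M.
Proof.
move=> gr s0 sr gM.
have h k : nm (side g s k) <= M * (2 * s).
  rewrite -(side_len k s0); apply: has_int_le (side_has_int k gr s0 sr) _ => t t01.
  by apply: gM; exact: nm_side.
have := h 0%N; have := h 1%N; have := h 2%N; have := h 3%N.
have := nmD (side g s 0 + side g s 1 + side g s 2) (side g s 3).
have := nmD (side g s 0 + side g s 1) (side g s 2).
have := nmD (side g s 0) (side g s 1).
rewrite -/(loop g s); lra.
Qed.

(* On a side, [1 / z] is compared with the constant [3 / (4 s i ^ k)]. *)
Lemma side_inv s k : 0 < s -> nm (side (fun z => z^-1) s k - ii * (3 / 2)%:C) <= 8 / 7.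
Proof.
move=> s0; set c := ((3 / 4)%:C * (s%:C * ii ^+ k)^-1 : C).
have s0C : s%:C != 0 :> C by rewrite -nm_gt0 nm_real gtr0_norm.
have ik0 : ii ^+ k != 0 by rewrite -nm_gt0 nm_iX.
have hol : holo_punctured (3 * s) (fun z => z^-1).
  by move=> z /andP[z0 _]; exists (- (z ^+ 2)^-1); apply: cder_inv; rewrite -nm_gt0.
have h1 := side_has_int k hol s0 (_ : 2 * s < 3 * s).
have h2 : has_int (fun=> c) (s%:C * corner k) (s%:C * corner k.+1) (ii * (3 / 2)%:C).
  have -> : ii * (3 / 2)%:C = c * (s%:C * corner k.+1) - c * (s%:C * corner k).
    by rewrite cornerS /corner /c !(rmorphM, fmorphV, rmorph_nat) /=; field; rewrite ik0.
  apply: (@has_int_deriv _ (fun z => c * z)) => t _.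
  by rewrite -[X in cder _ _ X](mulr1 c); apply: cderZ; exact: cder_id.
have := has_intD (h1 _) (has_intZ (-1) h2); rewrite !mulN1r => /(_ ltac:(lra)) h.
(* The side has length [2 s]. For [|y| <= 1] the quotient of [|1/4 - (3/4) i y|] by [|1 + i y|] is
   at most the square root of [5/16], which is below [4/7]. *)
have -> : 8 / 7 = 4 / 7 / s * (2 * s) by field; exact: lt0r_neq0.
rewrite -(side_len k s0); apply: has_int_le h _ => t /andP[t0 t1] /=.
rewrite side_pt; set y := 2 * t - 1.
have y0 : 1 + ii * y%:C != 0.
  by rewrite -nm_gt0 -(ltr_pXn2r (_ : 0 < 2)%N) ?nnegrE ?nm_ge0 // nm_1i expr0n ltr_pwDl // sqr_ge0.
rewrite /c (_ : _ + _ = (s%:C * ii ^+ k)^-1 * ((1 / 4)%:C - ii * (3 / 4 * y)%:C) / (1 + ii * y%:C)).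
  rewrite !nmM !nmV nmM nm_real nm_iX mulr1 gtr0_norm // ler_pdivrMr ?nm_gt0 //.
  rewrite (_ : 4 / 7 / s * nm (1 + ii * y%:C) = s^-1 * (4 / 7 * nm (1 + ii * y%:C))); last by ring.
  rewrite ler_pM2l ?invr_gt0 //; apply: nm_le_sqr; first lra.
  rewrite nm_1i nm_sqr /=.
  have : y ^+ 2 <= 1 by rewrite /y; nra.
  by nra.
by rewrite !(rmorphM, fmorphV, rmorph_nat, rmorph1) /=; field; rewrite y0 ik0.
Qed.

(** The four comparison values add up to [6 i], while the four errors add up to at most
    [32/7 < 5]. *)
Lemma loop_inv s : 0 < s -> 1 <= nm (loop (fun z => z^-1) s).
Proof.
move=> s0; have h := @side_inv s _ s0.
set g := fun z : C => z^-1.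
have E : ii * 6%:R = loop g s - ((side g s 0 - ii * (3 / 2)%:C) + (side g s 1 - ii * (3 / 2)%:C)
  + (side g s 2 - ii * (3 / 2)%:C) + (side g s 3 - ii * (3 / 2)%:C)).
  by rewrite /loop !(rmorphM, fmorphV, rmorph_nat) /=; field.
have : nm (ii * 6%:R) = 6 by rewrite nmM nm_i mul1r nm_nat.
rewrite E; set A := side g s 0 - _; set B := side g s 1 - _; set D := side g s 2 - _.
set F := side g s 3 - _; move=> h6.
have := nmD (loop g s) (- (A + B + D + F)); rewrite h6 nmN.
have := nmD (A + B + D) F; have := nmD (A + B) D; have := nmD A B.
have := h 0%N; have := h 1%N; have := h 2%N; have := h 3%N.
rewrite -/g -/A -/B -/D -/F; lra.
Qed.

Lemma loop_sqr_inv s : 0 < s -> loop (fun z => (z ^+ 2)^-1) s = 0.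
Proof.
move=> s0.
have h k : side (fun z => (z ^+ 2)^-1) s k = - (s%:C * corner k.+1)^-1 - - (s%:C * corner k)^-1.
  apply: segment_integralE; apply: (@has_int_deriv _ (fun z => - z^-1)) => t t01.
  rewrite -[(_ ^+ 2)^-1]opprK; apply/cderN/cder_inv.
  by have /andP[h _] := nm_side k s0 t01; rewrite -nm_gt0 (lt_le_trans s0).
by rewrite /loop !h corner4; ring.
Qed.

Lemma loopD f g r s : holo_punctured r f -> holo_punctured r g -> 0 < s -> 2 * s < r ->
  loop (fun z => f z + g z) s = loop f s + loop g s.
Proof.
move=> fr gr s0 sr.
have h k : side (fun z => f z + g z) s k = side f s k + side g s k.
  by apply: segment_integralE; apply: has_intD; apply: side_has_int sr.
by rewrite /loop !h; ring.
Qed.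

Lemma loopZ c g r s : holo_punctured r g -> 0 < s -> 2 * s < r ->
  loop (fun z => c * g z) s = c * loop g s.
Proof.
move=> gr s0 sr.
have h k : side (fun z => c * g z) s k = c * side g s k.
  by apply: segment_integralE; apply: has_intZ; apply: side_has_int sr.
by rewrite /loop !h; ring.
Qed.

Lemma loop_eq f g r s : holo_punctured r f -> 0 < s -> 2 * s < r ->
  (forall z, 0 < nm z < r -> f z = g z) -> loop g s = loop f s.
Proof.
move=> fr s0 sr fg.
have h k : side g s k = side f s k.
  apply: segment_integralE; apply: has_int_eq (side_has_int k fr s0 sr) => t t01; apply: fg.
  have /andP[h1 h2] := nm_side k s0 t01.
  by rewrite (lt_le_trans s0 h1) (le_lt_trans h2 sr).
by rewrite /loop !h.
Qed.

(* The derivative of [f] at [0], multiplied by the nonzero integral of [1 / z],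
   is the integral of [f z / z ^ 2]. *)
Lemma cauchy_estimate0 f r s l M : (forall z, nm z < r -> exists k, cder f z k) ->
  cder f 0 l -> 0 < s -> 2 * s < r ->
  (forall z, s <= nm z <= 2 * s -> nm (f z) <= M) -> nm l <= 8 * M / s.
Proof.
move=> fr fl s0 sr fM; apply/ler_addgt0Pr => e e0.
have [d d0 dP] := fl (e / 8) (divr_gt0 e0 (ltr0n _ 8)).
(* On the smaller square the first-order remainder of [f] at [0] is at most [(e / 8) |z|], so that
   its contribution to the integral is at most [e]. *)
pose s' := Num.min s (d / 4).
have s'0 : 0 < s' by rewrite lt_min s0 divr_gt0.
have s's : s' <= s by rewrite ge_min lexx.
have s'r : 2 * s' < r by apply: le_lt_trans sr; lra.
have s'd : 2 * s' < d.
  by have : s' <= d / 4 by [rewrite ge_min lexx orbT]; lra.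
have iz : holo_punctured r (fun z => z^-1).
  by move=> z /andP[z0 _]; exists (- (z ^+ 2)^-1); apply: cder_inv; rewrite -nm_gt0.
have iz2 : holo_punctured r (fun z => (z ^+ 2)^-1).
  move=> z zr; have [k kP] := iz z zr; exists (k * z^-1 + z^-1 * k).
  by apply: cder_ext (cderM kP kP) => w; rewrite expr2 invfM.
have mulP g h : holo_punctured r g -> holo_punctured r h -> holo_punctured r (fun z => g z * h z).
  move=> gr hr z zr; have [k kP] := gr z zr; have [m mP] := hr z zr.
  by exists (k * h z + g z * m); exact: cderM.
have fP : holo_punctured r f by move=> z /andP[_ /fr].
have cP c : holo_punctured r (fun=> c) by move=> z _; exists 0; exact: cder_cst.
have idP : holo_punctured r id by move=> z _; exists 1; exact: cder_id.
have addP g h : holo_punctured r g -> holo_punctured r h -> holo_punctured r (fun z => g z + h z).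
  move=> gr hr z zr; have [k kP] := gr z zr; have [m mP] := hr z zr.
  by exists (k + m); exact: cderD.
pose g z := f z * (z ^+ 2)^-1.
have gP : holo_punctured r g by exact: mulP.
pose rem z := (f z + (- f 0 + - l * z)) * (z ^+ 2)^-1.
have remP : holo_punctured r rem.
  exact: mulP _ _ (addP _ _ fP (addP _ _ (cP (- f 0)) (mulP _ _ (cP (- l)) idP))) iz2.
(* [f z / z^2] splits as [f 0 / z^2 + l / z + rem z], and the first term integrates to zero because
   it has a primitive. *)
have E : loop g s' = l * loop (fun z => z^-1) s' + loop rem s'.
  have fE : f 0 * loop (fun z => (z ^+ 2)^-1) s' = 0 by rewrite loop_sqr_inv // mulr0.
  rewrite -[RHS]add0r -fE -(loopZ _ iz2 s'0 s'r) -(loopZ l iz s'0 s'r).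
  have lP : holo_punctured r (fun z => l * z^-1) by exact: mulP _ _ (cP l) iz.
  have f0P : holo_punctured r (fun z => f 0 * (z ^+ 2)^-1) by exact: mulP _ _ (cP _) iz2.
  rewrite -(loopD lP remP s'0 s'r) -(loopD f0P (addP _ _ lP remP) s'0 s'r).
  apply: loop_eq s'0 s'r _; first exact: addP f0P (addP _ _ lP remP).
  by move=> z /andP[z0 _]; rewrite /rem /g; field; rewrite -nm_gt0.
have gM : nm (loop g s) <= 8 * s * (M / s ^+ 2).
  apply: (loop_le gP s0 sr) => z /[dup] zs /andP[z1 z2]; rewrite /g nmM nmV nmX.
  have z0 : 0 < nm z by apply: lt_le_trans z1.
  by apply: ler_pM; rewrite ?nm_ge0 ?invr_ge0 ?exprn_ge0 ?nm_ge0 ?fM // lef_pV2 ?posrE ?exprn_gt0 // lerXn2r // nnegrE ltW.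
have remM : nm (loop rem s') <= 8 * s' * (e / 8 / s').
  apply: (loop_le remP s'0 s'r) => z /andP[z1 z2]; rewrite /rem nmM nmV nmX.
  have z0 : 0 < nm z by apply: lt_le_trans z1.
  have := dP z; rewrite subr0 => /(_ (le_lt_trans z2 s'd)) h.
  rewrite ler_pdivrMr ?exprn_gt0 // addrA mulNr; apply: le_trans h _.
  rewrite (_ : e / 8 / s' * nm z ^+ 2 = e / 8 * (nm z * (nm z / s'))); last by ring.
  apply: ler_wpM2l; first by rewrite divr_ge0 // ltW.
  by apply: ler_peMr; rewrite ?nm_ge0 // ler_pdivlMr // mul1r.
rewrite (loop_change gP s'0 s's sr) E in gM.
have lT : nm l <= nm (l * loop (fun z => z^-1) s').
  by rewrite nmM ler_peMr ?nm_ge0 // loop_inv.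
have := nmBl (l * loop (fun z => z^-1) s') (- loop rem s'); rewrite opprK nmN.
have e1 : 8 * s' * (e / 8 / s') = e by field; exact: lt0r_neq0.
have e2 : 8 * s * (M / s ^+ 2) = 8 * M / s by field; exact: lt0r_neq0.
rewrite e1 in remM; rewrite e2 in gM; lra.
Qed.

Lemma cauchy_estimate f a r s l M : (forall z, nm (z - a) < r -> exists k, cder f z k) ->
  cder f a l -> 0 < s -> 2 * s < r ->
  (forall z, s <= nm (z - a) <= 2 * s -> nm (f z) <= M) -> nm l <= 8 * M / s.
Proof.
move=> fr fl s0 sr fM.
have sh z k : cder f (z + a) k -> cder (fun w => f (w + a)) z k.
  move=> fk; rewrite -[k]mulr1 -[1]addr0.
  apply: (@cder_comp _ f (fun w => w + a)) => //.
  by apply: cderD; [exact: cder_id|exact: cder_cst].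
apply: (@cauchy_estimate0 (fun z => f (z + a)) r) => //.
- by move=> z zr; have [|k /sh] := fr (z + a); [rewrite addrK|exists k].
- by apply: sh; rewrite add0r.
- by move=> z zs; apply: fM; rewrite addrK.
Qed.

End CauchyEstimate.

(** * Local theory of holomorphic functions *)

Section LocalTheory.
Variable R : realType.
Local Notation C := R[i].
Implicit Types (f g : C -> C) (p q z w l c u a : C) (r t s e d M : R).

Lemma cder_linear c z : cder (fun w => c * w) z c.
Proof. by have := cderZ c (cder_id z); rewrite mulr1. Qed.

Lemma mvi_segment f f' z w M : (forall t, 0 <= t <= 1 -> cder f (seg z w t) (f' (seg z w t))) ->
  (forall t, 0 <= t <= 1 -> nm (f' (seg z w t)) <= M) -> nm (f w - f z) <= M * nm (w - z).
Proof.
move=> df bf; have := has_int_deriv df.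
by move=> /has_int_le; apply.
Qed.

Lemma seg_disc a z w t r : nm (z - a) < r -> nm (w - a) < r -> 0 <= t <= 1 ->
  nm (seg z w t - a) < r.
Proof.
move=> za wa t01; pose m := Num.max (nm (z - a)) (nm (w - a)).
apply: (@le_lt_trans _ _ m); last by rewrite gt_max za.
by apply: convex_disc => //; rewrite le_max lexx ?orbT.
Qed.

Lemma mvi_disc f f' a r M : holo_on a r f f' -> (forall z, nm (z - a) < r -> nm (f' z) <= M) ->
  forall z w, nm (z - a) < r -> nm (w - a) < r -> nm (f w - f z) <= M * nm (w - z).
Proof.
move=> hf fM z w za wa; apply: mvi_segment => t t01.
  by apply: hf; exact: seg_disc.
by apply: fM; exact: seg_disc.
Qed.

Lemma holo_on_sub f f' a b r s : holo_on a r f f' -> nm (b - a) + s <= r -> holo_on b s f f'.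
Proof.
move=> hf bs z zb; apply: hf; apply: le_lt_trans (nm_tri b _ _) _; lra.
Qed.

(** The Cauchy estimate on the disc of radius [r / 2] about [z], with inner scale [r / 8]; hence
    [64 = 8 * 8]. *)
Lemma deriv_bound f f' a r M : 0 < r -> holo_on a r f f' ->
  (forall z, nm (z - a) < r -> nm (f z) <= M) ->
  forall z, nm (z - a) < r / 2 -> nm (f' z) <= 64 * M / r.
Proof.
move=> r0 hf fM z za.
have -> : 64 * M / r = 8 * M / (r / 8) by field; exact: lt0r_neq0.
have sub w : nm (w - z) < r / 2 -> nm (w - a) < r.
  by move=> wz; apply: le_lt_trans (nm_tri z _ _) _; lra.
apply: (@cauchy_estimate _ f z (r / 2)).
- by move=> w /sub /hf; exists (f' w).
- by apply: hf; lra.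
- by rewrite divr_gt0.
- lra.
- by move=> w /andP[_ h]; apply/fM/sub; lra.
Qed.

Lemma cder_shift f h z l : cder f (z + h) l -> cder (fun w => f (w + h)) z l.
Proof.
move=> fk; rewrite -[l]mulr1 -[1]addr0.
apply: (@cder_comp _ f (fun w => w + h)) => //.
by apply: cderD; [exact: cder_id|exact: cder_cst].
Qed.

Lemma holo_diffquot f f' a h r s : holo_on a r f f' -> nm h + s <= r ->
  holo_on a s (fun z => h^-1 * (f (z + h) - f z)) (fun z => h^-1 * (f' (z + h) - f' z)).
Proof.
move=> hf hs z za; have h0 := nm_ge0 h.
apply/cderZ/cderB; last by apply: hf; lra.
apply/cder_shift/hf; rewrite addrAC; apply: le_lt_trans (nmD _ _) _; lra.
Qed.

(** For [h = w - z] the difference quotient of [f] by [h] is holomorphic and at most [64 M / r] on a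
    disc of radius [r / 4]. Its derivative is the difference quotient of [f'], so a second use of
    [deriv_bound] gives the Lipschitz bound without assuming that [f'] is differentiable. *)
Lemma deriv_lip f f' a r M : 0 < r -> holo_on a r f f' ->
  (forall z, nm (z - a) < r -> nm (f z) <= M) ->
  forall z w, nm (z - a) < r / 8 -> nm (w - a) < r / 8 ->
  nm (f' w - f' z) <= 64 * (256 * M) / r ^+ 2 * nm (w - z).
Proof.
move=> r0 hf fM z w za wa; have b1 := deriv_bound r0 hf fM.
have M0 : 0 <= M.
  by apply: le_trans (fM a _); [exact: nm_ge0|rewrite subrr nm0].
have [->|wz] := eqVneq w z; first by rewrite !subrr nm0 mulr0.
pose h := w - z; have h0 : 0 < nm h by rewrite nm_gt0 subr_eq0.
have hr : nm h < r / 4.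
  by apply: le_lt_trans (nm_tri a _ _) _; rewrite (nmB a); lra.
have r4 : 0 < r / 4 by lra.
have hd : holo_on a (r / 4) (fun z => h^-1 * (f (z + h) - f z)) (fun z => h^-1 * (f' (z + h) - f' z)).
  by apply: (holo_diffquot hf); lra.
have bd v : nm (v - a) < r / 4 -> nm (h^-1 * (f (v + h) - f v)) <= 64 * M / r.
  move=> va; rewrite nmM nmV mulrC ler_pdivrMr //.
  have hf2 : holo_on a (r / 2) f f' by apply: (holo_on_sub hf); rewrite subrr nm0; lra.
  have := mvi_disc hf2 b1 (z := v) (w := v + h).
  rewrite [v + h]addrC addrK; apply; first lra.
  by rewrite -addrA; apply: le_lt_trans (nmD _ _) _; lra.
have := deriv_bound r4 hd bd (z := z).
rewrite (_ : z + h = w) ?/h ?subrKC // -/h nmM nmV ler_pdivrMl // => H.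
apply: le_trans (H _) _; first lra.
rewrite le_eqVlt; apply/orP; left; apply/eqP; field; exact: lt0r_neq0.
Qed.

Lemma deriv_quad f f' a r M : 0 < r -> holo_on a r f f' ->
  (forall z, nm (z - a) < r -> nm (f z) <= M) ->
  forall z w, nm (z - a) < r / 8 -> nm (w - a) < r / 8 ->
  nm (f w - f z - f' z * (w - z)) <= 64 * (256 * M) / r ^+ 2 * nm (w - z) ^+ 2.
Proof.
move=> r0 hf fM z w za wa; have lip := deriv_lip r0 hf fM za.
have -> : f w - f z - f' z * (w - z) = (f w - f' z * w) - (f z - f' z * z) by ring.
rewrite [nm (w - z) ^+ 2]expr2 [X in _ <= X]mulrA.
apply: (@mvi_segment (fun v => f v - f' z * v) (fun v => f' v - f' z)) => t t01.
  apply: cderB; first by apply: hf; have := seg_disc za wa t01; lra.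
  exact: cder_linear.
apply: le_trans (lip _ (seg_disc za wa t01)) _.
have M0 : 0 <= M.
  by apply: le_trans (fM a _); [exact: nm_ge0|rewrite subrr nm0].
apply: ler_wpM2l; last exact: nm_seg_tri.
by rewrite !mulr_ge0 ?ler0n // invr_ge0 exprn_ge0 // ltW.
Qed.

Lemma holo_bounded f f' a r : 0 < r -> holo_on a r f f' ->
  exists s M, [/\ 0 < s, s <= r, 0 <= M & forall z, nm (z - a) < s -> nm (f z) <= M].
Proof.
move=> r0 hf; have [|d d0 dP] := cder_cont (hf a _) (@ltr01 R); first by rewrite subrr nm0.
exists (Num.min d r), (nm (f a) + 1); split.
- by rewrite lt_min d0.
- by rewrite ge_min lexx orbT.
- by rewrite addr_ge0 ?nm_ge0.
- by move=> z; rewrite lt_min => /andP[/dP h _]; have := nmBl (f z) (f a); lra.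
Qed.

Lemma nm_lim (v : nat -> C) l c M : (forall e, 0 < e -> exists N, forall n, (N <= n)%N -> nm (v n - l) <= e) ->
  (exists N, forall n, (N <= n)%N -> nm (v n - c) <= M) -> nm (l - c) <= M.
Proof.
move=> vl [N NP]; apply/ler_addgt0Pr => e /vl[N' N'P].
apply: le_trans (nm_tri (v (maxn N N')) _ _) _; rewrite addrC (nmB l).
by apply: lerD; [apply: NP; exact: leq_maxl|apply: N'P; exact: leq_maxr].
Qed.

(* The difference quotients [D_h f] satisfy [|D_h f - f'| <= L |h|] near [a]; by
   the Cauchy estimate applied to [D_h f - D_k f], their derivatives at [a] are
   Cauchy as [h] tends to [0]. *)
Lemma deriv_cder f f' a r : 0 < r -> holo_on a r f f' -> exists l, cder f' a l.
Proof.
move=> r0 hf; have [s [M [s0 sr M0 fM]]] := holo_bounded r0 hf.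
have {}hf : holo_on a s f f' by apply: (holo_on_sub hf); rewrite subrr nm0; lra.
have [L L0 quad] : exists2 L, 0 <= L & forall z w, nm (z - a) < s / 8 -> nm (w - a) < s / 8 ->
    nm (f w - f z - f' z * (w - z)) <= L * nm (w - z) ^+ 2.
  exists (64 * (256 * M) / s ^+ 2); last exact: deriv_quad.
  by rewrite !mulr_ge0 ?ler0n // invr_ge0 exprn_ge0 // ltW.
pose D h := h^-1 * (f' (a + h) - f' a).
pose K := 64 * L / (s / 16).
have s16 : 0 < s / 16 by lra.
have K0 : 0 <= K by apply: divr_ge0; [exact: mulr_ge0 (ler0n _ _) L0|exact: ltW].
have DD h k : 0 < nm h < s / 16 -> 0 < nm k < s / 16 -> nm (D h - D k) <= K * (nm h + nm k).
  move=> /andP[h0 hs] /andP[k0 ks].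
  have -> : K * (nm h + nm k) = 64 * (L * (nm h + nm k)) / (s / 16) by rewrite /K; ring.
  have hh : holo_on a (s / 16) (fun z => h^-1 * (f (z + h) - f z)) (fun z => h^-1 * (f' (z + h) - f' z)).
    by apply: (holo_diffquot hf); lra.
  have hk : holo_on a (s / 16) (fun z => k^-1 * (f (z + k) - f z)) (fun z => k^-1 * (f' (z + k) - f' z)).
    by apply: (holo_diffquot hf); lra.
  have dq v u : 0 < nm u < s / 16 -> nm (v - a) < s / 16 -> nm (u^-1 * (f (v + u) - f v) - f' v) <= L * nm u.
    move=> /andP[u0 us] va; have := quad v (v + u).
    have -> : v + u - v = u by ring.
    have u00 : u != 0 by rewrite -nm_gt0.
    have -> : u^-1 * (f (v + u) - f v) - f' v = u^-1 * (f (v + u) - f v - f' v * u) by field.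
    move=> h1; rewrite nmM nmV mulrC ler_pdivrMr // -mulrA -expr2; apply: h1; first lra.
    by rewrite addrAC; apply: le_lt_trans (nmD _ _) _; lra.
  apply: (@deriv_bound (fun z => h^-1 * (f (z + h) - f z) - k^-1 * (f (z + k) - f z))
    (fun z => h^-1 * (f' (z + h) - f' z) - k^-1 * (f' (z + k) - f' z)) a) => //.
  - by move=> z za; apply: cderB; [exact: hh|exact: hk].
  - move=> z za; apply: le_trans (nm_tri (f' z) _ _) _; rewrite [X in _ <= X]mulrDr; apply: lerD.
      by apply: dq; rewrite ?h0.
    by rewrite nmB; apply: dq; rewrite ?k0.
  - by rewrite subrr nm0; lra.
(* Any sequence of nonzero steps tending to [0] would define the limit [l]; the bound [DD] then
   compares it with an arbitrary step. *)
pose hn (n : nat) : C := (s / 32 * 2^-1 ^+ n)%:C.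
have half01 : 0 <= (2^-1 : R) < 1 by apply/andP; split; lra.
have hnE n : nm (hn n) = s / 32 * 2^-1 ^+ n.
  by rewrite nm_real ger0_norm // mulr_ge0 ?exprn_ge0 //; lra.
have hn1 n : 0 < nm (hn n) < s / 16.
  rewrite hnE; have h1 : (2^-1 : R) ^+ n <= 1 by apply: exprn_ile1; lra.
  have h0 : 0 < (2^-1 : R) ^+ n by rewrite exprn_gt0 // invr_gt0.
  apply/andP; split; first by rewrite mulr_gt0 //; lra.
  by apply: (@le_lt_trans _ _ (s / 32)); [rewrite ler_piMr //; lra|lra].
have small e : 0 < e -> exists N, forall n, (N <= n)%N -> K * nm (hn n) <= e.
  move=> e0; have [|N NP] := @expr_small _ 2^-1 (e / (K * (s / 32) + 1)) half01.
    by rewrite divr_gt0 // ltr_wpDl // mulr_ge0 //; lra.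
  exists N => n /NP h; rewrite hnE mulrA; apply: le_trans (ler_wpM2l _ h) _.
    by rewrite mulr_ge0 //; lra.
  rewrite mulrC; apply: div_succ_le1; first exact: ltW.
  by rewrite mulr_ge0 //; lra.
have [|l lP] := @complex_cauchy _ (fun n => D (hn n)).
  move=> e e0; have [|N NP] := small (e / 2); first lra.
  exists N => m n /NP hm /NP hn'; apply: le_trans (DD _ _ (hn1 m) (hn1 n)) _.
  by rewrite [X in X <= _]mulrDr; lra.
exists l; apply: (@cder_leM _ _ _ _ K) => e e0.
exists (Num.min (s / 16) e) => [|w]; first by rewrite lt_min s16.
rewrite lt_min => /andP[ws we].
have [->|wa] := eqVneq w a; first by rewrite !subrr mulr0 subr0 nm0 mulr0.
have w0 : w - a != 0 by rewrite subr_eq0.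
have DwE : nm (l - D (w - a)) <= K * e.
  apply/ler_addgt0Pr => e' e'0; apply: (nm_lim lP).
  have [N NP] := small _ e'0; exists N => n /NP h.
  apply: le_trans (DD _ _ (hn1 n) _) _; first by rewrite nm_gt0 w0.
  by rewrite [X in X <= _]mulrDr addrC; apply: lerD => //; apply: ler_wpM2l => //; exact: ltW.
have -> : f' w - f' a - l * (w - a) = - ((l - D (w - a)) * (w - a)).
  by rewrite /D subrKC; field.
by rewrite nmN nmM; apply: ler_wpM2r => //; exact: nm_ge0.
Qed.

(** By [deriv_bound] applied to the differences [fn m - fn n], the derivatives are uniformly Cauchy
    on the half disc. The mean value inequality then transfers the first-order expansion from one
    [fn N] to the limit. *)
Lemma weierstrass (fn fn' : nat -> C -> C) g a r : 0 < r ->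
  (forall n, holo_on a r (fn n) (fn' n)) ->
  (forall e, 0 < e -> exists N, forall n z, (N <= n)%N -> nm (z - a) < r -> nm (fn n z - g z) <= e) ->
  exists l, cder g a l.
Proof.
move=> r0 hfn cvg.
pose K := 128 / r; have K0 : 0 <= K by rewrite /K divr_ge0 // ltW.
have r2 : 0 < r / 2 by lra.
have key e : 0 < e -> exists N, forall m n z, (N <= m)%N -> (N <= n)%N -> nm (z - a) < r / 2 ->
   nm (fn' m z - fn' n z) <= K * e.
  move=> e0; have [N NP] := cvg e e0; exists N => m n z Nm Nn za.
  have -> : K * e = 64 * (2 * e) / r by rewrite /K; ring.
  apply: (@deriv_bound (fun z => fn m z - fn n z) (fun z => fn' m z - fn' n z) a) => //.
    by move=> w wa; apply: cderB; exact: hfn.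
  move=> w wa; apply: le_trans (nm_tri (g w) _ _) _.
  by rewrite (nmB (g w)); have := NP m w Nm wa; have := NP n w Nn wa; lra.
have [|l lP] := @complex_cauchy _ (fun n => fn' n a).
  move=> e e0; have [|N NP] := key (e / (K + 1)); first by rewrite divr_gt0 // ltr_wpDl.
  exists N => m n Nm Nn; apply: le_trans (NP m n a Nm Nn _) _; first by rewrite subrr nm0.
  by rewrite mulrC; apply: div_succ_le1 => //; exact: ltW.
exists l; apply: (@cder_leM _ _ _ _ (1 + 2 * K)) => e e0.
have [N NP] := key e e0.
have [d d0 dP] : exists2 d, 0 < d & forall w, nm (w - a) < d ->
    nm (fn N w - fn N a - fn' N a * (w - a)) <= e * nm (w - a).
  by apply: hfn => //; rewrite subrr nm0.
exists (Num.min d (r / 2)) => [|w]; first by rewrite lt_min d0.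
rewrite lt_min => /andP[/dP wd wr].
have e1 : nm (l - fn' N a) <= K * e.
  by apply: (nm_lim lP); exists N => n Nn; apply: NP => //; rewrite subrr nm0.
have e2 : nm ((g w - g a) - (fn N w - fn N a)) <= K * e * nm (w - a).
  apply: (@nm_lim (fun n => fn n w - fn n a)).
    move=> e' e'0; have [|N' N'P] := cvg (e' / 2); first lra.
    exists N' => n Nn; have -> : fn n w - fn n a - (g w - g a) = (fn n w - g w) - (fn n a - g a) by ring.
    apply: le_trans (nmD _ _) _; rewrite nmN.
    have := N'P n w Nn; have := N'P n a Nn; rewrite subrr nm0 => /(_ r0) h1 /(_ _) h2.
    by have := h2 ltac:(lra); lra.
  exists N => n Nn; rewrite (_ : _ - _ = (fn n w - fn N w) - (fn n a - fn N a)); last by ring.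
  apply: (@mvi_disc (fun z => fn n z - fn N z) (fun z => fn' n z - fn' N z) a (r / 2)) => //.
  - by move=> z za; apply: cderB; apply: hfn; lra.
  - by move=> z za; exact: NP.
  - by rewrite subrr nm0.
rewrite (_ : _ - _ = ((g w - g a) - (fn N w - fn N a)) + (fn N w - fn N a - fn' N a * (w - a))
   - (l - fn' N a) * (w - a)); last by ring.
apply: le_trans (nmD _ _) _; rewrite nmN nmM; apply: le_trans (lerD (nmD _ _) (lexx _)) _.
have := ler_wpM2r (nm_ge0 (w - a)) e1; lra.
Qed.

End LocalTheory.

(** * Limits, factorization and zeros of holomorphic functions on a disc *)

Section Holomorphic.
Variable R : realType.
Local Notation C := R[i].
Implicit Types (f g : C -> C) (p : nat) (z w l c u a : C) (r t s e d M : R).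

Definition hol a r f := forall z, nm (z - a) < r -> exists l, cder f z l.

(** A total function; its value is meaningful only where some [cder] holds. *)
Definition dv f : C -> C := @derive1 R[i] (R[i]^o) f.

Lemma cder_dv f z l : cder f z l -> cder f z (dv f z).
Proof. by move=> /[dup] /cder_derive1 fl; rewrite /dv fl. Qed.

Lemma dvE f z l : cder f z l -> dv f z = l.
Proof. exact: cder_derive1. Qed.

Lemma hol_dv a r f : hol a r f -> holo_on a r f (dv f).
Proof. by move=> hf z /hf[l /cder_dv]. Qed.

Lemma holo_on_hol a r f f' : holo_on a r f f' -> hol a r f.
Proof. by move=> hf z /hf; exists (f' z). Qed.

Lemma hol_sub f a b r s : hol a r f -> nm (b - a) + s <= r -> hol b s f.
Proof. by move=> /hol_dv /holo_on_sub h /h /holo_on_hol. Qed.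

Lemma hol_le f a r s : hol a r f -> s <= r -> hol a s f.
Proof. by move=> hf sr; apply: (hol_sub hf); rewrite subrr nm0 add0r. Qed.

Lemma nm_aa a r : 0 < r -> nm (a - a) < r.
Proof. by rewrite subrr nm0. Qed.

Lemma hol_cst a r c : hol a r (fun=> c).
Proof. by move=> z _; exists 0; exact: cder_cst. Qed.

Lemma hol_id a r : hol a r id.
Proof. by move=> z _; exists 1; exact: cder_id. Qed.

Lemma holB a r f g : hol a r f -> hol a r g -> hol a r (fun z => f z - g z).
Proof. by move=> hf hg z za; have [l ?] := hf z za; have [k ?] := hg z za; exists (l - k); exact: cderB. Qed.

Lemma holM a r f g : hol a r f -> hol a r g -> hol a r (fun z => f z * g z).
Proof. by move=> hf hg z za; have [l hl] := hf z za; have [k hk] := hg z za; eexists; exact: cderM hl hk. Qed.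

Lemma hol_comp a r b s g f : hol a r f -> hol b s g ->
  (forall z, nm (z - a) < r -> nm (f z - b) < s) -> hol a r (fun z => g (f z)).
Proof.
move=> hf hg fs z za; have [l ?] := hf z za; have [k ?] := hg _ (fs z za).
by exists (k * l); apply: cder_comp.
Qed.

Lemma hol_deriv a r f : hol a r f -> hol a r (dv f).
Proof.
move=> hf z za; apply: (@deriv_cder _ f _ z (r - nm (z - a))); first by rewrite subr_gt0.
by apply: (holo_on_sub (hol_dv hf)); rewrite subrKC.
Qed.

Lemma hol_bounded f a r : 0 < r -> hol a r f ->
  exists s M, [/\ 0 < s, s <= r, 0 <= M & forall z, nm (z - a) < s -> nm (f z) <= M].
Proof. by move=> r0 /hol_dv; exact: holo_bounded. Qed.

Lemma hol_limit (fn : nat -> C -> C) g a r : (forall n, hol a r (fn n)) ->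
  (forall e, 0 < e -> exists N, forall n z, (N <= n)%N -> nm (z - a) < r -> nm (fn n z - g z) <= e) ->
  hol a r g.
Proof.
move=> hfn cvg z za; apply: (@weierstrass _ fn (fun n => dv (fn n)) g z (r - nm (z - a))).
- by rewrite subr_gt0.
- by move=> n; apply: (holo_on_sub (hol_dv (hfn n))); rewrite subrKC.
move=> e /cvg[N NP]; exists N => n w Nn wz; apply: NP => //.
by apply: le_lt_trans (nm_tri z _ _) _; lra.
Qed.

(** The quotient, extended by [f' a] at [a], is differentiable there because [f'] is itself
    differentiable at [a]. *)
Lemma hol_div f a r : 0 < r -> hol a r f -> f a = 0 ->
  exists2 q, hol a r q & forall z, f z = (z - a) * q z.
Proof.
move=> r0 hf fa0; pose q z := if z == a then dv f a else f z / (z - a).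
exists q => z; last first.
  rewrite /q; case: eqVneq => [->|za]; first by rewrite subrr mul0r.
  by field; rewrite subr_eq0.
have [->{z} _|za zr] := eqVneq z a.
  have [l fl] := hol_deriv hf (nm_aa a r0).
  (* The derivative of the quotient is half of [l = f'' a]. Subtracting the second-order Taylor
     polynomial from [f] leaves a function whose derivative is at most [e |v - a|], and the mean
     value inequality bounds its increment by [e |w - a|^2]. *)
  exists (l / 2); apply: (@cder_leM _ _ _ _ 1) => e e0.
  have [d d0 dP] := fl e e0; exists (Num.min d r) => [|w]; first by rewrite lt_min d0.
  rewrite lt_min => /andP[wd wr]; rewrite /q eqxx mul1r.
  case: eqVneq => [->|wa]; first by rewrite !subrr mulr0 subr0 nm0 mulr0.
  have w0 : w - a != 0 by rewrite subr_eq0.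
  have -> : f w / (w - a) - dv f a - l / 2 * (w - a) =
      ((f w - dv f a * w - l / 2 * (w - a) ^+ 2) - (f a - dv f a * a - l / 2 * (a - a) ^+ 2)) / (w - a).
    by rewrite fa0; field.
  rewrite nmM nmV ler_pdivrMr ?nm_gt0 //.
  apply: (@mvi_segment _ (fun v => f v - dv f a * v - l / 2 * (v - a) ^+ 2)
     (fun v => dv f v - dv f a - l / 2 * (2 * (v - a) ^+ 1 * (1 - 0)))) => t t01.
    have st : nm (seg a w t - a) < r by apply: seg_disc => //; exact: nm_aa.
    apply: cderB; first by apply: cderB; [exact: (hol_dv hf st)|exact: cder_linear].
    apply: cderZ; apply: (@cder_comp _ (fun v => v ^+ 2) (fun v => v - a)).
      by apply: cderB; [exact: cder_id|exact: cder_cst].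
    exact: cderX.
  rewrite (_ : l / 2 * _ = l * (seg a w t - a)); last by rewrite expr1; field.
  have sw := nm_seg_tri a w t01.
  apply: le_trans (dP _ _) _; first exact: le_lt_trans sw wd.
  by apply: ler_wpM2l => //; exact: ltW.
have [k kP] := hf z zr.
have z0 : z - a != 0 by rewrite subr_eq0.
exists (k * (z - a)^-1 + f z * (- ((z - a) ^+ 2)^-1 * (1 - 0))).
apply: (@cder_near _ (fun w => f w * (w - a)^-1) _ _ _ (nm (z - a))); first by rewrite nm_gt0.
  move=> w wz; rewrite /q; case: eqVneq => [wa|//].
  by move: wz; rewrite wa (nmB a) ltxx.
apply: cderM => //; apply: (@cder_comp _ (fun v => v^-1) (fun v => v - a)).
  by apply: cderB; [exact: cder_id|exact: cder_cst].
exact: cder_inv.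
Qed.

(* The Cauchy estimate for [(z - a) f z], whose derivative at [a] is [f a],
   bounds [f] at the centre by its values on an annulus. *)
Lemma center_bound f a r s M : 0 < s -> 2 * s < r -> hol a r f ->
  (forall z, s <= nm (z - a) <= 2 * s -> nm (f z) <= M) -> nm (f a) <= 16 * M.
Proof.
move=> s0 sr hf fM; have r0 : 0 < r by lra.
have lin z : cder (fun w => w - a) z (1 - 0) by apply: cderB; [exact: cder_id|exact: cder_cst].
have [l fl] := hf a (nm_aa a r0).
have -> : 16 * M = 8 * (2 * s * M) / s by field; exact: lt0r_neq0.
have -> : f a = (1 - 0) * f a + (a - a) * l by ring.
apply: (@cauchy_estimate _ (fun z => (z - a) * f z) a r) => //.
- by move=> z /hf[k kP]; eexists; apply: cderM kP; exact: lin.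
- by apply: cderM fl; exact: lin.
- move=> z /[dup] zs /andP[z1 z2]; rewrite nmM; apply: ler_pM; rewrite ?nm_ge0 //.
  exact: fM.
Qed.

(* If [f] were divisible by all powers of [z - a], its quotients by [(z - a) ^ n]
   would be bounded near [a] through their values on a fixed annulus, which
   forces [f] to vanish near [a]. *)
Lemma hol_order f a r : 0 < r -> hol a r f ->
  (exists2 d : R, 0 < d & forall z, nm (z - a) < d -> f z = 0) \/
  exists (p : nat) g d, [/\ 0 < d, d <= r, hol a d g, g a != 0 & forall z, f z = (z - a) ^+ p * g z].
Proof.
move=> r0 hf; have [s [M [s0 sr M0 fM]]] := hol_bounded r0 hf.
have {}hf := hol_le hf sr.
have [|H] := pselect (exists p g, [/\ hol a s g, g a != 0 & forall z, f z = (z - a) ^+ p * g z]).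
  by move=> [p [g [? ? ?]]]; right; exists p, g, s.
left; have div n : exists2 g, hol a s g & forall z, f z = (z - a) ^+ n * g z.
  elim: n => [|n [g hg gE]]; first by exists f => // z; rewrite expr0 mul1r.
  have [ga0|ga0] := eqVneq (g a) 0; last by case: H; exists n, g.
  have [h hh hE] := hol_div s0 hg ga0.
  by exists h => // z; rewrite gE hE exprSr; ring.
exists (s / 32) => [|z zs]; first lra.
apply/eqP; rewrite -nm_le0; apply/ler_addgt0Pr => e e0; rewrite add0r.
have half01 : 0 <= (2^-1 : R) < 1 by apply/andP; split; lra.
have M1 : 0 < 16 * M + 1 by lra.
have [|n nP] := @expr_small _ 2^-1 (e / (16 * M + 1)) half01; first by rewrite divr_gt0.
have [g hg gE] := div n.
have s16 : 0 < s / 16 by lra.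
(* On the annulus about [z] one has [|w - a| >= s / 16], whereas [|z - a| < s / 32]; the ratio of
   the two radii produces the factor [2^-n]. *)
have gz : nm (g z) <= 16 * (M * (16 / s) ^+ n).
  apply: (@center_bound g z (s / 2) (s / 8)); [lra|lra| |].
    by apply: (hol_sub hg); lra.
  move=> w /andP[w1 w2].
  have wa : nm (w - a) < s by apply: le_lt_trans (nm_tri z _ _) _; lra.
  have wa' : s / 16 <= nm (w - a).
    by have := nm_tri a w z; rewrite (nmB a z); lra.
  have wa0 : 0 < nm (w - a) by lra.
  have : nm (f w) <= M by exact: fM.
  rewrite gE nmM nmX => h.
  rewrite -(@ler_pM2l _ (nm (w - a) ^+ n)) ?exprn_gt0 //.
  apply: le_trans h _; rewrite mulrCA -exprMn -[X in X <= _]mulr1.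
  apply: ler_wpM2l => //; apply: exprn_ege1.
  by rewrite -(@ler_pM2l _ (s / 16)) // mulr1 [X in _ <= X](_ : _ = nm (w - a)) //; field; exact: lt0r_neq0.
rewrite gE nmM nmX; have zn : nm (z - a) ^+ n <= (s / 32) ^+ n.
  by apply: lerXn2r; rewrite ?nnegrE ?nm_ge0 ?(ltW zs) //; lra.
apply: le_trans (ler_pM _ _ zn gz) _; rewrite ?exprn_ge0 ?nm_ge0 //.
rewrite (_ : (s / 32) ^+ n * (16 * (M * (16 / s) ^+ n)) = 16 * M * ((s / 32) * (16 / s)) ^+ n); last first.
  by rewrite [(s / 32 * _) ^+ n]exprMn; set A := (s / 32) ^+ n; set B := (16 / s) ^+ n; ring.
rewrite (_ : s / 32 * (16 / s) = 2^-1); last by field; exact: lt0r_neq0.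
have := nP n (leqnn _) => /(ler_wpM2l (_ : 0 <= 16 * M)) h; apply: le_trans (h _) _; first lra.
by rewrite mulrC; apply: div_succ_le1; lra.
Qed.

Lemma hol_isolated_zeros f a r : 0 < r -> hol a r f ->
  (exists2 d : R, 0 < d & forall z, nm (z - a) < d -> f z = 0) \/
  (exists2 d : R, 0 < d & forall z, 0 < nm (z - a) < d -> f z != 0).
Proof.
move=> r0 hf; have [|[p [g [d [d0 dr hg ga gE]]]]] := hol_order r0 hf; [by left|right].
have [l gl] := hg a (nm_aa a d0).
have [|d' d'0 d'P] := cder_cont gl (_ : 0 < nm (g a)); first by rewrite nm_gt0.
exists d' => // z /andP[z0 zd]; rewrite gE mulf_neq0 ?expf_neq0 -?nm_gt0 //.
by have := d'P z zd; have := nmBl (g a) (g z); rewrite (nmB (g a)); lra.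
Qed.

End Holomorphic.

(** * Identity theorem and local inverses *)

Section IdentityInverse.
Variable R : realType.
Local Notation C := R[i].
Implicit Types (f g : C -> C) (p : nat) (z w l c u a b : C) (r t s e d M : R).

Lemma open_nmP (U : set R[i]^o) : open U <->
  forall z, U z -> exists2 r : R, 0 < r & forall w, nm (w - z) < r -> U w.
Proof.
rewrite openE; split=> H z /H; first by move/nbhs_nmP.
by move=> h; apply/nbhs_nmP.
Qed.

Lemma closure_nmP (A : set R[i]^o) (z : R[i]^o) : closure A z <->
  forall d : R, 0 < d -> exists2 w, A w & nm (w - z) < d.
Proof.
split=> [Az d d0|H B /nbhs_nmP[d d0 dB]].
  have [|w [Aw wz]] := Az [set w | nm (w - z) < d]; last by exists w.
  by apply/nbhs_nmP; exists d.
by have [w Aw wz] := H d d0; exists w; split => //; exact: dB.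
Qed.

(** The points near which [f] vanishes identically form an open set. It is also closed in [U]: at
    one of its limit points the zeros of [f] are not isolated. Connectedness concludes. *)
Lemma identity_theorem (U : set R[i]^o) f : domain U ->
  (forall z, U z -> exists l, cder f z l) ->
  (exists2 a, U a & exists2 d : R, 0 < d & forall z, nm (z - a) < d -> f z = 0) ->
  forall z, U z -> f z = 0.
Proof.
move=> [/open_nmP oU cU] fU [a Ua fa].
pose V : set R[i]^o := [set z | exists2 d : R, 0 < d & forall w, nm (w - z) < d -> f w = 0].
suff UV : U `&` V = U.
  move=> z; rewrite -UV => -[_ [d d0 dP]]; apply: dP; exact: nm_aa.
apply: cU; first by exists a.
  exists V => //; apply/open_nmP => z [d d0 dP]; exists d => // w wz.
  exists (d - nm (w - z)) => [|v vw]; first by rewrite subr_gt0.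
  by apply: dP; apply: le_lt_trans (nm_tri w _ _) _; lra.
exists (closure V); first exact: closed_closure.
apply/seteqP; split=> z [Uz Vz]; split => //; first exact: subset_closure.
have [r r0 rU] := oU z Uz.
have hf : hol z r f by move=> w /rU /fU.
have [//|[d d0 dP]] := hol_isolated_zeros r0 hf.
have [w [d' d'0 d'P] wd] := (closure_nmP _ _).1 Vz d d0.
(* A zero distinct from [z] is needed; when the approximating point is [z] itself, a small real
   translation provides one. *)
have [v [vz vd vw]] : exists v, [/\ v != z, nm (v - z) < d & nm (v - w) < d'].
  have [wz|wz] := eqVneq w z; last by exists w; split => //; exact: nm_aa.
  pose m := Num.min d d' / 2.
  have m0 : 0 < m by rewrite /m divr_gt0 // lt_min d0.
  have md : m < d by rewrite /m ltr_pdivrMr //; have : Num.min d d' <= d by [rewrite ge_min lexx]; lra.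
  have md' : m < d'.
    by rewrite /m ltr_pdivrMr //; have : Num.min d d' <= d' by [rewrite ge_min lexx orbT]; lra.
  exists (z + m%:C); rewrite wz addrAC subrr add0r nm_real gtr0_norm //; split => //.
  by rewrite -subr_eq0 addrAC subrr add0r -nm_gt0 nm_real gtr0_norm.
have := dP v; rewrite nm_gt0 subr_eq0 vz vd => /(_ isT).
by rewrite d'P // eqxx.
Qed.

(** The relative error [1/2] yields injectivity, and makes Newton's iteration with constant slope
    [c] contract by [1/2]. *)
Definition near_linear a r c f := forall z w, nm (z - a) < r -> nm (w - a) < r ->
  nm (f w - f z - c * (w - z)) <= nm c / 2 * nm (w - z).

Lemma deriv_near f a r e : 0 < r -> hol a r f -> 0 < e -> exists s,
  [/\ 0 < s, s <= r & forall z w, nm (z - a) < s -> nm (w - a) < s ->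
      nm (f w - f z - dv f a * (w - z)) <= e * nm (w - z)].
Proof.
move=> r0 hf e0; have [l fl] := hol_deriv hf (nm_aa a r0).
have [d d0 dP] := cder_cont fl e0.
exists (Num.min d r); split; first by rewrite lt_min d0.
  by rewrite ge_min lexx orbT.
move=> z w za wa.
rewrite (_ : _ - _ = (f w - dv f a * w) - (f z - dv f a * z)); last by ring.
apply: (@mvi_disc _ (fun v => f v - dv f a * v) (fun v => dv f v - dv f a) a (Num.min d r)) => //.
  move=> v; rewrite lt_min => /andP[_ va].
  by apply: cderB; [exact: (hol_dv hf)|exact: cder_linear].
by move=> v; rewrite lt_min => /andP[/dP/ltW].
Qed.

Lemma near_linear_ex f a r : 0 < r -> hol a r f -> dv f a != 0 ->
  exists s, [/\ 0 < s, s <= r & near_linear a s (dv f a) f].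
Proof. by move=> r0 hf c0; apply: (deriv_near r0 hf); rewrite divr_gt0 // nm_gt0. Qed.

Lemma near_linear_expand f a r c z w : near_linear a r c f -> nm (z - a) < r -> nm (w - a) < r ->
  nm c / 2 * nm (w - z) <= nm (f w - f z) <= 3 / 2 * nm c * nm (w - z).
Proof.
move=> H za wa; have := H z w za wa.
have := nmBl (c * (w - z)) (c * (w - z) - (f w - f z)).
have := nmD (f w - f z - c * (w - z)) (c * (w - z)).
rewrite subrK (nmB (c * (w - z))) opprB subrKC nmM => h1 h2 h3.
by apply/andP; split; lra.
Qed.

Lemma near_linear_inj f a r c z w : c != 0 -> near_linear a r c f ->
  nm (z - a) < r -> nm (w - a) < r -> f z = f w -> z = w.
Proof.
move=> c0 H za wa fzw; have /andP[+ _] := near_linear_expand H za wa.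
rewrite fzw subrr nm0 pmulr_rle0 ?divr_gt0 ?nm_gt0 // nm_le0 subr_eq0.
by move=> /eqP.
Qed.

(** Newton's iteration with slope frozen at [c] solves [f x = y]. The condition
    [|y - f a| < |c| r / 4] bounds the first step by [r / 4], so the iterates, starting at [a],
    remain in the disc of radius [r / 2]. *)
Lemma local_inverse f a r c : 0 < r -> c != 0 -> hol a r f -> near_linear a r c f ->
  exists k : C -> C, [/\ hol (f a) (nm c * r / 4) k,
    forall y, nm (y - f a) < nm c * r / 4 -> f (k y) = y /\ nm (k y - a) <= 2 / nm c * nm (y - f a)
  & forall y z, nm (y - f a) < nm c * r / 4 -> nm (z - f a) < nm c * r / 4 ->
      nm (k y - k z) <= 2 / nm c * nm (y - z)].
Proof.
move=> r0 c0 hf nl; have nc : 0 < nm c by rewrite nm_gt0.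
have half01 : 0 <= (2^-1 : R) < 1 by apply/andP; split; lra.
have sol y : exists x, nm (y - f a) < nm c * r / 4 -> f x = y /\ nm (x - a) <= 2 / nm c * nm (y - f a).
  have [yr|] := ltP (nm (y - f a)) (nm c * r / 4); last by exists a.
  pose T x := x - (f x - y) / c; pose x n := iter n T a.
  pose m := nm (y - f a) / nm c.
  have m0 : 0 <= m by rewrite /m divr_ge0 ?nm_ge0.
  have mr : m < r / 4 by rewrite /m ltr_pdivrMr //; lra.
  have TT z w : nm (z - a) < r -> nm (w - a) < r -> nm (T w - T z) <= 2^-1 * nm (w - z).
    move=> za wa; rewrite /T (_ : _ - _ = - ((f w - f z - c * (w - z)) / c)); last by field.
    rewrite nmN nmM nmV ler_pdivrMr //; have := nl z w za wa; lra.
  have xP n : nm (x n - a) <= 2 * m * (1 - 2^-1 ^+ n) /\ nm (x n.+1 - x n) <= m * 2^-1 ^+ n.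
    elim: n => [|n [IH1 IH2]].
      rewrite /x /= /T !expr0 subrr nm0 mulr1 subrr mulr0 addrAC subrr add0r nmN nmM nmV.
      by rewrite (nmB (f a)) /m.
    have p0 : 0 <= (2^-1 : R) ^+ n by rewrite exprn_ge0.
    have xn1 : nm (x n.+1 - a) <= 2 * m * (1 - 2^-1 ^+ n.+1).
      by apply: le_trans (nm_tri (x n) _ _) _; rewrite exprS; lra.
    have p1 : 0 <= m * (2^-1 : R) ^+ n by rewrite mulr_ge0.
    split => //; apply: le_trans (TT (x n) (x n.+1) _ _) _; rewrite ?exprS; try nra.
    by rewrite exprS in xn1; nra.
  have [l lP] := complex_geometric half01 (fun n => (xP n).2).
  exists l => _; have half : (1 - 2^-1)^-1 = 2 :> R by field.
  have la : nm (l - a) <= 2 * m.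
    by have := lP 0%N; rewrite /x /= expr0 mulr1 half (nmB a); lra.
  split; last by rewrite /m in la; rewrite mulrAC -mulrA.
  have lr : nm (l - a) < r by lra.
  have xr n : nm (x n - a) < r.
    have [h _] := xP n; have : 0 <= (2^-1 : R) ^+ n by rewrite exprn_ge0.
    nra.
  apply/eqP; rewrite -subr_eq0 -nm_le0; apply/ler_addgt0Pr => e e0; rewrite add0r.
  have A0 : 0 <= 4 * nm c * m by exact: mulr_ge0 (mulr_ge0 (ler0n _ 4) (nm_ge0 c)) m0.
  have [|n nP] := @expr_small _ 2^-1 (e / (4 * nm c * m + 1)) half01.
    by rewrite divr_gt0 // ltr_wpDl.
  have [_ h1] := xP n; have h2 := lP n; rewrite half in h2.
  have fx : f (x n) - y = - (c * (x n.+1 - x n)).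
    by rewrite /x iterS -/(x n) /T; field.
  have /andP[_ h3] := near_linear_expand nl (xr n) lr.
  apply: le_trans (nm_tri (f (x n)) _ _) _; rewrite fx nmN nmM.
  have := ler_wpM2l (nm_ge0 c) h1; rewrite (nmB l) in h3.
  have h4 := ler_wpM2l (_ : 0 <= 3 / 2 * nm c) h2.
  have h5 : 4 * nm c * m * 2^-1 ^+ n <= e.
    apply: le_trans (ler_wpM2l A0 (nP n (leqnn _))) _.
    by rewrite mulrC; apply: div_succ_le1 => //; exact: ltW.
  have {}h4 := h4 ltac:(lra); lra.
have [k kP] := boolp.choice sol; exists k.
have cr : 0 < nm c * r by rewrite mulr_gt0.
have kr y : nm (y - f a) < nm c * r / 4 -> nm (k y - a) < r.
  move=> yr; have [_ h] := kP y yr; apply: le_lt_trans h _.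
  by rewrite mulrAC ltr_pdivrMr //; lra.
have kl y z : nm (y - f a) < nm c * r / 4 -> nm (z - f a) < nm c * r / 4 ->
    nm (k y - k z) <= 2 / nm c * nm (y - z).
  move=> yr zr; have /andP[h _] := near_linear_expand nl (kr _ zr) (kr _ yr).
  rewrite (kP y yr).1 (kP z zr).1 in h.
  by rewrite mulrAC ler_pdivlMr //; lra.
split => // y yr; have [l fl] := hf _ (kr y yr); exists l^-1.
(* The expansion bound along one small real step from [k y] shows that the derivative of [f] there
   has modulus at least [|c| / 4]. *)
have [l0 lc] : l != 0 /\ nm c / 4 <= nm l.
  have [d d0 dP] := fl (nm c / 4) ltac:(lra).
  pose h := Num.min d (r - nm (k y - a)) / 2.
  have m0 : 0 < Num.min d (r - nm (k y - a)) by rewrite lt_min d0 subr_gt0 kr.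
  have h0 : 0 < h by rewrite divr_gt0.
  have hd : h < d by rewrite ltr_pdivrMr //; have : Num.min d (r - nm (k y - a)) <= d by [rewrite ge_min lexx]; lra.
  have hr : h < r - nm (k y - a).
    by rewrite ltr_pdivrMr //; have : Num.min d (r - nm (k y - a)) <= r - nm (k y - a) by [rewrite ge_min lexx orbT]; lra.
  have hE : k y + h%:C - k y = h%:C by ring.
  have nh : nm h%:C = h by rewrite nm_real gtr0_norm.
  have h1 := dP (k y + h%:C); rewrite hE nh in h1.
  have khr : nm (k y + h%:C - a) < r.
    by rewrite addrAC; apply: le_lt_trans (nmD _ _) _; rewrite nh; lra.
  have /andP[h2 _] := near_linear_expand nl (kr _ yr) khr.
  rewrite hE nh in h2; have := nmBl (f (k y + h%:C) - f (k y)) (l * h%:C).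
  rewrite nmM nh => h3; have {}h1 := h1 hd.
  have : nm c / 4 * h <= nm l * h by lra.
  rewrite ler_pM2r // => lc; split => //; rewrite -nm_gt0; lra.
apply: (@cder_leM _ _ _ _ (8 / (nm c * nm c))) => e e0.
have [d d0 dP] := fl e e0.
exists (Num.min (nm c * d / 2) (nm c * r / 4 - nm (y - f a))) => [|v].
  by rewrite lt_min subr_gt0 yr andbT divr_gt0 // mulr_gt0.
rewrite lt_min => /andP[v1 v2].
have vr : nm (v - f a) < nm c * r / 4 by apply: le_lt_trans (nm_tri y _ _) _; lra.
have kd : nm (k v - k y) < d.
  by apply: le_lt_trans (kl _ _ vr yr) _; rewrite mulrAC ltr_pdivrMr //; lra.
have := dP _ kd; rewrite (kP y yr).1 (kP v vr).1 => h.
rewrite (_ : _ - _ = - ((v - y - l * (k v - k y)) / l)); last by field.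
have nl0 : 0 < nm l by lra.
rewrite nmN nmM nmV ler_pdivrMr //; apply: le_trans h _.
apply: le_trans (ler_wpM2l (ltW e0) (kl _ _ vr yr)) _.
have -> : e * (2 / nm c * nm (v - y)) = 8 / (nm c * nm c) * e * nm (v - y) * (nm c / 4).
  by field; exact: lt0r_neq0.
apply: ler_wpM2l => //; rewrite !mulr_ge0 ?nm_ge0 ?ler0n ?(ltW e0) //.
by rewrite invr_ge0 mulr_ge0 // ltW.
Qed.

End IdentityInverse.

(** * Linearization and rescaling *)

Section Koenigs.
Variable R : realType.
Local Notation C := R[i].
Implicit Types (f g G : C -> C) (p : nat) (z w l c u a b : C) (r t s e d M : R).

Lemma hol_quad f a r : 0 < r -> hol a r f -> exists s A, [/\ 0 < s, s <= r, 0 <= A &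
  forall z w, nm (z - a) < s -> nm (w - a) < s ->
    nm (f w - f z - dv f z * (w - z)) <= A * nm (w - z) ^+ 2].
Proof.
move=> r0 hf; have [s [M [s0 sr M0 fM]]] := hol_bounded r0 hf.
exists (s / 8), (64 * (256 * M) / s ^+ 2); split; [lra|lra| |].
  by rewrite !mulr_ge0 ?ler0n // invr_ge0 exprn_ge0 // ltW.
exact: (deriv_quad s0 (hol_dv (hol_le hf sr)) fM).
Qed.

(* Koenigs linearization: [f] is the limit of [l ^- n (G^n - b)]. *)
Lemma koenigs G b s : 0 < s -> hol b s G -> G b = b -> 0 < nm (dv G b) < 1 ->
  exists r f, [/\ 0 < r, r <= s, hol b r f, (f b = 0) /\ (dv f b = 1) &
    forall z, nm (z - b) < r -> nm (G z - b) <= nm (z - b) /\ f (G z) = dv G b * f z].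
Proof.
move=> s0 hG Gb; set l := dv G b => /andP[l0 l1].
have l00 : l != 0 by rewrite -nm_gt0.
have [s1 [A [s10 s1s A0 GA]]] := hol_quad s0 hG.
(* With this [ep], the contraction rate [mu = |l| + ep] satisfies both [mu < 1] and [mu^2 < |l|];
   the second inequality makes the Koenigs sequence converge. *)
set x := nm l in l0 l1 *; pose ep := x * (1 - x) / 2.
have ep0 : 0 < ep by rewrite /ep divr_gt0 // mulr_gt0 // subr_gt0.
pose mu := x + ep.
have mu0 : 0 < mu by rewrite addr_gt0.
have mu1 : mu < 1 by rewrite /mu /ep; nra.
have mux : mu ^+ 2 < x.
  rewrite -subr_gt0 (_ : x - mu ^+ 2 = x * ((1 - x) ^+ 2 * (3 + (1 - x)) / 4)); last by rewrite /mu /ep; field.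
  by rewrite mulr_gt0 // divr_gt0 // mulr_gt0 ?exprn_gt0 ?subr_gt0 //; lra.
(* On this disc the quadratic error of [G] is at most [ep |z - b|], whence the rate [mu]. *)
pose r := Num.min s1 (ep / (A + 1)).
have r0 : 0 < r by rewrite lt_min s10 divr_gt0 // ltr_wpDl.
have rs1 : r <= s1 by rewrite ge_min lexx.
have Ar : A * r <= ep.
  have : r <= ep / (A + 1) by rewrite ge_min lexx orbT.
  move=> /(ler_wpM2l A0)/le_trans; apply; rewrite mulrC; apply: div_succ_le1 => //; exact: ltW.
have lin z : nm (z - b) < r -> nm (G z - b - l * (z - b)) <= A * nm (z - b) ^+ 2.
  move=> zr; have := GA b z; rewrite Gb; apply; first exact: nm_aa.
  exact: lt_le_trans rs1.
have Gmu z : nm (z - b) < r -> nm (G z - b) <= mu * nm (z - b).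
  move=> zr; rewrite -[G z - b](subrK (l * (z - b))); apply: le_trans (nmD _ _) _.
  rewrite nmM -/x /mu mulrDl addrC lerD2l; apply: le_trans (lin z zr) _.
  rewrite expr2 mulrA; apply: ler_wpM2r; first exact: nm_ge0.
  by apply: le_trans Ar; apply: ler_wpM2l => //; exact: ltW.
have n0 z := nm_ge0 z.
have Gn n z : nm (z - b) < r -> nm (iter n G z - b) <= mu ^+ n * nm (z - b) /\ nm (iter n G z - b) < r.
  move=> zr; elim: n => [|n [IH1 IH2]]; first by rewrite expr0 mul1r.
  rewrite iterS; have h := Gmu _ IH2; split.
    by apply: le_trans h _; rewrite exprS -mulrA; apply: ler_wpM2l IH1; exact: ltW.
  apply: le_lt_trans IH2; apply: le_trans h _; rewrite ler_piMl //; exact: ltW.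
pose F n z := (l ^+ n)^-1 * (iter n G z - b).
pose q := mu ^+ 2 / x.
have q01 : 0 <= q < 1.
  by rewrite /q divr_ge0 ?sqr_ge0 ?(ltW l0) //= ltr_pdivrMr // mul1r.
have q1 : 0 < 1 - q by case/andP: q01; rewrite subr_gt0.
(* The quadratic error at the n-th iterate is of order [mu^(2n)] and is divided by [l^(n+1)], which
   leaves the ratio [q = mu^2 / |l|]. *)
have step n z : nm (z - b) < r -> nm (F n.+1 z - F n z) <= (A / x * nm (z - b) ^+ 2) * q ^+ n.
  move=> zr; have [h1 h2] := Gn n z zr.
  have ln0 : l ^+ n != 0 by rewrite expf_neq0.
  have -> : F n.+1 z - F n z = (l ^+ n.+1)^-1 * (G (iter n G z) - b - l * (iter n G z - b)).
    by rewrite /F iterS exprS; move: (l ^+ n) ln0 => y y0; field; rewrite y0 l00.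
  rewrite nmM nmV nmX -/x exprS.
  have := lin _ h2; set B := nm _; set D := nm (iter _ _ _ - b) in h1 *; move=> h3.
  have xn : 0 < x ^+ n by rewrite exprn_gt0.
  rewrite ler_pdivrMl ?mulr_gt0 //.
  apply: le_trans h3 _.
  have -> : x * x ^+ n * (A / x * nm (z - b) ^+ 2 * q ^+ n) = A * (mu ^+ n * nm (z - b)) ^+ 2.
    have -> : q ^+ n = (mu ^+ n) ^+ 2 / x ^+ n by rewrite /q expr_div_n -!exprM mulnC.
    by move: (mu ^+ n) (x ^+ n) xn => y y' y'0; field; rewrite !lt0r_neq0.
  apply: ler_wpM2l => //; apply: lerXn2r => //; rewrite nnegrE ?/D ?n0 //.
  by apply: mulr_ge0; rewrite ?n0 // exprn_ge0 // ltW.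
have lim z : exists y, nm (z - b) < r -> forall n, nm (F n z - y) <= (A / x * nm (z - b) ^+ 2) * q ^+ n / (1 - q).
  have [zr|_] := boolP (nm (z - b) < r); last by exists 0.
  by have [y yP] := complex_geometric q01 (fun n => step n z zr); exists y.
have [f fP] := boolp.choice lim.
have hGr : hol b r G by apply: hol_le hG _; apply: le_trans rs1 _.
have hI n : hol b r (iter n G).
  elim: n => [|n IH]; first exact: hol_id.
  by apply: (hol_comp IH hGr) => z /(Gn n)[].
have hF n : hol b r (F n).
  by apply: holM; [exact: hol_cst|apply: holB; [exact: hI|exact: hol_cst]].
pose B := A / x * r ^+ 2 / (1 - q).
have Ax : 0 <= A / x by apply: divr_ge0 => //; exact: ltW.
have B0 : 0 <= B by apply: divr_ge0; [exact: mulr_ge0 Ax (sqr_ge0 _)|exact: ltW].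
have unif n z : nm (z - b) < r -> nm (F n z - f z) <= B * q ^+ n.
  move=> zr; apply: le_trans (fP z zr n) _; rewrite /B [X in _ <= X]mulrAC.
  apply: ler_wpM2r; first by rewrite invr_ge0 ltW.
  apply: ler_wpM2r; first by case/andP: q01 => ? _; rewrite exprn_ge0.
  apply: ler_wpM2l => //; apply: lerXn2r; rewrite ?nnegrE ?n0 //; exact: ltW.
have cvg e : 0 < e -> exists N, forall n z, (N <= n)%N -> nm (z - b) < r -> nm (F n z - f z) <= e.
  move=> e0; have [|N NP] := expr_small q01 (_ : 0 < e / (B + 1)).
    by rewrite divr_gt0 // ltr_wpDl.
  exists N => n z /NP h zr; apply: le_trans (unif n z zr) _.
  apply: le_trans (ler_wpM2l B0 h) _; rewrite mulrC; apply: div_succ_le1 => //; exact: ltW.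
have fb : f b = 0.
  have := fP b (nm_aa b r0) 0%N; rewrite /F /= subrr mulr0 sub0r nmN nm0 expr0n /= mulr0 !mul0r.
  by rewrite nm_le0 => /eqP.
exists r, f; split => //; [exact: le_trans rs1 _|exact: hol_limit cvg| |].
- split => //; apply: dvE; apply: (@cder_leM _ _ _ _ (A / x / (1 - q))) => e e0.
  exists (Num.min e r) => [|w]; first by rewrite lt_min e0.
  rewrite lt_min => /andP[we wr]; rewrite mul1r fb subr0 nmB.
  have := fP w wr 0%N; rewrite /F /= expr0 invr1 mul1r mulr1 => /le_trans; apply.
  have -> : A / x * nm (w - b) ^+ 2 / (1 - q) = A / x / (1 - q) * nm (w - b) * nm (w - b) by ring.
  apply: ler_wpM2r => //; apply: ler_wpM2l; last exact: ltW.
  exact: divr_ge0 Ax (ltW q1).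
- move=> z zr; have Gz := Gmu z zr.
  have Gz1 : nm (G z - b) <= nm (z - b) by apply: le_trans Gz _; rewrite ler_piMl // ltW.
  split => //; apply/eqP; rewrite -subr_eq0 -nm_le0; apply/ler_addgt0Pr => e e0; rewrite add0r.
  have [|N NP] := cvg (e / 2); first by rewrite divr_gt0.
  have Gr : nm (G z - b) < r by apply: le_lt_trans zr.
  have h1 := NP N _ (leqnn _) Gr; have h2 := NP N.+1 z (leqnSn _) zr.
  have E : F N (G z) = l * F N.+1 z.
    have : l ^+ N != 0 by rewrite expf_neq0.
    by rewrite /F -iterSr exprS; move: (l ^+ N) => y y0; field; rewrite ?y0 ?l00.
  rewrite (_ : _ - _ = - (F N (G z) - f (G z)) + l * (F N.+1 z - f z)); last by rewrite E; ring.
  apply: le_trans (nmD _ _) _; rewrite nmN nmM -/x.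
  have := ler_wpM2l (ltW l0) h2; nra.
Qed.

End Koenigs.

(** * Transition maps close to the identity, and extraction tools *)

Section Transitions.
Variable R : realType.
Local Notation C := R[i].
Implicit Types (f g h : C -> C) (P : C -> Prop) (p k n : nat) (z w l c u a b : C) (r t s e d M : R).

(* The transition maps [h] are [vn n ^-1 \o vn n.+1]: both factors pull [K] back
   to [P]. *)
Lemma transitions P (K : C -> Prop) (vn : nat -> C -> C) v a r : 0 < r ->
  (forall n, hol a r (vn n)) ->
  (forall e, 0 < e -> exists N, forall n z, (N <= n)%N -> nm (z - a) < r -> nm (vn n z - v z) <= e) ->
  dv v a != 0 ->
  (forall n w, nm (w - a) < r -> (P w <-> K (vn n w))) ->
  (forall n d, 0 < d -> exists w, nm (w - a) < d /\ vn n w <> vn n.+1 w) ->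
  exists s, [/\ 0 < s, s <= r & forall e, 0 < e -> exists h,
    [/\ hol a s h, forall w, nm (w - a) < s -> nm (h w - w) <= e,
        forall w, nm (w - a) < s -> (P w <-> P (h w)) &
        forall d, 0 < d -> exists w, nm (w - a) < d /\ h w <> w]].
Proof.
move=> r0 hvn cvg c0 PK diff; set c := dv v a in c0.
have nc : 0 < nm c by rewrite nm_gt0.
have hv := hol_limit hvn cvg.
have c4 : 0 < nm c / 4 by rewrite divr_gt0.
have [s [s0 sr lin]] := deriv_near r0 hv c4.
rewrite -/c in lin; pose Q := s / 2.
have Q0 : 0 < Q by rewrite divr_gt0.
(* The radius is independent of [e]. An expansion factor of at most [3/2 |c|] and the small
   displacement keep [vn n.+1 w] within [|c| Q / 4] of [vn n a], where the inverse of [vn n] is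
   defined. *)
exists (Q / 12); split; [lra|rewrite /Q; lra|move=> e e0].
have cs0 : 0 < nm c * s by rewrite mulr_gt0.
have ce0 : 0 < e * nm c by rewrite mulr_gt0.
(* The first bound makes the derivative of [vn m - v] at most [|c| / 4]; together with the [|c| / 4]
   for [v] this gives [near_linear]. The second bounds the displacement of the transition map by
   [e]. *)
pose eta := Num.min (nm c * s / 256) (e * nm c / 4).
have eta0 : 0 < eta by rewrite lt_min; apply/andP; split; apply: divr_gt0; rewrite ?ltr0n.
have eta1 : eta <= nm c * s / 256 by rewrite ge_min lexx.
have eta2 : eta <= e * nm c / 4 by rewrite ge_min lexx orbT.
have [n nP] := cvg eta eta0.
have close z w : nm (z - a) < s -> nm (vn n.+1 z - vn n z) <= 2 * eta.
  move=> zs; have zr := lt_le_trans zs sr.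
  apply: le_trans (nm_tri (v z) _ _) _; rewrite (nmB (v z)).
  by have := nP n z (leqnn _) zr; have := nP n.+1 z (leqnSn _) zr; lra.
have nl m : (n <= m)%N -> near_linear a Q c (vn m).
  move=> nm_ z w za wa.
  have hs : holo_on a s (fun z => vn m z - v z) (fun z => dv (vn m) z - dv v z).
    move=> y ys; have yr := lt_le_trans ys sr.
    by apply: cderB; [exact: (hol_dv (hvn m))|exact: (hol_dv hv)].
  have bd y : nm (y - a) < s -> nm (vn m y - v y) <= eta.
    by move=> ys; apply: nP => //; exact: lt_le_trans sr.
  have hQ : holo_on a Q (fun z => vn m z - v z) (fun z => dv (vn m) z - dv v z).
    by apply: (holo_on_sub hs); rewrite subrr nm0 /Q; lra.
  have := mvi_disc hQ (deriv_bound s0 hs bd) za wa.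
  have zs : nm (z - a) < s by move: za; rewrite /Q; lra.
  have ws : nm (w - a) < s by move: wa; rewrite /Q; lra.
  have := lin z w zs ws.
  have k1 : 64 * eta / s <= nm c / 4 by rewrite ler_pdivrMr //; lra.
  have := ler_wpM2r (nm_ge0 (w - z)) k1.
  rewrite (_ : vn m w - vn m z - c * (w - z) = (v w - v z - c * (w - z)) + ((vn m w - v w) - (vn m z - v z))); last by ring.
  by move=> h1 h2 h3; apply: le_trans (nmD _ _) _; lra.
have hQn m : hol a Q (vn m) by apply: (hol_le (hvn m)); rewrite /Q; lra.
have [k [hk kP _]] := local_inverse Q0 c0 (hQn n) (nl n (leqnn _)).
have aQ : nm (a - a) < Q by exact: nm_aa.
have inr w : nm (w - a) < Q / 12 -> nm (vn n.+1 w - vn n a) < nm c * Q / 4.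
  move=> wa; have wQ : nm (w - a) < Q by lra.
  have /andP[_ h1] := near_linear_expand (nl n.+1 (leqnSn _)) aQ wQ.
  apply: le_lt_trans (nm_tri (vn n.+1 a) _ _) _.
  have h2 := close a a (nm_aa a s0).
  have h3 : nm c * nm (w - a) <= nm c * (Q / 12) by apply: ler_wpM2l; rewrite ?nm_ge0 // ltW.
  by move: h3; rewrite /Q; lra.
have hw w : nm (w - a) < Q / 12 -> vn n (k (vn n.+1 w)) = vn n.+1 w /\ nm (k (vn n.+1 w) - a) < Q.
  move=> /inr wa; have [h1 h2] := kP _ wa; split => //; apply: le_lt_trans h2 _.
  rewrite mulrAC ltr_pdivrMr //; have : 0 < nm c * Q by rewrite mulr_gt0.
  lra.
exists (fun w => k (vn n.+1 w)); split.
- apply: hol_comp hk inr.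
  by apply: (hol_le (hQn n.+1)); lra.
- move=> w wa; have [h1 h2] := hw w wa.
  have wQ : nm (w - a) < Q by lra.
  have ws : nm (w - a) < s by move: wQ; rewrite /Q; lra.
  have /andP[h3 _] := near_linear_expand (nl n (leqnn _)) wQ h2.
  rewrite h1 in h3; have h4 := close w w ws.
  by rewrite -(ler_pM2l nc); lra.
- move=> w wa; have [h1 h2] := hw w wa.
  have wr : nm (w - a) < r by move: wa; rewrite /Q; lra.
  have hr : nm (k (vn n.+1 w) - a) < r by move: h2; rewrite /Q; lra.
  by rewrite (PK n.+1 w wr) (PK n _ hr) h1.
move=> d d0; have [|w [w1 w2]] := diff n (Num.min d (Q / 12)); first by rewrite lt_min d0; lra.
move: w1; rewrite lt_min => /andP[wd wa]; exists w; split => // E; apply: w2.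
by have [<- _] := hw w wa; rewrite E.
Qed.

(** The least [k] with [e * q ^+ k.+1 <= x]. It selects the rescaling that brings a translation part
    just below [e] without letting it become much smaller. *)
Lemma geometric_window (q x e : R) : 0 < q < 1 -> 0 < x < e ->
  exists k, q * e <= x / q ^+ k < e.
Proof.
move=> /andP[q0 q1] /andP[x0 xe].
have e0 : 0 < e by apply: lt_trans xe.
have q01 : 0 <= q < 1 by rewrite (ltW q0).
have [N NP] := expr_small q01 (divr_gt0 x0 e0).
have qk k : 0 < q ^+ k by rewrite exprn_gt0.
have ex : exists k, e * q ^+ k.+1 <= x.
  exists N; have := NP N.+1 (leqnSn _); rewrite ler_pdivlMr // mulrC.
  by [].
case: (ex_minnP ex) => k kP kmin; exists k; apply/andP; split.
  by rewrite ler_pdivlMr //; move: kP; rewrite exprS mulrA [e * q]mulrC.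
rewrite ltr_pdivrMr //; case: k kP kmin => [_ _|k _ kmin]; first by rewrite expr0 mulr1.
rewrite ltNge; apply/negP => h; have := kmin k h.
by rewrite ltnn.
Qed.

Lemma cluster_point (u : nat -> C) M : (forall n, nm (u n) <= M) ->
  exists l, forall e N, 0 < e -> exists2 n, (N <= n)%N & nm (u n - l) <= e.
Proof.
move=> uM.
have bnd (F : nat -> R) : (forall n, `|F n| <= M) -> bounded_fun F.
  by move=> FM; exists M; split => [|x Mx n _]; [exact: num_real|apply: le_trans (FM n) (ltW Mx)].
have [|f1 if1 c1] := @bolzano_weierstrass R (fun n => complex.Re (u n)).
  by apply: bnd => n; apply: le_trans (nm_Re _) (uM n).
have [|f2 if2 c2] := @bolzano_weierstrass R (fun n => complex.Im (u (f1 n))).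
  by apply: bnd => n; apply: le_trans (nm_Im _) (uM _).
move/cvg_ex: c1 => [x /cvgrPdist_le xP]; move/cvg_ex: c2 => [y /cvgrPdist_le yP].
exists (x +i* y)%C => e N e0.
have e2 : 0 < e / 2 by rewrite divr_gt0.
have [N1 _ N1P] := xP _ e2; have [N2 _ N2P] := yP _ e2.
have ge (f : nat -> nat) : increasing_seq f -> forall n, (n <= f n)%N.
  move=> fi; have fS m : (f m < f m.+1)%N.
    by rewrite ltnNge -[(_ <= _)%N]/(f m.+1 <= f m)%O (fi m.+1 m) -ltnNge.
  by elim=> [//|n IH]; apply: leq_ltn_trans IH (fS n).
pose m := maxn N (maxn N1 N2).
have Nm : (N <= m)%N by exact: leq_maxl.
have N1m : (N1 <= m)%N by rewrite /m maxnCA leq_maxl.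
have N2m : (N2 <= m)%N by rewrite /m [maxn N1 _]maxnC maxnCA leq_maxl.
exists (f1 (f2 m)).
  by apply: leq_trans (ge _ if1 _); apply: leq_trans (ge _ if2 _).
have := N2P m N2m; have := N1P (f2 m) (leq_trans N1m (ge _ if2 _)) => /= h1 h2.
apply: le_trans (nm_ReIm _) _; rewrite !raddfB /=.
by rewrite distrC in h1; rewrite distrC in h2; lra.
Qed.

End Transitions.

(** * Conjugation of symmetries by powers of the multiplier *)

Section Rescaling.
Variable R : realType.
Local Notation C := R[i].
Implicit Types (f g h : C -> C) (P : C -> Prop) (p k n q : nat) (z w l c u a b : C) (r s e d M : R).

Definition scaling_invariant P l r := forall w, nm w < r -> (P w <-> P (l * w)).

Definition near_identity_symmetry P r e h := [/\ hol 0 r h,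
  forall w, nm w < r -> nm (h w - w) <= e & forall w, nm w < r -> (P w <-> P (h w))].

(** One Euler step of complex size [t] for the field [z^p]. The error is relative to [|t|] because
    the number of steps will be inversely proportional to it. *)
Definition approximate_flow P p r e := exists f t, [/\ t != 0, nm t < e, hol 0 r f,
  forall z, nm z < r -> nm (f z - z - t * z ^+ p) <= e * nm t &
  forall z, nm z < r -> (P z <-> P (f z))].

Lemma scaling_iter P l r k w : nm l < 1 -> scaling_invariant P l r -> nm w < r ->
  (P w <-> P (l ^+ k * w)) /\ nm (l ^+ k * w) < r.
Proof.
move=> l1 Pl wr; elim: k => [|k [IH1 IH2]]; first by rewrite expr0 mul1r.
rewrite exprS -mulrA; split; first by rewrite IH1; exact: Pl.
rewrite nmM; apply: le_lt_trans IH2; rewrite ler_piMl ?nm_ge0 //; exact: ltW.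
Qed.

Definition rescale l k h z : C := (l ^+ k)^-1 * h (l ^+ k * z).

Lemma rescale_sym P l r e h k z : l != 0 -> nm l < 1 -> scaling_invariant P l r ->
  near_identity_symmetry P r e h -> nm z < r -> nm (rescale l k h z) < r ->
  (P z <-> P (rescale l k h z)).
Proof.
move=> l0 l1 Pl [_ _ Ph] zr fr.
have [h1 h2] := scaling_iter k l1 Pl zr; have [h3 _] := scaling_iter k l1 Pl fr.
rewrite h1 h3 Ph // /rescale mulrA divff ?mul1r //.
by rewrite expf_neq0.
Qed.

Lemma hol_rescale l r k h : nm l < 1 -> hol 0 r h -> hol 0 r (rescale l k h).
Proof.
move=> l1 hh; apply: holM; first exact: hol_cst.
apply: (hol_comp _ hh) => [|z]; first by apply: holM; [exact: hol_cst|exact: hol_id].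
rewrite !subr0 nmM nmX; apply: le_lt_trans; rewrite ler_piMl ?nm_ge0 //.
by rewrite exprn_ile1 ?nm_ge0 // ltW.
Qed.

(** On the half disc the proviso [|f z| < r] is automatic, since [f] displaces points by at most
    [|t| (r^p + 1)], which is made at most [r / 2]. *)
Lemma approximate_flow_of_range P p r : 0 < r ->
  (forall e, 0 < e -> exists f t, [/\ t != 0, nm t < e, hol 0 r f,
    forall z, nm z < r / 2 -> nm (f z - z - t * z ^+ p) <= e * nm t &
    forall z, nm z < r -> nm (f z) < r -> (P z <-> P (f z))]) ->
  forall e, 0 < e -> approximate_flow P p (r / 2) e.
Proof.
move=> r0 H e e0.
have A0 : 0 <= r ^+ p by rewrite exprn_ge0 // ltW.
have A1 : 0 < r ^+ p + 1 by rewrite ltr_wpDl.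
pose e' := Num.min e (Num.min 1 (r / 2 / (r ^+ p + 1))).
have e'0 : 0 < e' by rewrite !lt_min e0 ltr01 !divr_gt0.
have e'e : e' <= e by rewrite ge_min lexx.
have e'1 : e' <= 1 by rewrite !ge_min lexx orbT.
have e'2 : e' * (r ^+ p + 1) <= r / 2.
  by rewrite -ler_pdivlMr // !ge_min lexx !orbT.
have [f [t [t0 te hf ft fP]]] := H e' e'0.
have nt : 0 < nm t by rewrite nm_gt0.
exists f, t; split => //.
- exact: lt_le_trans te e'e.
- by apply: (hol_le hf); lra.
- move=> z zr; apply: le_trans (ft z zr) _; apply: ler_wpM2r => //; exact: ltW.
move=> z zr; apply: fP; first lra.
have -> : f z = (f z - z - t * z ^+ p) + t * z ^+ p + z by ring.
apply: le_lt_trans (nmD _ _) _; apply: le_lt_trans (lerD (nmD _ _) (lexx _)) _.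
rewrite nmM nmX; have h1 := ft z zr.
have h2 : nm z ^+ p <= r ^+ p by apply: lerXn2r; rewrite ?nnegrE ?nm_ge0 //; lra.
have h3 := ler_wpM2l (ltW nt) h2.
have h4 : nm t * (r ^+ p + 1) <= r / 2.
  by apply: le_trans e'2; apply: ler_wpM2r; apply: ltW.
have h5 : e' * nm t <= nm t by rewrite ler_piMl // ltW.
lra.
Qed.

(** Conjugation turns [z^(q+1) g(z)] into [(l^k)^q z^(q+1) g(l^k z)], and [g(l^k z)] tends to [g 0]
    uniformly on the disc. *)
Lemma rescale_order l r h g q d : 0 < r -> l != 0 -> nm l < 1 ->
  0 < d -> hol 0 d g -> g 0 != 0 ->
  (forall z, h z - z = z ^+ q.+1 * g z) ->
  forall e', 0 < e' -> exists N, forall k, (N <= k)%N -> forall z, nm z < r ->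
    nm (rescale l k h z - z - (l ^+ k) ^+ q * g 0 * z ^+ q.+1) <=
      e' * nm ((l ^+ k) ^+ q * g 0).
Proof.
move=> r0 l0 l1 d0 hg g0 hE e' e'0.
have A0 : 0 <= r ^+ q.+1 by rewrite exprn_ge0 // ltW.
have A1 : 0 < r ^+ q.+1 + 1 by rewrite ltr_wpDl.
have [m gm] := hg 0 (nm_aa 0 d0).
have ng : 0 < nm (g 0) by rewrite nm_gt0.
have [|dl dl0 dlP] := cder_cont gm (_ : 0 < e' * nm (g 0) / (r ^+ q.+1 + 1)).
  by rewrite divr_gt0 // mulr_gt0.
have [||N NP] := @expr_small _ (nm l) (dl / 2 / r).
- by rewrite nm_ge0.
- by rewrite !divr_gt0.
exists N => k /NP; rewrite ler_pdivlMr // => kP z zr.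
have lk0 : l ^+ k != 0 by rewrite expf_neq0.
have -> : rescale l k h z - z - (l ^+ k) ^+ q * g 0 * z ^+ q.+1 =
   (l ^+ k) ^+ q * z ^+ q.+1 * (g (l ^+ k * z) - g 0).
  have := hE (l ^+ k * z); rewrite /rescale => /(canRL (subrK _)) ->.
  rewrite exprMn exprS; move: (l ^+ k) lk0 => y y0.
  by set Y := y ^+ q; set Z := z ^+ q.+1; field.
have lz : nm (l ^+ k * z - 0) < dl.
  rewrite subr0 nmM nmX; apply: (@le_lt_trans _ _ (nm l ^+ k * r)); last by lra.
  by apply: ler_wpM2l; [rewrite exprn_ge0 ?nm_ge0|exact: ltW].
have := ltW (dlP _ lz); rewrite ler_pdivlMr // => h1.
rewrite !nmM (nmX z) -mulrA [X in _ <= X]mulrCA.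
apply: ler_wpM2l; first by rewrite nm_ge0.
apply: le_trans h1; rewrite mulrC; apply: ler_wpM2l; first exact: nm_ge0.
apply: (@le_trans _ _ (r ^+ q.+1)); last by rewrite lerDl.
by apply: lerXn2r; rewrite ?nnegrE ?nm_ge0 ?(ltW r0) // ltW.
Qed.

(* Conjugating [h] by a high power of the scaling [l] isolates the first nonzero
   Taylor coefficient of [h - id].  The order is [p = 0] if one can take
   [h 0 != 0] with [h] arbitrarily close to the identity; if the fixed map [h]
   has order at least [2], powers of [l] alone make it tend to the identity;
   otherwise the order is [1] and the coefficient [h'(0) - 1] is itself small. *)
Lemma approximate_flows P l r : 0 < r -> 0 < nm l < 1 -> scaling_invariant P l r ->
  (forall e, 0 < e -> exists h, near_identity_symmetry P r e h /\
     (forall d, 0 < d -> exists w, nm w < d /\ h w <> w)) ->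
  exists p, forall e, 0 < e -> approximate_flow P p (r / 2) e.
Proof.
move=> r0 /andP[nl l1] Pl Hh; have l0 : l != 0 by rewrite -nm_gt0.
have idE h e : near_identity_symmetry P r e h -> hol 0 r (fun z => h z - z).
  by move=> [hh _ _]; apply: holB => //; exact: hol_id.
have dE h e : 0 < e -> near_identity_symmetry P r e h -> forall z, nm z < r / 2 ->
    nm (dv (fun z => h z - z) z) <= 64 * e / r.
  move=> e0 hP z zr; apply: (deriv_bound r0 (hol_dv (idE _ _ hP))); last by rewrite subr0.
  by move=> w; rewrite subr0; case: hP => _ + _; apply.
have [A|] := pselect (forall e, 0 < e -> exists h, near_identity_symmetry P r e h /\ h 0 != 0).
  exists 0%N; apply: approximate_flow_of_range => // e e0.
  (* On the half disc [h - id] has derivative at most [64 eta / r], so after conjugation it varies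
     by at most [32 eta <= q e^2]. This is at most [e |t|] once [|t| >= q e]. *)
  pose q := nm l; pose eta := Num.min (e / 2) (q * e * e / 32).
  have q0 : 0 < q by [].
  have qe : 0 < q * e by rewrite mulr_gt0.
  have eta0 : 0 < eta by rewrite lt_min !divr_gt0 // mulr_gt0.
  have eta1 : eta <= e / 2 by rewrite ge_min lexx.
  have eta2 : eta <= q * e * e / 32 by rewrite ge_min lexx orbT.
  have [h [hP h0]] := A eta eta0; have [hh hclose hsym] := hP.
  have h0e : nm (h 0) <= eta by have := hclose 0; rewrite subr0 nm0 => /(_ r0).
  have [k /andP[k1 k2]] : exists k, q * e <= nm (h 0) / q ^+ k < e.
    by apply: geometric_window; [rewrite q0|rewrite nm_gt0 h0; lra].
  have lk0 : l ^+ k != 0 by rewrite expf_neq0.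
  pose t := (l ^+ k)^-1 * h 0.
  have tE : nm t = nm (h 0) / q ^+ k by rewrite /t nmM nmV nmX mulrC.
  exists (rescale l k h), t; rewrite tE; split => //.
  - by rewrite mulf_neq0 // invr_neq0.
  - exact: hol_rescale.
  - move=> z zr; rewrite expr0 mulr1.
    have -> : rescale l k h z - z - t = (l ^+ k)^-1 * ((h (l ^+ k * z) - l ^+ k * z) - (h 0 - 0)).
      by rewrite /rescale /t; move: (l ^+ k) lk0 => y y0; field.
    have hd := holo_on_sub (hol_dv (idE _ _ hP)) (_ : nm (0 - 0) + r / 2 <= r).
    have qk : q ^+ k <= 1 by rewrite exprn_ile1 ?(ltW q0) // ltW.
    have qk0 : 0 < q ^+ k by rewrite exprn_gt0.
    have := mvi_disc (hd _) _ (M := 64 * eta / r) (z := 0) (w := l ^+ k * z).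
    rewrite !subr0 nm0 => H; rewrite nmM nmV nmX.
    rewrite ler_pdivrMl // ; apply: le_trans (H _ _ _ _) _.
    + lra.
    + by move=> w; rewrite subr0; exact: dE.
    + lra.
    + by rewrite nmM nmX; apply: le_lt_trans zr; rewrite ler_piMl ?nm_ge0.
    rewrite nmM nmX mulrCA; apply: ler_wpM2l; first exact: ltW.
    apply: (@le_trans _ _ (64 * eta / r * (r / 2))).
      by apply: ler_wpM2l; [rewrite divr_ge0 ?(ltW r0) // mulr_ge0 // ltW|exact: ltW].
    rewrite (_ : 64 * eta / r * (r / 2) = 32 * eta); last by field; exact: lt0r_neq0.
    apply: (@le_trans _ _ (q * e * e)); first lra.
    by rewrite [X in _ <= X]mulrC; apply: ler_wpM2r => //; exact: ltW.
  - by move=> z zr fr; apply: (rescale_sym l0 l1 Pl hP).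
(* From here on, every symmetry within [e0] of the identity fixes [0], so [h - id] has order at
   least [1]. *)
move=> /existsNP[e0 /not_implyP[e00 notA]].
have h0 h : near_identity_symmetry P r e0 h -> h 0 = 0.
  by move=> hP; apply/eqP/negPn/negP => hn; apply: notA; exists h.
have [[h [q [g [d [hP d0 hg g0 hE]]]]]|notB] := pselect (exists h q g d,
    [/\ near_identity_symmetry P r e0 h, 0 < d, hol 0 d g, g 0 != 0 &
        forall z, h z - z = z ^+ q.+2 * g z]).
  exists q.+2; apply: approximate_flow_of_range => // e e_0.
  have [N1 N1P] := rescale_order r0 l0 l1 d0 hg g0 hE e_0.
  have ng : 0 < nm (g 0) by rewrite nm_gt0.
  have [||N2 N2P] := @expr_small _ (nm l) (e / 2 / nm (g 0)).
  - by rewrite nm_ge0.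
  - by rewrite !divr_gt0.
  pose k := maxn N1 N2.
  have lk0 : l ^+ k != 0 by rewrite expf_neq0.
  exists (rescale l k h), ((l ^+ k) ^+ q.+1 * g 0); split.
  - by rewrite mulf_neq0 // expf_neq0.
  - have := N2P k (leq_maxr _ _); rewrite ler_pdivlMr // nmM nmX nmX => h1.
    apply: (@le_lt_trans _ _ (e / 2)); last lra.
    apply: le_trans h1; apply: ler_wpM2r; first exact: nm_ge0.
    rewrite exprS ler_piMr ?exprn_ge0 ?nm_ge0 // -exprM.
    by rewrite exprn_ile1 ?nm_ge0 // ltW.
  - by case: hP => hh _ _; exact: hol_rescale.
  - by move=> z zr; apply: N1P; [exact: leq_maxl|lra].
  - by move=> z zr fr; apply: (rescale_sym l0 l1 Pl hP).
exists 1%N; apply: approximate_flow_of_range => // e e_0.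
(* The bound [e0] brings [h] under the two preceding exclusions, so its order is exactly [1].
   Rescaling leaves the coefficient [h'(0) - 1] unchanged; the Cauchy estimate with [e r / 128]
   makes it at most [e / 2]. *)
pose eta := Num.min e0 (e * r / 128).
have eta0 : 0 < eta by rewrite lt_min e00 divr_gt0 // mulr_gt0.
have eta1 : eta <= e0 by rewrite ge_min lexx.
have eta2 : eta <= e * r / 128 by rewrite ge_min lexx orbT.
have [h [hP hid]] := Hh eta eta0.
have hP0 : near_identity_symmetry P r e0 h.
  by case: hP => ? h1 ?; split => // w wr; apply: le_trans (h1 w wr) eta1.
have [[d d0 dP]|[q [g [d [d0 dr hg g0 gE]]]]] := hol_order r0 (idE _ _ hP).
  have [w [wd []]] := hid d d0.
  by apply/eqP; rewrite -subr_eq0 dP // subr0.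
have {}gE z : h z - z = z ^+ q * g z by rewrite gE subr0.
case: q gE => [|[|q]] gE; last by case: notB; exists h, q, g, d.
  by move: g0; have := gE 0; rewrite expr0 mul1r subr0 h0 // => <-; rewrite eqxx.
have [N1 N1P] := rescale_order r0 l0 l1 d0 hg g0 gE e_0.
exists (rescale l N1 h), (g 0); split => //.
- have : nm (g 0) <= 64 * eta / r.
    have <- : dv (fun z => h z - z) 0 = g 0.
      have [m gm] := hg 0 (nm_aa 0 d0); apply: dvE.
      have := cderM (cder_id 0) gm; rewrite mul0r addr0 mul1r.
      by apply: cder_ext => w; rewrite gE expr1.
    by apply: (dE _ _ eta0 hP); rewrite nm0 divr_gt0.
  rewrite ler_pdivlMr // => h1.
  have : nm (g 0) * r <= e / 2 * r by lra.
  by rewrite ler_pM2r // => h2; lra.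
- by case: hP => hh _ _; exact: hol_rescale.
- move=> z zr; have := N1P N1 (leqnn _) z; rewrite expr0 mul1r; apply; lra.
- by move=> z zr fr; apply: (rescale_sym l0 l1 Pl hP).
Qed.

(** Write the complex step as its modulus times a unit direction. A cluster point [u] of the
    directions replaces them at a relative cost [|s n - u| r^p], and the steps become real and
    positive. *)
Lemma approximate_flow_direction P p r : 0 < r -> (forall e, 0 < e -> approximate_flow P p r e) ->
  exists2 u, nm u = 1 & forall e, 0 < e -> exists f (t : R), [/\ 0 < t < e, hol 0 r f,
    forall z, nm z < r -> nm (f z - z - t%:C * u * z ^+ p) <= e * t &
    forall z, nm z < r -> (P z <-> P (f z))].
Proof.
move=> r0 H; have inv0 n : 0 < (2^-1 : R) ^+ n by rewrite exprn_gt0 // invr_gt0.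
have H' n : exists t, exists f, [/\ t != 0, nm t < 2^-1 ^+ n, hol 0 r f,
  forall z, nm z < r -> nm (f z - z - t * z ^+ p) <= 2^-1 ^+ n * nm t &
  forall z, nm z < r -> (P z <-> P (f z))].
  by have [f [t ft]] := H _ (inv0 n); exists t, f.
have [t tP] := boolp.choice H'.
have t0 n : t n != 0 by have [f []] := tP n.
have nt n : 0 < nm (t n) by rewrite nm_gt0.
pose s n := t n / (nm (t n))%:C.
have ntC n : nm (nm (t n))%:C = nm (t n) by rewrite nm_real ger0_norm // ltW.
have s1 n : nm (s n) = 1 by rewrite /s nmM nmV ntC divff // gt_eqF.
have [|u uP] := @cluster_point _ s 1; first by move=> n; rewrite s1.
exists u.
  apply/eqP; rewrite eq_le; apply/andP; split; apply/ler_addgt0Pr => e e0.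
    have [n _ h] := uP e 0%N e0; have := nmBl u (s n); rewrite (nmB u) s1; lra.
  by have [n _ h] := uP e 0%N e0; have := nmBl (s n) u; rewrite s1; lra.
move=> e e0; have A0 : 0 <= r ^+ p by rewrite exprn_ge0 // ltW.
have A1 : 0 < r ^+ p + 1 by rewrite ltr_wpDl.
have half01 : 0 <= (2^-1 : R) < 1 by apply/andP; split; lra.
have [|N NP] := @expr_small _ 2^-1 (e / 2) half01; first by rewrite divr_gt0.
have [|n Nn su] := uP (e / 2 / (r ^+ p + 1)) N; first by rewrite !divr_gt0.
have [f [_ tn hf ft fP]] := tP n; have en := NP n Nn.
exists f, (nm (t n)); split => //; first by rewrite nt; lra.
move=> z zr; have tE : t n = (nm (t n))%:C * s n.
  by rewrite /s mulrCA divff ?mulr1 // -nm_gt0 ntC.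
rewrite (_ : _ - _ = (f z - z - t n * z ^+ p) + (nm (t n))%:C * (s n - u) * z ^+ p); last first.
  by rewrite {2}tE; ring.
apply: le_trans (nmD _ _) _; rewrite !nmM ntC nmX.
rewrite ler_pdivlMr // in su.
have h2 : nm z ^+ p <= r ^+ p by apply: lerXn2r; rewrite ?nnegrE ?nm_ge0 ?(ltW r0) // ltW.
have h3 : nm (s n - u) * nm z ^+ p <= e / 2.
  apply: le_trans su; apply: ler_wpM2l; first exact: nm_ge0.
  by apply: le_trans h2 _; rewrite lerDl.
have h4 := ler_wpM2l (ltW (nt n)) h3; have h5 := ft z zr.
have h6 := ler_wpM2r (ltW (nt n)) en.
by rewrite -mulrA; lra.
Qed.

End Rescaling.

(** * Rectification of the flow *)

Section FlowBox.
Variable R : realType.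
Local Notation C := R[i].
Implicit Types (f g h F : C -> C) (P Q : C -> Prop) (p k n q : nat) (z w y l c u v a b : C) (r s t e d M : R).

(** The integral from the centre is a primitive: Goursat's theorem on the triangle [a], [z], [w]
    identifies its increment with the integral from [z] to [w]. *)
Lemma primitive_disc f a r : 0 < r -> hol a r f ->
  exists F, F a = 0 /\ forall z, nm (z - a) < r / 2 -> cder F z (f z).
Proof.
move=> r0 hf; pose S z := nm (z - a) <= r / 2.
have cS : segment_convex S by exact: convex_disc.
have clS : limit_closed S by exact: closed_disc.
have Sf z : S z -> exists l, cder f z l by rewrite /S => h; apply: hf; lra.
have Sa : S a by rewrite /S subrr nm0; lra.
have gr := goursat cS clS Sf.
have hi z w : S z -> S w -> has_int f z w (segment_integral f z w).
  by move=> Sz Sw; apply: segment_integralP => t t01; apply: Sf; exact: cS.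
exists (segment_integral f a); split => [|z za e e0].
  apply: segment_integralE; exists (fun=> 0); last by rewrite subrr.
  move=> t _ e e0; exists 1 => // s _.
  by rewrite !(subrr, mulr0, subr0) nm0 mulr_ge0 // ltW.
have Sz : S z by rewrite /S ltW.
have [l fl] := Sf z Sz; have [d d0 dP] := cder_cont fl e0.
exists (Num.min d (r / 2 - nm (z - a))) => [|w].
  by rewrite lt_min d0 subr_gt0.
rewrite lt_min => /andP[wd wr].
have Sw : S w by rewrite /S; apply: le_trans (nm_tri z _ _) _; lra.
have E : segment_integral f a w - segment_integral f a z = segment_integral f z w.
  have rev : segment_integral f w a = - segment_integral f a w.
    by apply: segment_integralE; apply: has_int_rev; exact: hi.
  by have := gr a z w Sa Sz Sw; rewrite rev => h; apply/esym/(eq_of_sum0 h (erefl 0)); ring.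
rewrite E; have hc : has_int (fun=> f z) z w (f z * w - f z * z).
  by apply: (@has_int_deriv _ (fun v => f z * v)) => t _; exact: cder_linear.
have := has_intD (hi z w Sz Sw) (has_intZ (-1) hc).
rewrite !mulN1r -mulrBr => h; apply: has_int_le h _ => t t01.
apply/ltW/dP; apply: le_lt_trans wd.
exact: nm_seg_tri.
Qed.

(* Euler's method: about [t / x] iterations of a map close to the translation by
   [x v] give a point close to [y + t v]. *)
Lemma iterate_flow Q v r s : nm v = 1 -> s < r ->
  (forall e, 0 < e -> exists F t, [/\ 0 < t < e,
    forall y, nm y < r -> nm (F y - y - t%:C * v) <= e * t &
    forall y, nm y < r -> Q y -> Q (F y)]) ->
  (forall y, nm y < r -> (forall e, 0 < e -> exists2 w, nm (w - y) <= e & Q w) -> Q y) ->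
  forall y t, 0 <= t -> nm y < s -> nm (y + t%:C * v) < s -> Q y -> Q (y + t%:C * v).
Proof.
move=> v1 sr H cl y t t0 ys yts Qy; apply: cl => [|d d0]; first exact: lt_trans sr.
have t1 : 0 < t + 1 by rewrite ltr_wpDl.
(* The accumulated drift is at most [e t]: below [r - s], so the orbit stays in the domain of [F],
   and at most [d / 2]. The last incomplete step costs less than [e <= d / 2]. *)
pose e := Num.min (d / 2) (Num.min (d / 2) (r - s) / (t + 1)).
have m0 : 0 < Num.min (d / 2) (r - s) by rewrite lt_min divr_gt0 // subr_gt0.
have e0 : 0 < e by rewrite lt_min; apply/andP; split; exact: divr_gt0.
have ed : e <= d / 2 by rewrite ge_min lexx.
have et : e * (t + 1) <= Num.min (d / 2) (r - s).
  by rewrite -ler_pdivlMr // ge_min lexx orbT.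
have et1 : e * t <= d / 2.
  by have : Num.min (d / 2) (r - s) <= d / 2 by [rewrite ge_min lexx]; lra.
have et2 : e * t < r - s.
  by have : Num.min (d / 2) (r - s) <= r - s by [rewrite ge_min lexx orbT]; lra.
have [F [x [/andP[x0 xe] Fx FQ]]] := H e e0.
pose N := Num.truncn (t / x).
have tx0 : 0 <= t / x by rewrite divr_ge0 // ltW.
have /andP[N1 N2] := truncn_itv tx0; rewrite -/N in N1 N2.
rewrite ler_pdivlMr // in N1; rewrite ltr_pdivrMr // -natr1 in N2.
have it j : (j <= N)%N -> nm (iter j F y - (y + (j%:R * x)%:C * v)) <= j%:R * (e * x) /\ Q (iter j F y).
  elim: j => [|j IH] jN.
    by rewrite [iter 0 F y]/= !mul0r addr0 subrr nm0.
  have [IH1 IH2] := IH (ltnW jN).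
  have jx : j%:R * x <= t.
    by apply: le_trans N1; apply: ler_wpM2r; [exact: ltW|rewrite ler_nat ltnW].
  have jx0 : 0 <= j%:R * x by rewrite mulr_ge0 // ltW.
  have lin : nm (y + (j%:R * x)%:C * v) < s.
    have [tz|tz] := eqVneq t 0.
      have -> : j%:R * x = 0 by apply/eqP; rewrite eq_le jx0 -tz jx.
      by rewrite rmorph0 mul0r addr0.
    have tp : 0 < t by rewrite lt_def tz.
    have -> : y + (j%:R * x)%:C * v = seg y (y + t%:C * v) (j%:R * x / t).
      rewrite /seg addrAC subrr add0r mulrA -rmorphM /=.
      by rewrite mulfVK.
    rewrite -[X in nm X]subr0; apply: seg_disc; rewrite ?subr0 //.
    by rewrite divr_ge0 //= ler_pdivrMr // mul1r.
  have inr : nm (iter j F y) < r.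
    rewrite -(subrK (y + (j%:R * x)%:C * v) (iter j F y)).
    apply: le_lt_trans (nmD _ _) _.
    have : j%:R * (e * x) <= e * t by rewrite mulrCA; apply: ler_wpM2l => //; exact: ltW.
    lra.
  split; last exact: FQ.
  rewrite iterS (_ : _ - _ = (F (iter j F y) - iter j F y - x%:C * v) + (iter j F y - (y + (j%:R * x)%:C * v))); last first.
    by rewrite -natr1 !(rmorphM, rmorphD, rmorph1) /=; ring.
  apply: le_trans (nmD _ _) _; rewrite -natr1; have := Fx _ inr; lra.
have [h1 h2] := it N (leqnn _); exists (iter N F y) => //.
rewrite (_ : _ - _ = (iter N F y - (y + (N%:R * x)%:C * v)) - (t - N%:R * x)%:C * v); last first.
  by rewrite rmorphB /=; ring.
apply: le_trans (nmD _ _) _; rewrite nmN nmM v1 mulr1 nm_real ger0_norm; last lra.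
have : N%:R * (e * x) <= e * t by rewrite mulrCA; apply: ler_wpM2l => //; exact: ltW.
lra.
Qed.

(** A map this close to a translation is [near_linear] with slope [1]; its local inverse moves
    points by about [-t] and preserves [Q] because the invariance is an equivalence. *)
Lemma reverse_flow Q r :  0 < r ->
  (forall e, 0 < e -> exists F t, [/\ 0 < t < e, hol 0 r F,
    forall y, nm y < r -> nm (F y - y - t%:C) <= e * t &
    forall y, nm y < r -> (Q y <-> Q (F y))]) ->
  forall e, 0 < e -> exists F t, [/\ 0 < t < e,
    forall y, nm y < r / 16 -> nm (F y - y - t%:C * -1) <= e * t &
    forall y, nm y < r / 16 -> Q y -> Q (F y)].
Proof.
move=> r0 H e e0.
(* The bound [r / 128] gives the slope error [64 e' t / r <= 1/2] and also [|F 0| <= r / 32]. The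
   inverse is then defined within [r / 8] of [F 0], which covers the disc of radius [r / 16]. *)
pose e' := Num.min e (Num.min 1 (r / 128)).
have e'0 : 0 < e' by rewrite !lt_min e0 ltr01 divr_gt0 // ltr0n.
have e'e : e' <= e by rewrite ge_min lexx.
have e'1 : e' <= 1 by rewrite !ge_min lexx orbT.
have e'2 : e' <= r / 128 by rewrite !ge_min lexx !orbT.
have [F [t [/andP[t0 te] hF Ft FQ]]] := H e' e'0.
have r20 : 0 < r / 2 by lra.
have c0 : (1 : C) != 0 by exact: oner_neq0.
have et1 : e' * t <= t by rewrite ler_piMl // ltW.
have lin z : cder (fun y => y + t%:C) z (1 + 0) by apply: cderD; [exact: cder_id|exact: cder_cst].
have hE : holo_on 0 r (fun y => F y - (y + t%:C)) (fun y => dv F y - (1 + 0)).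
  by move=> z zr; apply: cderB; [exact: (hol_dv hF)|exact: lin].
have bE z : nm (z - 0) < r -> nm (F z - (z + t%:C)) <= e' * t.
  by rewrite subr0 opprD addrA; exact: Ft.
have dE := deriv_bound r0 hE bE.
have nl : near_linear 0 (r / 2) 1 F.
  move=> z w zr wr.
  have hE2 := holo_on_sub hE (_ : nm (0 - 0) + r / 2 <= r).
  have := mvi_disc (hE2 _) dE zr wr.
  rewrite nm1 mul1r (_ : _ - _ - (_ - _) = F w - F z - (w - z)); last by ring.
  rewrite subrr nm0 add0r => h; apply: le_trans (h _) _; first lra.
  apply: ler_wpM2r; first exact: nm_ge0.
  by rewrite ler_pdivrMr //; lra.
have hF2 : hol 0 (r / 2) F by apply: (hol_le hF); lra.
have [k [_ kP _]] := local_inverse r20 c0 hF2 nl.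
have F0 : nm (F 0) <= r / 32.
  have := Ft 0; rewrite nm0 subr0 => /(_ r0) h.
  rewrite -(subrK t%:C (F 0)); apply: le_trans (nmD _ _) _.
  by rewrite nm_real gtr0_norm //; lra.
have kin y : nm y < r / 16 -> F (k y) = y /\ nm (k y) < r.
  move=> yr; have yF : nm (y - F 0) < nm (1 : C) * (r / 2) / 4.
    by apply: le_lt_trans (nmD _ _) _; rewrite nmN nm1; lra.
  have [h1 h2] := kP _ yF; split => //.
  by rewrite subr0 nm1 in h2 *; rewrite nm1 in yF; lra.
exists k, t; split.
- by rewrite t0; lra.
- move=> y /kin[h1 h2]; have := Ft _ h2; rewrite h1.
  rewrite (_ : k y - y - t%:C * -1 = - (y - k y - t%:C)); last by ring.
  by rewrite nmN => h; apply: le_trans h _; apply: ler_wpM2r => //; exact: ltW.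
- by move=> y /kin[h1 h2]; rewrite (FQ _ h2) h1.
Qed.

(** In the chart [g], whose derivative is the inverse of the field, a step [t u z^p] becomes the
    translation by [t]. The hypotheses on [A] and [M1] make the errors uniform over the chart. *)
Lemma conjugated_flow P u p r z0 s d0 A M1 g h : 0 < r -> nm u = 1 ->
  (forall e, 0 < e -> exists f t, [/\ 0 < t < e, hol 0 r f,
    forall z, nm z < r -> nm (f z - z - t%:C * u * z ^+ p) <= e * t &
    forall z, nm z < r -> (P z <-> P (f z))]) ->
  0 < s -> nm z0 + s <= r -> 0 < d0 -> hol z0 s g ->
  (forall z w, nm (z - z0) < s -> nm (w - z0) < s -> g z = g w -> z = w) ->
  hol 0 d0 h -> (forall y, nm y < d0 -> g (h y) = y /\ nm (h y - z0) < s) ->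
  (forall y, nm y < d0 / 2 -> nm (h y - z0) < s / 2) ->
  0 <= A -> (forall z w, nm (z - z0) < s -> nm (w - z0) < s ->
     nm (g w - g z - (u * z ^+ p)^-1 * (w - z)) <= A * nm (w - z) ^+ 2) ->
  0 <= M1 -> (forall z, nm (z - z0) < s -> z != 0 /\ nm (u * z ^+ p)^-1 <= M1) ->
  forall e, 0 < e -> exists F t, [/\ 0 < t < e, hol 0 (d0 / 2) F,
    forall y, nm y < d0 / 2 -> nm (F y - y - t%:C) <= e * t &
    forall y, nm y < d0 / 2 -> (P (h y) <-> P (h (F y)))].
Proof.
move=> r0 u1 H s0 z0s d0p hg inj hh hs hs2 A0 quad M10 bound e e0.
have u0 : u != 0 by rewrite -nm_gt0 u1.
have A1 : 0 <= r ^+ p by rewrite exprn_ge0 // ltW.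
have rp1 : 0 < r ^+ p + 1 by rewrite ltr_wpDl.
(* [B] collects the two errors: [A] times the square of a step, of size at most [t (r^p + 1)], and
   [M1] times the error of [f]. *)
have [B BE] : exists B, B = A * (r ^+ p + 1) ^+ 2 + M1 by eexists.
have B0 : 0 <= B by rewrite BE addr_ge0 // mulr_ge0 // sqr_ge0.
have B1 : 0 < B + 1 by rewrite ltr_wpDl.
have [e1 [e10 e1e e11]] : exists e1 : R, [/\ 0 < e1, e1 <= e & e1 <= 1].
  by exists (Num.min e 1); rewrite lt_min e0 ltr01 !ge_min !lexx orbT.
have [e' [e'0 e'e1 e'B e'd e's]] : exists e' : R, [/\ 0 < e', e' <= e1, e' * (B + 1) <= e1,
    e' <= d0 / 8 & e' * (r ^+ p + 1) <= s / 8].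
  exists (Num.min e1 (Num.min (e1 / (B + 1)) (Num.min (d0 / 8) (s / 8 / (r ^+ p + 1))))).
  by rewrite !lt_min e10 !divr_gt0 // -!ler_pdivlMr // !ge_min !lexx !orbT.
have e'1 : e' <= e by exact: le_trans e1e.
have e'3 : e' * (B + 1) <= e by exact: le_trans e1e.
have e'2 : e' <= 1 by exact: le_trans e11.
have e'7 : e' * (B + 1) <= 1 by exact: le_trans e11.
have [f [t [/andP[t0 te] hf ft fP]]] := H e' e'0.
clear H e1 e10 e1e e11 e'e1 e'B.
have et : e' * t <= t by rewrite ler_piMl // ltW.
have move1 z : nm z < r -> nm (f z - z) <= t * (r ^+ p + 1).
  move=> zr; rewrite -(subrK (t%:C * u * z ^+ p) (f z - z)); apply: le_trans (nmD _ _) _.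
  rewrite !nmM nmX u1 mulr1 nm_real gtr0_norm // mulrDr mulr1 addrC; apply: lerD.
    apply: ler_wpM2l; first exact: ltW.
    by apply: lerXn2r; rewrite ?nnegrE ?nm_ge0 ?(ltW r0) // ltW.
  exact: le_trans (ft z zr) et.
have tr : t * (r ^+ p + 1) <= s / 8.
  by apply: le_trans e's; apply: ler_wpM2r; apply: ltW.
have ts : nm z0 + s / 2 <= r by clear - z0s s0; lra.
have inr z : nm (z - z0) < s / 2 -> nm z < r.
  move=> zs; rewrite -(subrK z0 z); apply: le_lt_trans (nmD _ _) _; clear - ts zs; lra.
have fin z : nm (z - z0) < s / 2 -> nm (f z - z0) < s.
  move=> zs; apply: le_lt_trans (nm_tri z _ _) _.
  have := move1 _ (inr z zs); clear - zs tr s0; lra.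
have hd y : nm y < d0 / 2 -> nm y < d0 by clear - d0p; lra.
have est y : nm y < d0 / 2 -> nm (g (f (h y)) - y - t%:C) <= B * e' * t.
  move=> yr; have h1 := hs2 y yr; have h2 := inr _ h1; have h3 := fin _ h1.
  have [gh h4] := hs y (hd y yr); have [hy0 M1y] := bound _ h4.
  have := quad _ _ h4 h3; rewrite gh.
  have := M1y; set Z := u * h y ^+ p => Zb.
  have Z0 : Z != 0 by rewrite mulf_neq0 // expf_neq0.
  set er := f (h y) - h y - t%:C * u * h y ^+ p.
  have -> : g (f (h y)) - y - Z^-1 * (f (h y) - h y) = (g (f (h y)) - y - t%:C) - Z^-1 * er.
    by rewrite /er -mulrA -/Z; field.
  set X := g (f (h y)) - y - t%:C => q1.
  have q2 : nm (Z^-1 * er) <= M1 * (e' * t).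
    by rewrite nmM; apply: ler_pM; rewrite ?nm_ge0 //; exact: ft.
  have q3 : A * nm (f (h y) - h y) ^+ 2 <= A * ((r ^+ p + 1) ^+ 2 * (e' * t)).
    apply: ler_wpM2l => //; apply: (@le_trans _ _ ((t * (r ^+ p + 1)) ^+ 2)).
      by apply: lerXn2r; rewrite ?nnegrE ?nm_ge0 ?mulr_ge0 ?(ltW t0) ?(ltW rp1) //; exact: move1.
    rewrite exprMn mulrC; apply: ler_wpM2l; first exact: sqr_ge0.
    by rewrite expr2; apply: ler_wpM2r; apply: ltW.
  rewrite -(subrK (Z^-1 * er) X); apply: le_trans (nmD _ _) _.
  have -> : B * e' * t = A * ((r ^+ p + 1) ^+ 2 * (e' * t)) + M1 * (e' * t) by rewrite BE; ring.
  by apply: lerD => //; exact: le_trans q3.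
have Be : B * e' * t <= t.
  rewrite ler_piMl ?(ltW t0) //; clear - e'7 e'0; lra.
exists (fun y => g (f (h y))), t; split.
- by rewrite t0; exact: lt_le_trans e'1.
- have hh1 : hol 0 (d0 / 2) h by apply: (hol_le hh); clear - d0p; lra.
  have hfh : hol 0 (d0 / 2) (fun y => f (h y)).
    by apply: (hol_comp hh1 hf) => y; rewrite !subr0 => /hs2/inr.
  by apply: (hol_comp hfh hg) => y; rewrite subr0 => /hs2/fin.
- move=> y yr; apply: le_trans (est y yr) _; apply: ler_wpM2r; first exact: ltW.
  clear - e'3 e'0; lra.
move=> y yr; have h1 := hs2 y yr; have h2 := inr _ h1; have h3 := fin _ h1.
have gd : nm (g (f (h y))) < d0.
  have -> : g (f (h y)) = (g (f (h y)) - y - t%:C) + (y + t%:C) by ring.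
  apply: le_lt_trans (nmD _ _) _.
  have h4 := est y yr; have h5 := nmD y t%:C; rewrite nm_real gtr0_norm // in h5.
  clear - yr te e'd h4 h5 Be t0; lra.
have [h4 h5] := hs _ gd.
rewrite (fP _ h2); have -> // : h (g (f (h y))) = f (h y).
exact: inj h5 h3 h4.
Qed.

(* The chart [g] rectifies the vector field [u z ^ p]: it is a primitive of its
   inverse. *)
Lemma flow_box P u p r z0 : 0 < r -> nm u = 1 -> nm z0 < r -> z0 != 0 ->
  (forall e, 0 < e -> exists f t, [/\ 0 < t < e, hol 0 r f,
    forall z, nm z < r -> nm (f z - z - t%:C * u * z ^+ p) <= e * t &
    forall z, nm z < r -> (P z <-> P (f z))]) ->
  (forall z, nm z < r -> (forall e, 0 < e -> exists2 w, nm (w - z) <= e & P w) -> P z) ->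
  exists s d g h, [/\ 0 < s, nm z0 + s <= r & 0 < d] /\
   [/\ hol z0 s g, forall z w, nm (z - z0) < s -> nm (w - z0) < s -> g z = g w -> z = w,
     hol 0 d h,
     (h 0 = z0) /\ (forall y, nm y < d -> g (h y) = y /\ nm (h y - z0) < s) &
     forall y t, nm y < d -> nm (y + t%:C) < d -> P (h y) -> P (h (y + t%:C))].
Proof.
move=> r0 u1 z0r z00 H cl.
have nz0 : 0 < nm z0 by rewrite nm_gt0.
have u0 : u != 0 by rewrite -nm_gt0 u1.
(* The disc of radius [s0] stays in the domain and at distance at least [|z0| / 2] from the zero of
   the field. *)
pose s0 := Num.min (nm z0 / 2) (r - nm z0).
have s00 : 0 < s0 by rewrite lt_min divr_gt0 // subr_gt0.
have s0z : s0 <= nm z0 / 2 by rewrite ge_min lexx.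
have s0r : s0 <= r - nm z0 by rewrite ge_min lexx orbT.
have lb z : nm (z - z0) < s0 -> nm z0 / 2 <= nm z.
  by move=> zs; have := nmBl z0 z; rewrite (nmB z0); lra.
have n0 z : nm (z - z0) < s0 -> z != 0 by move=> /lb h; rewrite -nm_gt0; lra.
have hq : hol z0 s0 (fun z => (u * z ^+ p)^-1).
  move=> z zs; exists (- ((u * z ^+ p) ^+ 2)^-1 * (u * (p%:R * z ^+ p.-1))).
  apply: (@cder_comp _ (fun v => v^-1) (fun z => u * z ^+ p)); first exact/cderZ/cderX.
  by apply: cder_inv; rewrite mulf_neq0 // expf_neq0 // n0.
have [g [gz0 dg]] := primitive_disc s00 hq.
have s20 : 0 < s0 / 2 by lra.
have hg : hol z0 (s0 / 2) g by move=> z /dg; eexists; eassumption.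
set c := (u * z0 ^+ p)^-1.
have dgE z : nm (z - z0) < s0 / 2 -> dv g z = (u * z ^+ p)^-1 by move=> /dg/dvE.
have dgz0 : dv g z0 = c by apply: dgE; exact: nm_aa.
have c0 : c != 0 by rewrite invr_neq0 // mulf_neq0 // expf_neq0.
have nc : 0 < nm c by rewrite nm_gt0.
have [s1 [A [s10 s1s A0 quad]]] := hol_quad s20 hg.
have [|s [sp ss1 nl]] := near_linear_ex s10 (hol_le hg s1s); first by rewrite dgz0.
rewrite dgz0 in nl.
have ss0 : s <= s0 / 2 by apply: le_trans s1s.
have hgs : hol z0 s g by exact: hol_le hg ss0.
have [h [hh hP hlip]] := local_inverse sp c0 hgs nl.
rewrite gz0 in hh hP hlip.
pose d0 := nm c * s / 4; rewrite -/d0 in hh hP hlip.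
have cs : 0 < nm c * s by rewrite mulr_gt0.
have d00 : 0 < d0 by rewrite /d0 divr_gt0.
have inj z w : nm (z - z0) < s -> nm (w - z0) < s -> g z = g w -> z = w.
  by move=> zs ws; exact: near_linear_inj c0 nl zs ws.
have hb y e : nm y <= e * d0 -> nm y < d0 -> nm (h y - z0) <= e * (s / 2).
  move=> ye yd; have := (hP y _).2; rewrite !subr0 => /(_ yd) h1.
  apply: le_trans h1 _; rewrite mulrAC ler_pdivrMr //; move: ye; rewrite /d0; lra.
have hs y : nm y < d0 -> g (h y) = y /\ nm (h y - z0) < s.
  move=> yd; split; first by have := (hP y _).1; rewrite subr0; apply.
  by have := hb y 1; rewrite !mul1r => /(_ (ltW yd) yd); lra.
have h0 : h 0 = z0.
  have z0d : nm (0 : C) < d0 by rewrite nm0.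
  have [gh0 h0s] := hs 0 z0d.
  by apply: inj => //; [exact: nm_aa|rewrite gz0].
pose Q y := P (h y).
pose r1 := d0 / 2.
have r10 : 0 < r1 by rewrite divr_gt0.
pose M1 := ((nm z0 / 2) ^+ p)^-1.
have M10 : 0 <= M1 by rewrite invr_ge0 exprn_ge0 // divr_ge0 // ltW.
have z0s : nm z0 + s <= r by clear - ss0 s0r s00; lra.
have FL := conjugated_flow (d0 := d0) (A := A) (M1 := M1) r0 u1 H sp z0s d00 hgs inj hh hs.
have {}FL e : 0 < e -> exists F t, [/\ 0 < t < e, hol 0 r1 F,
    forall y, nm y < r1 -> nm (F y - y - t%:C) <= e * t &
    forall y, nm y < r1 -> (Q y <-> Q (F y))].
  apply: FL => //.
  - move=> y yr; have yd : nm y < d0 by clear - yr d00; lra.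
    have h1 : nm (h y - z0) <= 1 / 2 * (s / 2) by apply: hb => //; clear - yr; lra.
    clear - h1 sp; lra.
  - move=> z w zs ws; rewrite -dgE; last by clear - zs ss0; lra.
    by apply: quad; [clear - zs ss1|clear - ws ss1]; lra.
  - move=> z zs; have zs0 : nm (z - z0) < s0 by clear - zs ss0 s00; lra.
    split; first exact: n0.
    rewrite nmV nmM u1 mul1r nmX lef_pV2 ?posrE ?exprn_gt0 ?divr_gt0 ?nm_gt0 ?(n0 _ zs0) //.
    by apply: lerXn2r; rewrite ?nnegrE ?nm_ge0 ?divr_ge0 ?nm_ge0 //; exact: lb.
(* Closedness passes to the chart because [h] is Lipschitz. *)
have Qcl y : nm y < d0 -> (forall e, 0 < e -> exists2 w, nm (w - y) <= e & Q w) -> Q y.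
  move=> yd Hy; have [_ hy] := hs y yd.
  apply: cl => [|e e0].
    by rewrite -(subrK z0 (h y)); apply: le_lt_trans (nmD _ _) _; lra.
  pose e' := Num.min (e * nm c / 2) ((d0 - nm y) / 2).
  have dy : 0 < d0 - nm y by rewrite subr_gt0.
  have [|w wy Qw] := Hy e'; first by rewrite lt_min !divr_gt0 // mulr_gt0.
  have w1 : nm (w - y) <= e * nm c / 2 by apply: le_trans wy _; rewrite ge_min lexx.
  have w2 : nm (w - y) <= (d0 - nm y) / 2 by apply: le_trans wy _; rewrite ge_min lexx orbT.
  have wd : nm w < d0 by rewrite -(subrK y w); apply: le_lt_trans (nmD _ _) _; lra.
  exists (h w) => //; have := hlip w y; rewrite !subr0 => /(_ wd yd) /le_trans; apply.
  by rewrite mulrAC ler_pdivrMr //; lra.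
have n1 : nm (1 : C) = 1 by exact: nm1.
have nN1 : nm (-1 : C) = 1 by rewrite nmN nm1.
(* The inverse steps are available on radius [r1 / 16], and iteration needs a strictly smaller disc;
   this radius serves both signs of [t]. *)
exists s, (r1 / 32), g, h; split; first by split => //; lra.
split => //.
- by apply: (hol_le hh); move: r10; rewrite /r1; lra.
- by split => // y yr; apply: hs; move: yr r10; rewrite /r1; lra.
move=> y t yr ytr Py.
have [t0|t0] := leP 0 t.
  have lt : r1 / 32 < r1 by lra.
  have := @iterate_flow Q 1 r1 (r1 / 32) n1 lt _ _ y t t0 yr; rewrite mulr1; apply => //.
    move=> e e0; have [F [x [xe _ Fx FQ]]] := FL e e0; exists F, x; split => //.
      by move=> w wr; rewrite mulr1; exact: Fx.
    by move=> w wr; rewrite FQ.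
  by move=> w wr; apply: Qcl; move: wr r10; rewrite /r1; lra.
have lt : r1 / 32 < r1 / 16 by lra.
have t0' : 0 <= - t by lra.
have E : (- t)%:C * -1 = t%:C :> C by rewrite rmorphN /=; ring.
have := @iterate_flow Q (-1) (r1 / 16) (r1 / 32) nN1 lt (reverse_flow r10 FL) _ y (- t) t0' yr.
rewrite E; apply => // w wr; apply: Qcl; move: wr r10; rewrite /r1; lra.
Qed.

End FlowBox.

(** * The product structure *)

Section ProductPiece.
Variable R : realType.
Local Notation C := R[i].
Local Notation ii := ('i%C : R[i]).
Implicit Types (z w y u v : C) (s t a d e : R).

Lemma cvg_nmP (T : Type) (F : set_system T) (FF : Filter F) (f : T -> R[i]^o) (l : R[i]^o) :
  f @ F --> l <-> forall e, 0 < e -> \forall x \near F, nm (f x - l) < e.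
Proof.
split=> [/cvgrPdist_lt fl e e0|H].
  have := fl e%:C; rewrite ltcR => /(_ e0); apply: filterS => x.
  by rewrite normE ltcR nmB.
apply/cvgrPdist_lt => _ /gt0CE[e e0 ->]; apply: filterS (H e e0) => x.
by rewrite normE ltcR nmB.
Qed.

Definition box a : C -> Prop := fun y => `|complex.Re y| < a /\ `|complex.Im y| < a.

Lemma box_scale a y t : 0 <= t <= 1 -> box a y -> box a (t%:C * y).
Proof.
case: y => p q /andP[t0 t1] [/= p1 q1]; split => /=.
  rewrite mul0r subr0 normrM ger0_norm //; apply: le_lt_trans p1.
  by rewrite ler_piMl.
rewrite mul0r addr0 normrM ger0_norm //; apply: le_lt_trans q1.
by rewrite ler_piMl.
Qed.

Lemma box_convex a y w t : 0 <= t <= 1 -> box a y -> box a w -> box a (seg y w t).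
Proof.
have cvx (p q : R) : 0 <= t <= 1 -> `|p| < a -> `|q| < a -> `|p + t * (q - p)| < a.
  move=> /andP[t0 t1] pa qa; pose m := Num.max `|p| `|q|.
  apply: (@le_lt_trans _ _ m); last by rewrite gt_max pa.
  have : `|p| <= m by rewrite le_max lexx.
  have : `|q| <= m by rewrite le_max lexx orbT.
  move: m => m; rewrite !ler_norml => /andP[q1 q2] /andP[p1 p2].
  have t1' : 0 <= 1 - t by rewrite subr_ge0.
  have := mulr_ge0 t1' (_ : 0 <= p + m); have := mulr_ge0 t1' (_ : 0 <= m - p).
  have := mulr_ge0 t0 (_ : 0 <= q + m); have := mulr_ge0 t0 (_ : 0 <= m - q).
  move=> h1 h2 h3 h4; have {}h1 := h1 ltac:(lra); have {}h2 := h2 ltac:(lra).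
  have {}h3 := h3 ltac:(lra); have {}h4 := h4 ltac:(lra).
  by apply/andP; split; lra.
case: y => p q; case: w => p' q' t01 [/= h1 h2] [/= h3 h4]; split => /=.
  by rewrite mul0r subr0; exact: cvx.
by rewrite mul0r addr0; exact: cvx.
Qed.

Lemma box_nm a y : `|complex.Re y| <= a -> `|complex.Im y| <= a -> nm y <= 2 * a.
Proof. by move=> h1 h2; apply: le_trans (nm_ReIm _) _; lra. Qed.

Section Chart.
Variables (N : set R[i]^o) (g h : C -> C) (d a : R).
Hypothesis oN : open N.
Hypothesis gN : forall z, N z -> exists l, cder g z l.
Hypothesis ginj : forall z w, N z -> N w -> g z = g w -> z = w.
Hypothesis hh : hol 0 d h.
Hypothesis gh : forall y, nm y < d -> g (h y) = y /\ N (h y).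
Hypothesis a0 : 0 < a.
Hypothesis ad : 2 * a < d.

(** The square seen through the chart. Under the hypotheses, [g] and [h] are inverse bijections
    between it and the open square of half-side [a]. *)
Let Omega : set R[i]^o := [set z | N z /\ box a (g z)].

Lemma box_d y : box a y -> nm y < d.
Proof. by move=> [/ltW h1 /ltW h2]; apply: le_lt_trans (box_nm h1 h2) ad. Qed.

Lemma h_box y : box a y -> Omega (h y).
Proof. by move=> yb; have [gy Ny] := gh (box_d yb); split => //; rewrite gy. Qed.

Lemma Omega_h z : Omega z -> h (g z) = z.
Proof.
move=> [Nz zb]; have [gy Ny] := gh (box_d zb).
exact: ginj.
Qed.

Lemma h_cont y e : nm y < d -> 0 < e -> exists2 r : R, 0 < r & forall w, nm (w - y) < r -> nm (h w - h y) < e.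
Proof.
move=> yd e0; have [l hl] : exists l, cder h y l by apply: hh; rewrite subr0.
exact: cder_cont hl e0.
Qed.

Lemma open_Omega : open Omega.
Proof.
apply/open_nmP => z [Nz [z1 z2]].
have [r r0 rN] := (open_nmP _).1 oN z Nz; have [l gl] := gN Nz.
have [|s s0 sP] := cder_cont gl (_ : 0 < Num.min (a - `|complex.Re (g z)|) (a - `|complex.Im (g z)|)).
  by rewrite lt_min !subr_gt0 z1.
exists (Num.min r s) => [|w]; first by rewrite lt_min r0.
rewrite lt_min => /andP[/rN Nw /sP]; rewrite lt_min => /andP[h1 h2]; split => //.
have := nm_Re (g w - g z); have := nm_Im (g w - g z); rewrite !raddfB /= => h3 h4.
have := lerB_dist (complex.Re (g w)) (complex.Re (g z)).
have := lerB_dist (complex.Im (g w)) (complex.Im (g z)).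
by split; lra.
Qed.

(** In the chart the square is star-shaped about [0]: it is a union of images of radial segments,
    all containing [h 0]. *)
Lemma connected_Omega : connected Omega.
Proof.
pose path y : set R[i]^o := (fun t : R => h (t%:C * y) : R[i]^o) @` `[0, 1]%classic.
have -> : Omega = \bigcup_(y in [set y | box a y]) path y.
  apply/seteqP; split=> z.
    move=> /[dup] Oz [_ zb]; exists (g z) => //; exists 1 => /=.
      by rewrite in_itv /= ler01 lexx.
    by rewrite rmorph1 mul1r Omega_h.
  move=> [y yb [t /=]]; rewrite in_itv /= => t01 <-.
  by apply: h_box; exact: box_scale.
apply: bigcup_connected.
  exists (h 0) => y yb; exists 0 => /=; first by rewrite in_itv /= ler01 lexx.
  by rewrite mul0r.
move=> y yb; apply: connected_continuous_connected; first exact: segment_connected.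
apply: continuous_in_subspaceT => t /set_mem /=; rewrite in_itv /= => t01.
apply/cvg_nmP => e e0.
have [r r0 rP] := h_cont (box_d (box_scale t01 yb)) e0.
have y1 : 0 < nm y + 1 by rewrite ltr_wpDl ?nm_ge0.
apply/nbhs_normP; exists (r / (nm y + 1)) => [|s] /=; first by rewrite divr_gt0.
rewrite /ball_ /= distrC ltr_pdivlMr // => st; apply: rP.
rewrite -mulrBl -rmorphB nmM nm_real; apply: le_lt_trans st.
by apply: ler_wpM2l => //; rewrite lerDl.
Qed.

(** The square is convex, so a loop is contracted in the chart along straight segments to its base
    point, which stays fixed. *)
Lemma loops_contractible_Omega : loops_contractible Omega.
Proof.
move=> gamma cg gO g01.
have inO t : `[0, 1]%classic t -> Omega (gamma t) by move=> t01; apply: gO; exists t.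
have I0 : `[0, 1]%classic (0 : R) by rewrite /= in_itv /= lexx ler01.
pose p (x : R * R) : C := seg (g (gamma x.2)) (g (gamma 0)) x.1.
have boxp x : (`[0, 1] `*` `[0, 1])%classic x -> box a (p x).
  move=> [/= x1 x2]; apply: box_convex; first by move: x1; rewrite in_itv.
    by have [] := inO _ x2.
  by have [] := inO _ I0.
exists (fun x => h (p x)); split.
- apply/subspace_continuousP => -[s t] /[dup] Ix [/= sI tI]; apply/cvg_nmP => e e0.
  have [r r0 rP] := h_cont (box_d (boxp _ Ix)) e0.
  have [Nt _] := inO t tI; have [l gl] := gN Nt.
  have r2 : 0 < r / 2 by rewrite divr_gt0.
  have [r1 r10 r1P] := cder_cont gl r2.
  pose M := nm (g (gamma t) - g (gamma 0)).
  have M1 : 0 < M + 1 by rewrite ltr_wpDl ?nm_ge0.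
  move/subspace_continuousP : cg => /(_ t tI) /cvg_nmP /(_ r1 r10).
  rewrite nearE /within /= => /nbhs_normP[r3 /= r30 r3P].
  rewrite nearE /within /=.
  exists ([set s' : R | `|s - s'| < r / 2 / (M + 1)], [set t' : R | `|t - t'| < r3]).
    split; apply/nbhs_normP.
      by exists (r / 2 / (M + 1)) => //=; rewrite divr_gt0.
    by exists r3.
  move=> [s' t'] [/= hs ht] [/= s'I t'I]; apply: rP; rewrite /p /=.
  have := r3P t' ht t'I => /r1P gt.
  rewrite (_ : _ - _ = (1 - s')%:C * (g (gamma t') - g (gamma t)) + (s - s')%:C * (g (gamma t) - g (gamma 0))); last first.
    by rewrite /seg !rmorphB rmorph1; ring.
  apply: le_lt_trans (nmD _ _) _; rewrite !nmM !nm_real -/M.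
  move: s'I; rewrite in_itv /= => /andP[s'0 s'1].
  have n1 : `|1 - s'| <= 1 by rewrite ler_norml; lra.
  have n2 := ler_wpM2r (nm_ge0 (g (gamma t') - g (gamma t))) n1.
  rewrite ltr_pdivlMr // in hs.
  have n3 : 0 <= `|s - s'| by [].
  by have := nm_ge0 (g (gamma t) - g (gamma 0)); rewrite -/M; lra.
- by move=> z [x Ix <-]; apply: h_box; exact: boxp.
- move=> t tI; rewrite /p /seg /=; split.
    by rewrite rmorph0 mul0r addr0 Omega_h //; exact: inO.
  by rewrite rmorph1 mul1r subrKC Omega_h //; exact: inO.
- move=> s sI; rewrite /p /seg /= -g01 subrr mulr0 addr0.
  by rewrite Omega_h //; exact: inO.
Qed.

Definition cbox y := `|complex.Re y| <= a /\ `|complex.Im y| <= a.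

Lemma cbox_d y : cbox y -> nm y < d.
Proof. by move=> [h1 h2]; apply: le_lt_trans (box_nm h1 h2) ad. Qed.

(** A limit of points of [Omega] comes from a cluster point of their coordinates, which lies in the
    closed square; conversely, points of the closed square are approached by contraction towards
    [0]. The condition [2 a < d] keeps the closed square where [h] is continuous. *)
Lemma closure_Omega z : closure Omega z <-> exists2 y, cbox y & z = h y.
Proof.
split=> [Oz|[y [y1 y2] ->]].
  have ex (n : nat) : exists y, box a y /\ nm (h y - z) < 2^-1 ^+ n.
    have [|w /[dup] Ow [_ wb] wz] := (closure_nmP _ _).1 Oz (2^-1 ^+ n).
      by rewrite exprn_gt0 // invr_gt0.
    by exists (g w); rewrite Omega_h.
  have [y yP] := boolp.choice ex.
  have [|l lP] := @cluster_point _ y d.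
    by move=> n; have [yb _] := yP n; exact: ltW (box_d yb).
  have lb : cbox l.
    split; apply/ler_addgt0Pr => e e0; have [n _ ly] := lP e 0%N e0; have [[b1 b2] _] := yP n.
      have := nm_Re (y n - l); rewrite raddfB /= distrC.
      by have := lerB_dist (complex.Re l) (complex.Re (y n)); lra.
    have := nm_Im (y n - l); rewrite raddfB /= distrC.
    by have := lerB_dist (complex.Im l) (complex.Im (y n)); lra.
  exists l => //; apply/eqP; rewrite -subr_eq0 -nm_le0; apply/ler_addgt0Pr => e e0.
  have e2 : 0 < e / 2 by rewrite divr_gt0.
  have [r r0 rP] := h_cont (cbox_d lb) e2.
  have half01 : 0 <= (2^-1 : R) < 1 by apply/andP; split; lra.
  have [N1 N1P] := expr_small half01 e2.
  have r2 : 0 < r / 2 by rewrite divr_gt0.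
  have [n Nn ly] := lP (r / 2) N1 r2.
  have hy : nm (h (y n) - h l) < e / 2 by apply: rP; lra.
  have [_ hz] := yP n; have hN := N1P n Nn.
  rewrite add0r; apply: le_trans (nm_tri (h (y n)) _ _) _.
  by rewrite (nmB z); lra.
apply/closure_nmP => e e0.
have [r r0 rP] := h_cont (cbox_d (conj y1 y2)) e0.
pose x := Num.min 1 (r / 2 / (nm y + 1)).
have y1' : 0 < nm y + 1 by rewrite ltr_wpDl ?nm_ge0.
have x0 : 0 < x by rewrite lt_min ltr01 !divr_gt0.
have x1 : x <= 1 by rewrite ge_min lexx.
have xr : x * (nm y + 1) <= r / 2 by rewrite -ler_pdivlMr // ge_min lexx orbT.
have bx : box a ((1 - x)%:C * y).
  have sh (q : R) : `|q| <= a -> `|(1 - x) * q| < a.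
    move=> qa; have x1' : 0 <= 1 - x by rewrite subr_ge0.
    rewrite normrM ger0_norm //; have := mulr_gt0 x0 a0; have := ler_wpM2l x1' qa; lra.
  case: (y) y1 y2 => q1 q2 /= y1 y2; split => /=.
    by rewrite mul0r subr0; exact: sh.
  by rewrite mul0r addr0; exact: sh.
exists (h ((1 - x)%:C * y)); first exact: h_box.
apply: rP; rewrite (_ : _ - _ = - (x%:C * y)); last by rewrite rmorphB rmorph1; ring.
by rewrite nmN nmM nm_real gtr0_norm //; lra.
Qed.

End Chart.

(** Horizontal invariance makes membership of [h (p + i q)] in [K] depend on [q] alone inside the
    square, so [K] is determined by its trace on the vertical axis. The affine map [(g + a) / (2 a)]
    sends the closed square to the unit square with abscissae in [[0, 1]]. *)
Lemma product_piece_chart (K N : set R[i]^o) (g h : C -> C) d :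
  open N -> (forall z, N z -> exists l, cder g z l) ->
  (forall z w, N z -> N w -> g z = g w -> z = w) -> 0 < d -> hol 0 d h ->
  (forall y, nm y < d -> g (h y) = y /\ N (h y)) -> closed K -> K (h 0) ->
  (forall y t, nm y < d -> nm (y + t%:C) < d -> K (h y) -> K (h (y + t%:C))) ->
  exists Omega : set R[i]^o, Omega `<=` N /\ product_piece K Omega.
Proof.
move=> oN gN ginj d0 hh gh cK K0 flow.
pose a := d / 4; have a0 : 0 < a by rewrite divr_gt0.
have ad : 2 * a < d by rewrite /a; lra.
exists [set z | N z /\ box a (g z)]; split; first by move=> z [].
split.
  split; first split.
  - exact: open_Omega.
  - exact: (connected_Omega ginj hh gh ad).
  - exact: (loops_contractible_Omega gN ginj hh gh ad).
pose k : C := (2 * a)%:C.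
have k0 : k != 0 by rewrite -nm_gt0 nm_real gtr0_norm; lra.
pose psi z := (g z + a%:C) / k.
have clO := closure_Omega ginj hh gh a0 ad.
have a2 : 0 < 2 * a by rewrite mulr_gt0.
have n2a : `|2 * a| = 2 * a by rewrite gtr0_norm.
(* The vertical segment [p = 0] in the chart; the factor [2 a] matches the normalisation of [psi],
   hence the range [|x| <= 1/2]. *)
pose line (x : R) : C := (0 +i* (2 * a * x))%C.
pose L0 := [set x : R | `|x| <= 2^-1 /\ K (h (line x))].
have lined x : `|x| <= 2^-1 -> cbox a (line x).
  move=> x1; split => /=; first by rewrite normr0 ltW.
  by rewrite normrM n2a; have := ler_wpM2l (ltW a2) x1; lra.
pose L : set R[i]^o := [set (0 +i* x)%C | x in L0].
exists N, psi, L; split; split => //.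
- move=> z /clO[y /(cbox_d ad) yd ->]; by have [] := gh y yd.
- split=> [z Nz|z w /set_mem Nz /set_mem Nw E].
    have [l gl] := gN z Nz.
    apply: (@cder_derivable _ _ _ (l * k^-1 + (g z + a%:C) * 0)).
    apply: (@cderM _ (fun z => g z + a%:C) (fun=> k^-1)); last exact: cder_cst.
    by rewrite -[l]addr0; apply: cderD => //; exact: cder_cst.
  apply: ginj => //; move: E; rewrite /psi => /(mulIf (invr_neq0 k0)).
  exact: addIr.
- exists 0, 0 => //; split; first by rewrite normr0 invr_ge0.
  by rewrite (_ : line 0 = 0) //; rewrite /line mulr0.
- have cL : compact L0.
    apply: (@subclosed_compact _ _ (`[- 2^-1, 2^-1]%classic : set R)).
    + move=> x xL; have ex e : 0 < e -> exists2 x', L0 x' & `|x - x'| < e.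
        move=> e0; have [|x' [L0x' xx']] := xL [set x' | `|x - x'| < e].
          by apply/nbhs_normP; exists e.
        by exists x'.
      have x2 : `|x| <= 2^-1.
        apply/ler_addgt0Pr => e /ex[x' [x'1 _] xx'].
        by have := lerB_dist x x'; lra.
      split => //; apply: cK; apply/closure_nmP => e e0.
      have [r r0 rP] := h_cont hh (cbox_d ad (lined x x2)) e0.
      have r1 : 0 < r / (2 * a) by rewrite divr_gt0 // mulr_gt0.
      have [x' [x'1 Kx'] xx'] := ex _ r1.
      exists (h (line x')) => //; apply: rP.
      rewrite (_ : line x' - line x = (2 * a * (x' - x))%:C * ii); last first.
        by apply/eqP; rewrite eq_complex /=; apply/andP; split; apply/eqP; ring.
      rewrite nmM nm_i mulr1 nm_real normrM gtr0_norm; last by rewrite mulr_gt0.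
      by rewrite ltr_pdivlMr in xx'; [rewrite distrC mulrC|rewrite mulr_gt0].
    + exact: segment_compact.
    + by move=> x [/= x1 _]; rewrite in_itv /= -ler_norml.
  apply: continuous_compact cL; apply: continuous_in_subspaceT => x _.
  apply/cvg_nmP => e e0; apply/nbhs_normP; exists e => [//|y xy].
  rewrite (_ : (0 +i* y)%C - (0 +i* x)%C = (y - x)%:C * ii); last first.
    by apply/eqP; rewrite eq_complex /=; apply/andP; split; apply/eqP; ring.
  by rewrite nmM nm_i mulr1 nm_real distrC; exact: xy.
- by move=> z [x _ <-].
apply/seteqP; split=> [_ [z [/clO[y yb ->] Kz] <-]|z [x /=]].
  have yd := cbox_d ad yb; have [gy _] := gh y yd.
  case: y yb Kz yd gy => p q [/= yp yq] Kz yd gy.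
  exists ((p + a) / (2 * a)).
    rewrite /= in_itv /=; move: yp; rewrite ler_norml => /andP[p1 p2].
    by rewrite ler_pdivrMr // ler_pdivlMr //; lra.
  exists (0 +i* (q / (2 * a)))%C.
    exists (q / (2 * a)) => //; split.
      by rewrite normrM normfV n2a ler_pdivrMr //; clear - yq; lra.
    (* Flowing by the real time [-p] carries the point to the vertical axis. *)
    have E : line (q / (2 * a)) = (p +i* q)%C + (- p)%:C.
      apply/eqP; rewrite eq_complex /=; apply/andP; split; apply/eqP; first by ring.
      by field; rewrite lt0r_neq0.
    have ld : nm (line (q / (2 * a))) < d.
      apply/(cbox_d ad)/lined; rewrite normrM normfV n2a ler_pdivrMr //; clear - yq; lra.
    by rewrite E in ld *; exact: (flow (p +i* q)%C (- p) yd ld Kz).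
  rewrite /psi gy /k; apply: (mulIf k0); rewrite mulfVK //.
  by apply/eqP; rewrite eq_complex /=; apply/andP; split; apply/eqP; field; rewrite lt0r_neq0.
rewrite in_itv /= => x01 [_ [q [q1 Kq] <-] <-].
pose y : C := ((2 * a * x - a) +i* (2 * a * q))%C.
have yb : cbox a y.
  move/andP: x01 => [x0 x1]; have h0 := mulr_ge0 (ltW a2) x0.
  have h1 := ler_wpM2l (ltW a2) x1; have h2 := ler_wpM2l (ltW a2) q1.
  split; rewrite /y /=; first by rewrite ler_norml; clear - h0 h1; apply/andP; split; lra.
  by rewrite normrM n2a; clear - h2; lra.
have yd := cbox_d ad yb; have [gy _] := gh y yd.
exists (h y).
  split; first by apply/clO; exists y.
  have E : y = line q + (2 * a * x - a)%:C.
    by apply/eqP; rewrite eq_complex /=; apply/andP; split; apply/eqP; ring.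
  by rewrite E in yd *; exact: (flow (line q) (2 * a * x - a) (cbox_d ad (lined q q1)) yd Kq).
rewrite /psi gy /k; apply: (mulIf k0); rewrite mulfVK //.
by apply/eqP; rewrite eq_complex /=; apply/andP; split; apply/eqP; ring.
Qed.

End ProductPiece.

(** * Proof of the theorem *)

Section SymmetrySequences.
Variable R : realType.
Local Notation C := (R[i]^o).
Implicit Types (K U D : set C) (F : set (C -> C)) (H g : C -> C) (a b z w x y : C) (d e r : R).

(** Squares replace closed discs as compact neighbourhoods because they are continuous images of
    products of segments. *)
Lemma compact_square a r : compact [set z : C | `|complex.Re (z - a)| <= r /\ `|complex.Im (z - a)| <= r].
Proof.
pose f (x : R * R) : C := a + (x.1 +i* x.2)%C.
have -> : [set z : C | `|complex.Re (z - a)| <= r /\ `|complex.Im (z - a)| <= r] =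
    f @` (`[- r, r] `*` `[- r, r])%classic.
  apply/seteqP; split=> [z [z1 z2]|_ [[p q] [/= p1 q1] <-]].
    exists (complex.Re (z - a), complex.Im (z - a)); first by split; rewrite /= in_itv /= -ler_norml.
    rewrite /f /= (_ : (_ +i* _)%C = z - a); last by case: (z - a).
    by rewrite subrKC.
  rewrite /f /= addrAC subrr add0r /= !ler_norml.
  by move: p1 q1; rewrite !in_itv.
apply: continuous_compact; last by apply: compact_setX; exact: segment_compact.
apply: continuous_in_subspaceT => -[p q] _; apply/cvg_nmP => e e0.
have e2 : 0 < e / 2 by rewrite divr_gt0.
exists ([set x : R | `|p - x| < e / 2], [set x : R | `|q - x| < e / 2]).
  by split; apply/nbhs_normP; exists (e / 2).
move=> [p' q'] [/= hp hq]; apply: le_lt_trans (nm_ReIm _) _.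
rewrite (_ : f (p', q') - f (p, q) = ((p' - p) +i* (q' - q))%C); last first.
  rewrite /f /= opprD addrACA subrr add0r.
  by apply/eqP; rewrite eq_complex /= !eqxx.
by rewrite /= distrC (distrC q'); lra.
Qed.

(** The closed square of half-side [r] contains the disc of radius [r] and lies within distance
    [2 r] of [a]; the factor [3] leaves strict room. *)
Lemma uniform_on_disc U (u : nat -> C -> C) g a r : 0 < r -> cvg_unif_on_compacts U u g ->
  (forall z, nm (z - a) < 3 * r -> U z) ->
  forall e, 0 < e -> exists N, forall n z, (N <= n)%N -> nm (z - a) < r -> nm (u n z - g z) <= e.
Proof.
move=> r0 ug aU e e0.
pose A : set C := [set z | `|complex.Re (z - a)| <= r /\ `|complex.Im (z - a)| <= r].
have cA : compactly_in U A.
  split; last exact: compact_square.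
  by move=> z [z1 z2]; apply: aU; apply: le_lt_trans (nm_ReIm _) _; lra.
have entE : entourage [set xy : C * C | nm (xy.1 - xy.2) < e].
  have eC : 0 < e%:C by rewrite ltcR.
  apply: filterS (entourage_ball C (PosNum eC)) => -[x y] /=.
  by rewrite -ball_normE /= normE ltcR.
have := ug _ (fam_nbhs g entE cA); rewrite nbhs_filterE => -[N _ NP].
exists N => n z /NP /= h za; rewrite nmB; apply/ltW/h.
by split; apply: le_trans (ltW za); [exact: nm_Re|exact: nm_Im].
Qed.

Lemma not_isolated K x d : isolated K = set0 -> K x -> 0 < d ->
  exists y, [/\ K y, y != x & nm (y - x) < d].
Proof.
move=> iK Kx d0; have := subset_closure Kx; rewrite closure_isolated_limit_point iK.
rewrite set0U => /(_ [set y : C | nm (y - x) < d])[|y [yx Ky yd]].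
  by apply/nbhs_nmP; exists d.
by exists y.
Qed.

(** An infinite set receives an injection of the natural numbers. The maps are counted through their
    restrictions to [U], so distinct terms differ at a point of [U]. *)
Lemma distinct_sequence U F : ~ finite_family U F ->
  exists u : nat -> C -> C, (forall n, F (u n)) /\
    forall m n, m <> n -> exists2 z, U z & u m z <> u n z.
Proof.
move=> /infiniteP /pcard_leP [f].
have ex n : exists u, F u /\ u \_ U = f n.
  have [] : [set (u \_ U) | u in F] (f n) by apply: funS.
  by move=> u Fu uE; exists u.
have [u uP] := boolp.choice ex; exists u; split=> [n|m n mn]; first by have [] := uP n.
apply: contrapT => H; apply: mn.
apply: (@inj _ _ setT f); rewrite ?inE //.
apply: (etrans (esym (uP m).2)); apply: (etrans _ (uP n).2).
apply/funext => z; rewrite !patchE.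
case: ifPn => // /set_mem Uz; apply: contrapT => neq; apply: H; by exists z.
Qed.

Lemma identity_theorem2 U (f g : C -> C) : domain U ->
  (forall z, U z -> exists l, cder f z l) -> (forall z, U z -> exists l, cder g z l) ->
  (exists2 a, U a & exists2 d : R, 0 < d & forall z, nm (z - a) < d -> f z = g z) ->
  forall z, U z -> f z = g z.
Proof.
move=> dU hf hg [a Ua [d d0 fg]] z Uz; apply/eqP; rewrite -subr_eq0; apply/eqP.
apply: (@identity_theorem R U (fun z => f z - g z)) => //.
  move=> w Uw; have [l fl] := hf w Uw; have [k gk] := hg w Uw.
  by exists (l - k); exact: cderB.
by exists a => //; exists d => // w /fg ->; rewrite subrr.
Qed.

Lemma symmetry_cder K D H : symmetry K D H -> forall z, D z -> exists l, cder H z l.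
Proof. by move=> [_ _ hH _] z /hH /derivable_cder; exists (derive1 H z). Qed.

Lemma symmetryE K D H z : symmetry K D H -> D z -> (K z <-> K (H z)).
Proof.
move=> [_ _ _ HK] Dz; have := HK z Dz; split=> Kz.
  by have [] := (HK z Dz).1 (conj Dz Kz).
by have [] := (HK z Dz).2 (conj (ex_intro2 _ _ z Dz erefl) Kz).
Qed.

(** If [g'] vanished near [x], the identity theorem would make [g] constant on [U]. Otherwise [x] is
    at worst an isolated zero of [g'], and it remains to find an attracting point of [K] close to
    [x] but distinct from it. *)
Lemma attracting_point_regular K U V g x : isolated K = set0 -> J_like K U -> domain U ->
  open V -> V `<=` U -> V x -> K x -> (forall z, U z -> exists l, cder g z l) ->
  ~ constant_on U g ->
  exists b, [/\ V b, K b, attracting_points K b & dv g b != 0].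
Proof.
move=> iK JK dU oV VU Vx Kx hg gc.
have [r r0 rV] := (open_nmP V).1 oV x Vx.
have hr : hol x r g by move=> z /rV /VU /hg.
have [[d d0 dP]|[d d0 dP]] := hol_isolated_zeros r0 (hol_deriv hr).
  case: gc; exists (g x) => z Uz.
  apply: (identity_theorem2 (g := fun=> g x) dU hg _ _ Uz).
    by move=> w _; exists 0; exact: cder_cst.
  exists x; first exact: VU.
  pose m := Num.min d r; exists m; first by rewrite lt_min d0.
  move=> w wm; apply/eqP; rewrite -subr_eq0 -nm_le0.
  have m0 : 0 < m by rewrite lt_min d0.
  have md : m <= d by rewrite ge_min lexx.
  have mr : m <= r by rewrite ge_min lexx orbT.
  have hm : holo_on x m g (dv g) := hol_dv (hol_le hr mr).
  rewrite -[X in _ <= X](mul0r (nm (w - x))).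
  apply: (mvi_disc hm _ (nm_aa x m0) wm) => v vm.
  by rewrite dP ?nm0 //; exact: lt_le_trans md.
pose m := Num.min d r / 2.
have m0 : 0 < Num.min d r by rewrite lt_min d0.
have m20 : 0 < m by rewrite divr_gt0.
have md : 2 * m <= d.
  by rewrite /m mulrC mulfVK ?ge_min ?lexx // pnatr_eq0.
have mr : 2 * m <= r.
  by rewrite /m mulrC mulfVK ?ge_min ?lexx ?orbT // pnatr_eq0.
have [y [Ky yx ym]] := not_isolated iK Kx m20.
have Uy : U y by apply/VU/rV; lra.
have yx0 : 0 < nm (y - x) by rewrite nm_gt0 subr_eq0.
(* Approximating [y] more closely than its distance to [x] forces [b] to differ from [x]. *)
have [b [[Ub Kb] ab] by_] := (closure_nmP _ _).1 (JK y (conj Uy Ky)) _ yx0.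
have bx : nm (b - x) < 2 * m by apply: le_lt_trans (nm_tri y _ _) _; lra.
exists b; split => //; first by apply: rV; exact: lt_le_trans mr.
apply: dP; apply/andP; split; last exact: lt_le_trans md.
by have := nm_tri b y x; rewrite (nmB y b); lra.
Qed.

End SymmetrySequences.

Section Main.
Variable R : realType.
Local Notation C := (R[i]^o).
Implicit Types (K U D V : set C) (F : set (C -> C)) (G H g : C -> C) (a b z w x y : C) (d e r s t : R).

(** All hypotheses are in the linearizing coordinate. The accumulation of [P] at [0] supplies a base
    point [z0] away from the zero of the field. *)
Lemma flow_near_attracting_point (P : C -> Prop) (l : C) r : 0 < r -> 0 < nm l < 1 ->
  scaling_invariant P l r ->
  (forall z, nm z < r -> (forall e, 0 < e -> exists2 w, nm (w - z) <= e & P w) -> P z) ->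
  (forall d, 0 < d -> exists y, [/\ P y, y != 0 & nm y < d]) ->
  (forall e, 0 < e -> exists h, [/\ hol 0 r h, forall w, nm (w - 0) < r -> nm (h w - w) <= e,
     forall w, nm (w - 0) < r -> (P w <-> P (h w)) &
     forall d, 0 < d -> exists w, nm (w - 0) < d /\ h w <> w]) ->
  exists z0 s d g h, [/\ P z0, 0 < s, nm z0 + s <= r & 0 < d] /\
   [/\ hol z0 s g, forall z w, nm (z - z0) < s -> nm (w - z0) < s -> g z = g w -> z = w,
     hol 0 d h,
     (h 0 = z0) /\ (forall y, nm y < d -> g (h y) = y /\ nm (h y - z0) < s) &
     forall y t, nm y < d -> nm (y + t%:C) < d -> P (h y) -> P (h (y + t%:C))].
Proof.
move=> r0 l01 Pl cl acc Hh.
have r20 : 0 < r / 2 by rewrite divr_gt0.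
have [p pP] : exists p, forall e, 0 < e -> approximate_flow P p (r / 2) e.
  apply: (approximate_flows r0 l01 Pl) => e /Hh[h [h1 h2 h3 h4]]; exists h; split.
    by split=> // w wr; [apply: h2|apply: h3]; rewrite subr0.
  by move=> d /h4[w [wd hw]]; exists w; rewrite subr0 in wd.
have [u u1 uP] := approximate_flow_direction r20 pP.
have [z0 [Pz0 z00 z0r]] := acc _ r20.
have [|s [d [g [h [[s0 zs d0] gh]]]]] := flow_box r20 u1 z0r z00 uP.
  by move=> z zr; apply: cl; lra.
by exists z0, s, d, g, h; split => //; split => //; lra.
Qed.

(** Everything is transported by the Koenigs coordinate [f], with local inverse [k]: there [K]
    becomes [P] and [G] becomes multiplication by [l]. Composing the rectifying chart with [f]
    brings the product structure back to [K]. *)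
Lemma product_piece_near K V G b (un : nat -> C -> C) g r : closed K -> isolated K = set0 ->
  0 < r -> (forall z, nm (z - b) < r -> V z) -> hol b r G -> K b -> G b = b ->
  0 < nm (dv G b) < 1 -> (forall z, nm (z - b) < r -> (K z <-> K (G z))) ->
  (forall n, hol b r (un n)) ->
  (forall e, 0 < e -> exists N, forall n z, (N <= n)%N -> nm (z - b) < r -> nm (un n z - g z) <= e) ->
  dv g b != 0 -> (forall n z, nm (z - b) < r -> (K z <-> K (un n z))) ->
  (forall n d, 0 < d -> exists w, nm (w - b) < d /\ un n w <> un n.+1 w) ->
  exists Omega : set C, Omega `<=` V /\ product_piece K Omega.
Proof.
move=> cK iK r0 bV hG Kb Gb l01 KG hun cvg dgb Kun diff.
have hg : hol b r g := hol_limit hun cvg.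
have [r1 [f [r10 r1r hf [fb df] fG]]] := koenigs r0 hG Gb l01.
set l := dv G b in l01 fG.
have [|q [q0 qr1 nl]] := near_linear_ex r10 hf; first by rewrite df oner_neq0.
rewrite df in nl.
have qr : q <= r by exact: le_trans r1r.
have [k [hk kP klip]] := local_inverse q0 (oner_neq0 _) (hol_le hf qr1) nl.
rewrite fb nm1 mul1r in hk kP klip.
pose rho := q / 4; rewrite -/rho in hk kP klip.
have rho0 : 0 < rho by rewrite /rho divr_gt0.
have kf w : nm w < rho -> f (k w) = w /\ nm (k w - b) < q.
  move=> wr; have [|h1 h2] := kP w; first by rewrite subr0.
  split => //; apply: le_lt_trans h2 _; rewrite divr1 subr0; move: wr; rewrite /rho; lra.
have finj z w : nm (z - b) < q -> nm (w - b) < q -> f z = f w -> z = w.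
  by move=> zq wq; exact: near_linear_inj (oner_neq0 _) nl zq wq.
have bq : nm (b - b) < q by exact: nm_aa.
have fk z : nm (z - b) < q -> nm (f z) < rho -> k (f z) = z.
  by move=> zq fr; have [h1 h2] := kf _ fr; apply: finj.
have k0 : k 0 = b by rewrite -fb; apply: fk => //; rewrite fb nm0.
have f_small d : 0 < d -> exists2 s, 0 < s & forall z, nm (z - b) < s -> nm (z - b) < q /\ nm (f z) < d.
  move=> d0; have [m fm] := hf b (nm_aa b r10).
  have [s s0 sP] := cder_cont fm d0; exists (Num.min s q); first by rewrite lt_min s0.
  by move=> z; rewrite lt_min => /andP[/sP + zq]; rewrite fb subr0.
pose P w := K (k w).
have Pl : scaling_invariant P l rho.
  move=> w wr; have [h1 h2] := kf w wr.
  have [h3 h4] := fG (k w) (lt_le_trans h2 qr1); rewrite h1 in h4.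
  have lw : nm (l * w) < rho.
    case/andP: l01 => _ l1; rewrite nmM; apply: le_lt_trans wr.
    by rewrite ler_piMl ?nm_ge0 // ltW.
  rewrite /P (KG _ (lt_le_trans h2 qr)) -h4 fk //; last by rewrite h4.
  exact: le_lt_trans h2.
have Pcl z : nm z < rho -> (forall e, 0 < e -> exists2 w, nm (w - z) <= e & P w) -> P z.
  move=> zr H; apply: cK; apply/closure_nmP => e e0.
  pose m := Num.min (e / 4) ((rho - nm z) / 2).
  have m0 : 0 < m by rewrite lt_min !divr_gt0 // subr_gt0.
  have [w wm Pw] := H m m0.
  have w1 : nm (w - z) <= e / 4 by apply: le_trans wm _; rewrite ge_min lexx.
  have w2 : nm (w - z) <= (rho - nm z) / 2 by apply: le_trans wm _; rewrite ge_min lexx orbT.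
  have wr : nm w < rho.
    by rewrite -(subrK z w); apply: le_lt_trans (nmD _ _) _; lra.
  exists (k w) => //; have := klip w z; rewrite !subr0 divr1 => /(_ wr zr); lra.
have acc d : 0 < d -> exists y, [/\ P y, y != 0 & nm y < d].
  move=> d0; have m0 : 0 < Num.min d rho by rewrite lt_min d0.
  have [s s0 sP] := f_small _ m0.
  have [y [Ky yb ys]] := not_isolated iK Kb s0.
  have [yq] := sP y ys; rewrite lt_min => /andP[yd yr].
  exists (f y); split => //; first by rewrite /P fk.
  by apply/eqP => fy; case/eqP: yb; apply: finj => //; rewrite fb.
have hkb w : nm (w - 0) < rho -> nm (k w - b) < r.
  by rewrite subr0 => /kf[_]; lra.
have hv n : hol 0 rho (fun w => un n (k w)) by exact: hol_comp hk (hun n) hkb.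
have vcvg e : 0 < e -> exists N, forall n z, (N <= n)%N -> nm (z - 0) < rho ->
    nm (un n (k z) - g (k z)) <= e.
  by move=> /cvg[N NP]; exists N => n z Nn /hkb; exact: NP.
(* Since [f (k w) = w] near [0], the derivative of [k] at [0] cannot vanish, and [g'(b)] is
   nonzero. *)
have dv0 : dv (fun w => g (k w)) 0 != 0.
  have [m km] := hk 0 (nm_aa 0 rho0); have [c fc] := hf b (nm_aa b r10).
  have [c' gc] := hg b (nm_aa b r0).
  have m0 : m != 0.
    have h1 : cder (fun w => f (k w)) 0 (c * m) by apply: cder_comp; rewrite ?k0.
    have h2 : cder (fun w => f (k w)) 0 1.
      apply: (cder_near rho0 _ (cder_id 0)) => w; rewrite subr0 => /kf[-> _].
      by [].
    apply/eqP => m0; have := cder_uniq h1 h2; rewrite m0 mulr0 => /eqP.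
    by rewrite eq_sym oner_eq0.
  have h1 : cder (fun w => g (k w)) 0 (c' * m) by apply: cder_comp; rewrite ?k0.
  by rewrite (dvE h1) mulf_neq0 // -(dvE gc).
have PK n w : nm (w - 0) < rho -> (P w <-> K (un n (k w))).
  by move=> /hkb; exact: Kun.
have vdiff n d : 0 < d -> exists w, nm (w - 0) < d /\ un n (k w) <> un n.+1 (k w).
  move=> d0; have m0 : 0 < Num.min d rho by rewrite lt_min d0.
  have [s s0 sP] := f_small _ m0; have [z [zs zn]] := diff n s s0.
  have [zq] := sP z zs; rewrite lt_min => /andP[zd zr].
  by exists (f z); rewrite subr0 fk.
have [s [s0 srho trans]] := transitions rho0 hv vcvg dv0 PK vdiff.
have Pls : scaling_invariant P l s by move=> w ws; apply: Pl; exact: lt_le_trans srho.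
have Pcls z : nm z < s -> (forall e, 0 < e -> exists2 w, nm (w - z) <= e & P w) -> P z.
  by move=> zs; apply: Pcl; exact: lt_le_trans srho.
have [z0 [q' [d [g' [h [[Pz0 q'0 zq d0] [hg' g'inj hh [h0 gh] flow]]]]]]] :=
  flow_near_attracting_point s0 l01 Pls Pcls acc trans.
have h_in y : nm y < d -> nm (h y) < rho.
  move=> /gh[_ hy]; rewrite -(subrK z0 (h y)); apply: le_lt_trans (nmD _ _) _; lra.
(* The domain of the composite chart [g' (f z)]: both factors are injective there. *)
pose N : set C := [set z | nm (z - b) < q /\ nm (f z - z0) < q'].
have fq z : nm (z - b) < q -> exists m, cder f z m by move=> zq'; apply: hf; lra.
have [|||||||||Omega [ON OP]] := @product_piece_chart R K N (fun z => g' (f z)) (fun y => k (h y)) d.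
- apply/open_nmP => z [z1 z2]; have [m fm] := fq z z1.
  have [|s1 s10 s1P] := cder_cont fm (_ : 0 < q' - nm (f z - z0)); first by rewrite subr_gt0.
  exists (Num.min s1 (q - nm (z - b))) => [|w]; first by rewrite lt_min s10 subr_gt0.
  rewrite lt_min => /andP[/s1P w1 w2]; split.
    by apply: le_lt_trans (nm_tri z _ _) _; lra.
  by apply: le_lt_trans (nm_tri (f z) _ _) _; lra.
- move=> z [z1 z2]; have [m fm] := fq z z1; have [c gc] := hg' _ z2.
  by exists (c * m); exact: cder_comp.
- move=> z w [z1 z2] [w1 w2] E; apply: finj => //; exact: g'inj E.
- by [].
- by apply: (hol_comp hh hk) => y; rewrite !subr0; exact: h_in.
- by move=> y yd; have [h1 h2] := kf _ (h_in y yd); rewrite /N /= h1; have [h3 h4] := gh y yd.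
- exact: cK.
- by rewrite h0.
- exact: flow.
exists Omega; split => // z /ON[zq' _]; apply: bV; lra.
Qed.

End Main.

Theorem theorem2p3 (R : realType) (K U : set (R[i]^o))
    (K_compact : compact K) (K_no_isolated : isolated K = set0)
    (U_domain : domain U) (K_Jlike : J_like K U) :
  (forall F : set (R[i]^o -> R[i]^o),
      (forall H, F H -> symmetry K U H) -> nontrivial_family U F ->
      finite_family U F)
  \/
  (forall V : set (R[i]^o), open V -> V `<=` U -> V `&` K !=set0 ->
      exists Omega : set (R[i]^o),
        Omega `<=` V /\ product_piece K Omega).
Proof.
have [|notfin] := pselect (forall F : set (R[i]^o -> R[i]^o),
  (forall H, F H -> symmetry K U H) -> nontrivial_family U F -> finite_family U F).
  by left.
right=> V oV VU [x [Vx Kx]].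
move/existsNP: notfin => [F /not_implyP[Fsym /not_implyP[[Fnormal Fnc] Finf]]].
have [v [Fv vdist]] := distinct_sequence Finf.
have [phi [phimono [g vg]]] := Fnormal v Fv.
pose u n := v (phi n).
have Fu n : F (u n) by exact: Fv.
have gnc := Fnc _ g Fu vg.
have cK : closed K by apply: compact_closed => //; exact: norm_hausdorff.
have uU n z : U z -> exists l, cder (u n) z l by exact: (symmetry_cder (Fsym _ (Fu n))).
have oU := (open_nmP U).1 U_domain.1.
have local a r : 0 < r -> (forall z, nm (z - a) < 3 * r -> U z) ->
    forall n, hol a r (u n).
  by move=> r0 aU n z za; apply/uU/aU; lra.
have hg z : U z -> exists l, cder g z l.
  move=> Uz; have [r r0 rU] := oU z Uz.
  have r30 : 0 < r / 3 by rewrite divr_gt0.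
  have r3U w : nm (w - z) < 3 * (r / 3) -> U w by move=> wz; apply: rU; lra.
  exact: (hol_limit (local _ _ r30 r3U) (uniform_on_disc r30 vg r3U) (nm_aa z r30)).
have [b [Vb Kb [D [G [symG Db [Gb l01]]]] dgb]] :=
  attracting_point_regular K_no_isolated K_Jlike U_domain oV VU Vx Kx hg gnc.
have [r1 r10 r1V] := (open_nmP V).1 oV b Vb.
have [domD _ _ _] := symG; have [r2 r20 r2D] := (open_nmP D).1 domD.1 b Db.
(* The triple disc must lie in [U] for uniform convergence on the disc of radius [r], which must
   also lie in the domain [D] of [G]. *)
pose r := Num.min r1 r2 / 3.
have m0 : 0 < Num.min r1 r2 by rewrite lt_min r10.
have r0 : 0 < r by rewrite divr_gt0.
have r31 : 3 * r <= r1 by rewrite /r mulrC mulfVK ?ge_min ?lexx // pnatr_eq0.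
have r32 : r <= r2.
  have : 3 * r <= r2 by rewrite /r mulrC mulfVK ?ge_min ?lexx ?orbT // pnatr_eq0.
  lra.
have r3U z : nm (z - b) < 3 * r -> U z by move=> zb; apply/VU/r1V; lra.
have rU z : nm (z - b) < r -> U z by move=> zb; apply: r3U; lra.
have rD z : nm (z - b) < r -> D z by move=> zb; apply: r2D; lra.
apply: (@product_piece_near R K V G b u g r) => //.
- by move=> z zb; apply: r1V; lra.
- by move=> z /rD; exact: (symmetry_cder symG).
- by move: l01; rewrite normE !ltcR.
- by move=> z /rD; exact: symmetryE symG.
- by move=> n; exact: local.
- exact: uniform_on_disc vg r3U.
- by move=> n z /rU; exact: symmetryE (Fsym _ (Fu n)).
(* If two consecutive maps agreed near [b], the identity theorem would make them agree on [U]; but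
   [phi] is strictly increasing, so they are distinct terms of [v]. *)
- move=> n d d0; apply: contrapT => H.
  have [|z Uz] := vdist (phi n) (phi n.+1).
    by have := phimono n n.+1 (ltnSn n) => + E; rewrite E ltnn.
  apply; apply: (identity_theorem2 U_domain (uU n) (uU n.+1) _ Uz).
  exists b; first exact: VU.
  exists d => // w wd; apply: contrapT => neq; apply: H; by exists w.
Qed.
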